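(* Let $\alpha,\beta\ge-1/2$ and $1<p<\infty$. If there exists $C>0$ such that $\Vert u\,S_n(u^{-1}f)\Vert_{L^{p,\infty}(d\nu)}\le C\Vert f\Vert_{L^p(d\nu)}$ for every $n\ge0$ and $f\in L^p(d\nu)$, then $$\Big|a+(\alpha+1)\Big(\frac1p-\frac12\Big)\Big|<\frac14\quad\text{and}\quad\Big|b+(\beta+1)\Big(\frac1p-\frac12\Big)\Big|<\frac14.$$
   Context: $d\nu=(1-x)^\alpha(1+x)^\beta dx+\sum_{i=1}^kM_i\delta_{a_i}$ on $[-1,1]$, with $a_1,\dots,a_k\in[-1,1]$ distinct and $M_i>0$. $(P_n)$ are the orthonormal polynomials for $\nu$, $L_n(x,y)=\sum_{j=0}^nP_j(x)P_j(y)$, $S_nf(x)=\int L_n(x,y)f(y)\,d\nu(y)$. The weight is $u(x)=(1-x)^a(1+x)^b$ for $x\in(-1,1)$ ($a,b\in\mathbb R$), with $0<u(\pm1)<\infty$. $L^{p,\infty}(d\nu)$ is the weak $L^p$ space with quasinorm $\sup_{t>0}t^{1/p}f^*(t)$, $f^*$ the nonincreasing rearrangement with respect to $\nu$. *)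

(* Defs.v *)
From HB Require Import structures.
From mathcomp Require Import all_boot all_order all_algebra.
From mathcomp Require Import all_classical all_reals all_analysis.
Set Implicit Arguments. Unset Strict Implicit. Unset Printing Implicit Defensive.
Import Order.TTheory GRing.Theory Num.Theory.
Import numFieldNormedType.Exports.
Local Open Scope classical_set_scope.
Local Open Scope ring_scope.

Section JacobiMeasure.
Variable R : realType.

Definition jacobi_w (alpha beta : R) (x : R) : R :=
  ((1 - x) `^ alpha) * ((1 + x) `^ beta).

(* integral of f against
   dnu = (1-x)^alpha (1+x)^beta dx on [-1,1] + sum_i M_i delta_{a_i} *)
Definition nu_int (alpha beta : R) (k : nat) (pts M : 'I_k -> R)
  (f : R -> R) : \bar R :=
  ((\int[@lebesgue_measure R]_(x in `[(-1)%R, 1%R]) (f x * jacobi_w alpha beta x)%:E)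
   + \sum_(i < k) (M i * f (pts i))%:E)%E.

Definition nu_set (alpha beta : R) (k : nat) (pts M : 'I_k -> R)
  (A : set R) : \bar R :=
  ((\int[@lebesgue_measure R]_(x in `[(-1)%R, 1%R] `&` A) (jacobi_w alpha beta x)%:E)
   + \sum_(i < k) (M i * \1_A (pts i))%:E)%E.

Definition nu_integrable (alpha beta : R) (k : nat) (pts M : 'I_k -> R)
  (h : R -> R) : Prop :=
  measurable_fun setT h /\
  (nu_int alpha beta pts M (fun x => `|h x|%R) < +oo)%E.

Definition in_Lp (alpha beta : R) (k : nat) (pts M : 'I_k -> R) (p : R)
  (f : R -> R) : Prop :=
  measurable_fun setT f /\
  (nu_int alpha beta pts M (fun x => (`|f x| `^ p)%R) < +oo)%E.

(* ||f||_{L^p(dnu)} (meaningful for f in L^p) *)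
Definition Lp_norm (alpha beta : R) (k : nat) (pts M : 'I_k -> R) (p : R)
  (f : R -> R) : R :=
  (fine (nu_int alpha beta pts M (fun x => (`|f x| `^ p)%R))) `^ p^-1.

Definition rearrangement (alpha beta : R) (k : nat) (pts M : 'I_k -> R)
  (f : R -> R) (t : R) : \bar R :=
  ereal_inf [set s%:E | s in
     [set s : R | 0 <= s /\
        (nu_set alpha beta pts M [set x | (s < `|f x|)%R] <= t%:E)%E]].

Definition weak_Lp_norm (alpha beta : R) (k : nat) (pts M : 'I_k -> R) (p : R)
  (f : R -> R) : \bar R :=
  ereal_sup [set ((t `^ p^-1)%:E * rearrangement alpha beta pts M f t)%E
            | t in [set t : R | 0 < t]].

Definition orthonormal_polys (alpha beta : R) (k : nat) (pts M : 'I_k -> R)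
  (P : nat -> {poly R}) : Prop :=
  (forall n, size (P n) = n.+1) /\
  (forall n, 0 < lead_coef (P n)) /\
  (forall i j, nu_int alpha beta pts M (fun x => (P i).[x] * (P j).[x])
               = ((i == j)%:R)%:E).

Definition kernelL (P : nat -> {poly R}) (n : nat) (x y : R) : R :=
  \sum_(j < n.+1) (P j).[x] * (P j).[y].

Definition partial_sum (alpha beta : R) (k : nat) (pts M : 'I_k -> R)
  (P : nat -> {poly R}) (n : nat) (g : R -> R) (x : R) : R :=
  fine (nu_int alpha beta pts M (fun y => kernelL P n x y * g y)).

Definition weight_u (a b u1 um1 : R) (x : R) : R :=
  if x == 1 then u1 else if x == -1 then um1
  else ((1 - x) `^ a) * ((1 + x) `^ b).

End JacobiMeasure.

(* Main.v *)
(** Put [x = sg * cos th] with [sg = 1] or [sg = -1] according to the endpoint under study.  The measure becomes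
    [omega th * dth] plus point masses, [omega = (1 - cos th)^s * (1 + cos th)^t], where [s = alpha + 1/2] and
    [t = beta + 1/2] (exchanged when [sg = -1]).

    Asymptotics.  Approximating the Szego function by polynomials, with extra factors that vanish at the mass points,
    bounds the leading coefficient of [P n] from below.  Since the integral of [P n * sqrt omega * cos (N th - tau)]
    equals this leading coefficient up to an explicit constant ([N = n + (s + t)/2], [tau = s * pi/2]), it follows that
    [P n (cos th) * sqrt omega - sqrt (2/pi) * cos (N th - tau)] tends to 0 in L^2(dth).

    Upper bound on the exponent.  [S_n - S_(n-1)] has rank one.  Apply it to [u^-1 * K^(q-1) * cos (N th - tau)] cut off
    to [e <= th <= 1], where [K = u^-1 * omega^(-1/2)] and [q] is conjugate to [p].  On a fixed interval the image has the
    size of the integral of [K^q * omega] over [e, 1], so the weak-type bound keeps this integral bounded as [e] tends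
    to 0; it diverges when [a + (alpha + 1) (1/p - 1/2) >= 1/4].

    Lower bound.  Take now [K = u^-1 * omega^(-1/2) * sin / (1 - cos)] and the phase [sin (N th - tau)].  By the
    Christoffel-Darboux formula the image at angles [th ~ eta], with [eta] much smaller than [e], is a multiple of [P n]
    whose size is again the integral of [K^q * omega] over [e, 1].  Comparing with the weak-type bound as [n] grows, then
    letting [eta] and [e] tend to 0, excludes [a + (alpha + 1) (1/p - 1/2) <= -1/4]. *)

Require Import Defs.
From HB Require Import structures.
From mathcomp Require Import all_boot all_order all_algebra.
From mathcomp Require Import all_classical all_reals all_analysis.
From mathcomp Require Import complex measurable_realfun.
From mathcomp Require Import ring lra zify.
Import Order.TTheory GRing.Theory Num.Theory.
Import numFieldNormedType.Exports.
Local Open Scope classical_set_scope.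
Local Open Scope ring_scope.

(** * Integrals of continuous functions over [0, pi] *)

(** No pointwise asymptotics of the polynomials are proved, only convergence in L^2(dth). This
    suffices because the weak-type bound is tested with continuous functions: the oscillating factor
    of a test function is paired with [P n] by Cauchy-Schwarz, and the distribution function of a
    partial sum is bounded from below by a quadratic expression in its L^2 distance to the limiting
    cosine. The price is the order of the limits: the cutoffs e and eta are fixed while n tends to
    infinity, and they move only in the resulting inequalities, where n no longer occurs.

    Convergence in L^2 needs only a lower bound for the leading coefficients. The upper bound is
    Cauchy-Schwarz, since the weighted polynomials have norm at most 1 and their profiles have norms
    tending to 1.

    The critical exponents themselves are excluded because there the integral L of K^q * omega over
    [e, 1] still diverges logarithmically, while an inequality L^p <= const * L with p > 1 keeps L
    bounded. *)

Section Continuity.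
Context {R : realType}.
Implicit Types f g : R -> R.

(** A separate head symbol for continuity on the whole line lets the tactic [cont] recurse on the
    shape of a function; with continuous integrands, integrability over [0, pi] is never a separate
    question. *)
Definition contf f : Prop := continuous f.

Lemma contD f g : contf f -> contf g -> contf (fun x => f x + g x).
Proof. by move=> cf cg x; apply: continuousD; [exact: cf|exact: cg]. Qed.
Lemma contB f g : contf f -> contf g -> contf (fun x => f x - g x).
Proof. by move=> cf cg x; apply: continuousB; [exact: cf|exact: cg]. Qed.
Lemma contN f : contf f -> contf (fun x => - f x).
Proof. by move=> cf x; apply: continuousN; exact: cf. Qed.
Lemma contM f g : contf f -> contf g -> contf (fun x => f x * g x).
Proof. by move=> cf cg x; apply: continuousM; [exact: cf|exact: cg]. Qed.
Lemma contX f n : contf f -> contf (fun x => f x ^+ n).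
Proof. by move=> cf x; apply: (@continuous_comp _ _ _ f (fun y => y ^+ n)); [exact: cf|exact: exprn_continuous]. Qed.
Lemma cont_cst (c : R) : contf (fun _ => c).
Proof. by move=> x; exact: cvg_cst. Qed.
Lemma cont_id : contf (fun x => x).
Proof. by move=> x; exact: cvg_id. Qed.
Lemma cont_comp f g : contf g -> contf f -> contf (fun x => g (f x)).
Proof. by move=> cg cf x; apply: continuous_comp; [exact: cf|exact: cg]. Qed.
Lemma cont_norm f : contf f -> contf (fun x => `|f x|).
Proof. by move=> cf x; apply: (continuous_comp (cf x)); exact: norm_continuous. Qed.
Lemma cont_cos f : contf f -> contf (fun x => cos (f x)).
Proof. by apply: cont_comp; exact: continuous_cos. Qed.
Lemma cont_sin f : contf f -> contf (fun x => sin (f x)).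
Proof. by apply: cont_comp; exact: continuous_sin. Qed.
Lemma cont_sqrt f : contf f -> contf (fun x => Num.sqrt (f x)).
Proof. by apply: cont_comp; exact: sqrt_continuous. Qed.
Lemma cont_max f g : contf f -> contf g -> contf (fun x => Num.max (f x) (g x)).
Proof. by move=> cf cg x; apply: continuous_max; [exact: cf|exact: cg]. Qed.
Lemma cont_min f g : contf f -> contf g -> contf (fun x => Num.min (f x) (g x)).
Proof. by move=> cf cg x; apply: continuous_min; [exact: cf|exact: cg]. Qed.
Lemma cont_sum (J : Type) (r : seq J) (P : pred J) (F : J -> R -> R) :
  (forall i, P i -> contf (F i)) -> contf (fun x => \sum_(i <- r | P i) F i x).
Proof.
move=> cF x; elim: r => [|i r IH].
  by under eq_fun do rewrite big_nil; exact: cvg_cst.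
under eq_fun do rewrite big_cons; case: ifP => [Pi|//].
by apply: continuousD; [exact: cF|].
Qed.
Lemma cont_horner (p : {poly R}) f : contf f -> contf (fun x => p.[f x]).
Proof. by apply: cont_comp; exact: continuous_horner. Qed.
Lemma cont_powR f r : (forall x, 0 < f x) -> contf f -> contf (fun x => f x `^ r).
Proof.
move=> f0 cf x; apply: (@continuous_comp _ _ _ f (fun y => y `^ r)); first exact: cf.
apply: differentiable_continuous; apply/derivable1_diffP.
by apply: derivable_powR; rewrite in_itv/= f0.
Qed.
Lemma cont_inv f : (forall x, f x != 0) -> contf f -> contf (fun x => (f x)^-1).
Proof. by move=> f0 cf x; apply: continuousV; [exact: f0|exact: cf]. Qed.

Lemma cont_mull (c : R) : contf ( *%R c).
Proof. exact: (contM _ _ (cont_cst c) cont_id). Qed.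
Lemma cont_addl (c : R) : contf (+%R c).
Proof. exact: (contD _ _ (cont_cst c) cont_id). Qed.
Lemma cont_cos1 : contf (@cos R).
Proof. exact: continuous_cos. Qed.
Lemma cont_sin1 : contf (@sin R).
Proof. exact: continuous_sin. Qed.

(** [powR] has only a conventional value at negative bases, so the base is truncated at 0. *)
Lemma powR_continuous_ge0 (r : R) : 0 <= r -> continuous (fun x : R => (Num.max x 0) `^ r).
Proof.
rewrite le_eqVlt => /predU1P[<-|r0].
  by under eq_fun do rewrite powRr0; exact: cont_cst.
move=> x.
have [x0|x0|->] := ltgtP x 0; last first.
- rewrite /continuous_at maxxx powR0 ?gt_eqF//.
  apply/cvgrPdist_le => e e0.
  have /cvgrPdist_le /(_ e e0) := powR_cvg0 r0.
  move=> [d /= d0 H]; exists d => //= y /= yd.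
  rewrite sub0r normrN; have [y0|y0] := leP y 0.
    by rewrite powR0 ?gt_eqF// normr0 ltW.
  by have := H y yd y0; rewrite sub0r normrN.
- have : {for x, continuous (fun y : R => y `^ r)}.
    apply: differentiable_continuous; apply/derivable1_diffP.
    by apply: derivable_powR; rewrite in_itv/= x0.
  rewrite /continuous_at (max_idPl (ltW x0)); apply: cvg_trans.
  apply: near_eq_cvg; near=> y; rewrite (max_idPl _)//.
  by apply/ltW; near: y; exact: lt_nbhsr.
- rewrite /continuous_at (max_idPr (ltW x0)).
  apply: (@cvg_near_cst); near=> y; rewrite (max_idPr _)//.
  by apply/ltW; near: y; exact: lt_nbhsl.
Unshelve. all: by end_near. Qed.
Lemma cont_powR_ge0 f r : (forall x, 0 <= f x) -> 0 <= r -> contf f ->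
  contf (fun x => f x `^ r).
Proof.
move=> f0 r0 cf.
have -> : (fun x => f x `^ r) = (fun x => (fun y => (Num.max y 0) `^ r) (f x)).
  by apply/funext => x /=; rewrite (max_idPl _).
exact: (cont_comp _ _ (powR_continuous_ge0 _ r0) cf).
Qed.
End Continuity.

Ltac cont := repeat first
  [ match goal with
    | H : contf ?f |- contf ?f => exact H
    | H : contf ?f |- contf (fun x => ?f x) => exact H
    end
  | lazymatch goal with
    | |- contf (fun x => (@?f x + @?g x)%R) => refine (contD f g _ _)
    | |- contf (fun x => (- @?f x)%R) => refine (contN f _)
    | |- contf (fun x => (@?f x * @?g x)%R) => refine (contM f g _ _)
    | |- contf (fun x => (@?f x ^+ _)%R) => refine (contX f _ _)
    | |- contf (fun x => (`|@?f x|)%R) => refine (cont_norm f _)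
    | |- contf (fun x => cos (@?f x)) => refine (cont_cos f _)
    | |- contf (fun x => sin (@?f x)) => refine (cont_sin f _)
    | |- contf (fun x => Num.sqrt (@?f x)) => refine (cont_sqrt f _)
    | |- contf (fun x => Num.max (@?f x) (@?g x)) => refine (cont_max f g _ _)
    | |- contf (fun x => Num.min (@?f x) (@?g x)) => refine (cont_min f g _ _)
    | |- contf (fun x => horner _ (@?f x)) => refine (cont_horner _ f _)
    | |- contf (fun x => \sum_(i <- _ | _) _) => apply: cont_sum; let i := fresh "i" in let Hi := fresh "Hi" in move=> i Hi
    end
  | exact: cont_cst | exact: cont_id | exact: cont_mull | exact: cont_addl | exact: cont_cos1 | exact: cont_sin1
  | assumption ].

Section IntegralPi.
Context {R : realType}.
Implicit Types f g h : R -> R.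

Definition Ipi f : R := \int[@lebesgue_measure R]_(x in `[0, pi]) f x.

Lemma continuous_integrable_itv f (a b : R) : contf f ->
  (@lebesgue_measure R).-integrable `[a, b] (EFin \o f).
Proof.
move=> cf; apply: continuous_compact_integrable; first exact: segment_compact.
apply: continuous_subspaceT; exact: cf.
Qed.

Lemma eq_Ipi f g : (forall x, 0 <= x <= pi -> f x = g x) -> Ipi f = Ipi g.
Proof.
move=> fg; apply: eq_Rintegral => x; rewrite inE/= in_itv/= => xp; exact: fg.
Qed.

Lemma IpiD f g : contf f -> contf g ->
  Ipi (fun x => f x + g x) = Ipi f + Ipi g.
Proof. by move=> cf cg; apply: RintegralD => //; exact: continuous_integrable_itv. Qed.

Lemma IpiB f g : contf f -> contf g ->
  Ipi (fun x => f x - g x) = Ipi f - Ipi g.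
Proof. by move=> cf cg; apply: RintegralB => //; exact: continuous_integrable_itv. Qed.

Lemma IpiZ c f : contf f -> Ipi (fun x => c * f x) = c * Ipi f.
Proof. by move=> cf; apply: RintegralZl => //; exact: continuous_integrable_itv. Qed.

Lemma Ipi_cst c : Ipi (fun _ => c) = c * pi.
Proof.
have E : (@lebesgue_measure R) `[0, pi]%classic = pi%:E.
  by rewrite lebesgue_measure_itv/= lte_fin pi_gt0 -EFinD subr0.
by rewrite /Ipi Rintegral_cst//; congr (_ * _); exact: (congr1 fine E).
Qed.

Lemma Ipi_sum (J : Type) (r : seq J) (P : pred J) (F : J -> R -> R) :
  (forall i, P i -> contf (F i)) ->
  Ipi (fun x => \sum_(i <- r | P i) F i x) = \sum_(i <- r | P i) Ipi (F i).
Proof.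
move=> cF; elim: r => [|i r IH].
  rewrite big_nil -[RHS](mul0r pi) -Ipi_cst.
  by apply: eq_Ipi => x _; rewrite big_nil.
rewrite big_cons -IH; case: ifP => [Pi|Pi].
  rewrite -IpiD; [|exact: cF|exact: cont_sum].
  by apply: eq_Ipi => x _; rewrite big_cons Pi.
by apply: eq_Ipi => x _; rewrite big_cons Pi.
Qed.

Lemma Ipi_ge0 f : (forall x, 0 <= x <= pi -> 0 <= f x) -> 0 <= Ipi f.
Proof. by move=> f0; apply: Rintegral_ge0 => x; rewrite /= in_itv/= => /f0. Qed.

Lemma le_Ipi f g : contf f -> contf g ->
  (forall x, 0 <= x <= pi -> f x <= g x) -> Ipi f <= Ipi g.
Proof.
move=> cf cg fg; apply: le_Rintegral => //; try exact: continuous_integrable_itv.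
Qed.

Lemma Ipi_norm f : contf f -> `|Ipi f| <= Ipi (fun x => `|f x|).
Proof. by move=> cf; apply: le_normr_Rintegral => //; exact: continuous_integrable_itv. Qed.

Lemma Ipi_cauchy_schwarz f g : contf f -> contf g ->
  Ipi (fun x => f x * g x) ^+ 2 <= Ipi (fun x => f x ^+ 2) * Ipi (fun x => g x ^+ 2).
Proof.
move=> cf cg.
set A := Ipi (fun x => f x ^+ 2); set B := Ipi (fun x => g x ^+ 2).
set X := Ipi _.
have H t s : 0 <= s ^+ 2 * A - 2 * s * t * X + t ^+ 2 * B.
  have -> : s ^+ 2 * A - 2 * s * t * X + t ^+ 2 * B
      = Ipi (fun x => (s * f x - t * g x) ^+ 2).
    rewrite -IpiZ; last by cont. rewrite -IpiZ; last by cont. rewrite -IpiZ; last by cont.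
    rewrite -IpiB; [|by cont|by cont]; rewrite -IpiD; [|by cont|by cont].
    by apply: eq_Ipi => x _; ring.
  by apply: Ipi_ge0 => x _; exact: sqr_ge0.
have A0 : 0 <= A by apply: Ipi_ge0 => x _; exact: sqr_ge0.
have B0 : 0 <= B by apply: Ipi_ge0 => x _; exact: sqr_ge0.
have [BE|Bn] := eqVneq B 0.
  rewrite BE mulr0; have [->|Xn] := eqVneq X 0; first by rewrite expr0n.
  (* With B = 0 and s = 1 the form is affine in t; this t gives it the value -1. *)
  have := H ((A + 1) / (2 * X)) 1; rewrite BE mulr0 addr0 expr1n mul1r.
  have -> : A - 2 * 1 * ((A + 1) / (2 * X)) * X = -1 by field.
  by move=> ?; lra.
(* The minimising ratio t / s = X / B. *)
have := H X B; rewrite (_ : _ + _ = B * (B * A - X ^+ 2)); last by ring.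
by rewrite pmulr_rge0 ?lt_def ?Bn// subr_ge0 mulrC.
Qed.

Lemma sin_mulrn_pi n : sin (n%:R * pi) = 0 :> R.
Proof.
elim: n => [|n IH]; first by rewrite mul0r sin0.
by rewrite -natr1 mulrDl mul1r sinDpi IH oppr0.
Qed.

Lemma Ipi_derive f F : contf f -> (forall x : R, is_derive x 1 F (f x)) ->
  Ipi f = F pi - F 0.
Proof.
move=> cf dF; rewrite /Ipi /Rintegral (@continuous_FTC2 _ f F)//=.
- exact: pi_gt0.
- apply: continuous_subspaceT; exact: cf.
- have cF x : {for x, continuous F}.
    by apply: differentiable_continuous; apply/derivable1_diffP; exact: ex_derive.
  split; first by move=> x _; exact: ex_derive.
  - exact/cvg_at_right_filter/cF.
  - exact/cvg_at_left_filter/cF.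
- by move=> x _; rewrite derive1E; exact: derive_val.
Qed.

Lemma Ipi_coslin (l m : R) : l != 0 ->
  Ipi (fun x => cos (l * x + m)) = (sin (l * pi + m) - sin m) / l.
Proof.
move=> l0.
have dF (x : R) : is_derive x 1 (fun x => l^-1 * sin (l * x + m)) (cos (l * x + m)).
  by apply: is_derive_eq; rewrite /GRing.scale/=; field.
have cf : contf (fun x => cos (l * x + m)) by cont.
by rewrite (Ipi_derive _ _ cf dF) mulr0 add0r; field.
Qed.

Lemma Ipi_cos_nat n : Ipi (fun x => cos (n%:R * x)) = if n == 0%N then pi else 0.
Proof.
case: ifP => [/eqP ->|n0].
  rewrite -[RHS]mul1r -Ipi_cst; apply: eq_Ipi => x _; by rewrite mul0r cos0.
have n0' : (n%:R : R) != 0 by rewrite pnatr_eq0 n0.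
have := Ipi_coslin n%:R 0 n0'.
rewrite addr0 sin0 subr0 sin_mulrn_pi mul0r => <-.
by apply: eq_Ipi => x _; rewrite addr0.
Qed.

Lemma cosMcos (x y : R) : cos x * cos y = 2^-1 * (cos (x + y) + cos (x - y)).
Proof. by rewrite cosD cosB; field. Qed.
Lemma sinMsin (x y : R) : sin x * sin y = 2^-1 * (cos (x - y) - cos (x + y)).
Proof. by rewrite cosB cosD; field. Qed.

Lemma Ipi_cos_natB m n : Ipi (fun x => cos (m%:R * x - n%:R * x)) = if m == n then pi else 0.
Proof.
have [->|mn] := eqVneq m n.
  rewrite -[RHS]mul1r -Ipi_cst; apply: eq_Ipi => x _; by rewrite subrr cos0.
wlog le_mn : m n mn / (n <= m)%N.
  move=> H; have [|/ltnW nm] := leqP n m; first exact: H.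
  rewrite -(H n m) 1?eq_sym//; apply: eq_Ipi => x _.
  by rewrite -cosN opprB.
rewrite -[RHS](_ : (if (m - n)%N == 0%N then pi else 0) = 0); last first.
  by rewrite subn_eq0 leqNgt ltn_neqAle eq_sym mn le_mn.
rewrite -Ipi_cos_nat; apply: eq_Ipi => x _.
by rewrite natrB// mulrBl.
Qed.

Lemma Ipi_cos_natD m n : Ipi (fun x => cos (m%:R * x + n%:R * x)) = if (m + n == 0)%N then pi else 0.
Proof.
by rewrite -Ipi_cos_nat; apply: eq_Ipi => x _; rewrite natrD mulrDl.
Qed.

Lemma Ipi_coscos m n : Ipi (fun x => cos (m.+1%:R * x) * cos (n.+1%:R * x)) = if m == n then pi / 2 else 0.
Proof.
transitivity (Ipi (fun x => 2^-1 * (cos (m.+1%:R * x + n.+1%:R * x) + cos (m.+1%:R * x - n.+1%:R * x)))).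
  by apply: eq_Ipi => x _; rewrite cosMcos.
rewrite IpiZ; last by cont.
rewrite IpiD; [|by cont|by cont].
by rewrite Ipi_cos_natD Ipi_cos_natB eqSS/= add0r; case: ifP => _; rewrite ?mulr0 // mulrC.
Qed.

Lemma Ipi_sinsin m n : Ipi (fun x => sin (m.+1%:R * x) * sin (n.+1%:R * x)) = if m == n then pi / 2 else 0.
Proof.
transitivity (Ipi (fun x => 2^-1 * (cos (m.+1%:R * x - n.+1%:R * x) - cos (m.+1%:R * x + n.+1%:R * x)))).
  by apply: eq_Ipi => x _; rewrite sinMsin.
rewrite IpiZ; last by cont.
rewrite IpiB; [|by cont|by cont].
by rewrite Ipi_cos_natD Ipi_cos_natB eqSS/= subr0; case: ifP => _; rewrite ?mulr0 // mulrC.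
Qed.

(** Bessel's inequality bounds the sum of the squared coefficients, so they tend to 0. This gives
    the Riemann-Lebesgue lemma for continuous functions with no density argument. *)
Lemma bessel_cvg0 (e : nat -> R -> R) (c : R) h : 0 < c -> (forall n, contf (e n)) -> contf h ->
  (forall m n, Ipi (fun x => e m x * e n x) = if m == n then c else 0) ->
  (fun n => Ipi (fun x => h x * e n x)) @ \oo --> 0.
Proof.
move=> c0 ce ch orth; set a := fun n => Ipi _.
have bound N : \sum_(n < N) a n ^+ 2 <= c * Ipi (fun x => h x ^+ 2).
  pose S x := \sum_(n < N) (a n / c) * e n x.
  have cS : contf S by apply: cont_sum => i _; cont; exact: ce.
  have chS : Ipi (fun x => h x * S x) = c^-1 * \sum_(n < N) a n ^+ 2.
    transitivity (Ipi (fun x => \sum_(n < N) (a n / c) * (h x * e n x))).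
      apply: eq_Ipi => x _; rewrite mulr_sumr; apply: eq_bigr => i _; ring.
    rewrite Ipi_sum; last by move=> i _; cont; exact: ce.
    rewrite mulr_sumr; apply: eq_bigr => i _.
    by rewrite IpiZ; [rewrite -/(a i); ring|cont; exact: ce].
  have cSS : Ipi (fun x => S x ^+ 2) = c^-1 * \sum_(n < N) a n ^+ 2.
    transitivity (Ipi (fun x => \sum_(n < N) (a n / c) * (\sum_(m < N) (a m / c) * (e n x * e m x)))).
      apply: eq_Ipi => x _; rewrite expr2 {1}/S mulr_suml; apply: eq_bigr => i _.
      by rewrite -mulrA; congr (_ * _); rewrite mulr_sumr; apply: eq_bigr => j _; ring.
    rewrite Ipi_sum; last first.
      by move=> i _; cont => //; try exact: ce.
    rewrite mulr_sumr; apply: eq_bigr => i _.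
    rewrite IpiZ; last by cont; try exact: ce.
    rewrite Ipi_sum; last by move=> j _; cont; exact: ce.
    rewrite (bigD1 i)//= big1 => [|j ji].
      rewrite IpiZ; last by cont; exact: ce.
      by rewrite orth eqxx addr0; field; rewrite gt_eqF.
    rewrite IpiZ; last by cont; exact: ce.
    by rewrite orth eq_sym -val_eqE/= in ji *; rewrite (negbTE ji) mulr0.
  have : 0 <= Ipi (fun x => (h x - S x) ^+ 2) by apply: Ipi_ge0 => x _; exact: sqr_ge0.
  have -> : Ipi (fun x => (h x - S x) ^+ 2) =
      Ipi (fun x => h x ^+ 2) - 2 * Ipi (fun x => h x * S x) + Ipi (fun x => S x ^+ 2).
    rewrite -IpiZ; last by cont.
    rewrite -IpiB; [|by cont|by cont]. rewrite -IpiD; [|by cont|by cont].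
    by apply: eq_Ipi => x _; ring.
  rewrite chS cSS; set T := \sum_(n < N) _; set H := Ipi _ => K.
  have : c^-1 * T <= H by lra.
  by rewrite ler_pdivrMl.
have : cvgn (series (fun n => a n ^+ 2)).
  apply: nondecreasing_is_cvgn.
    by apply: nondecreasing_series => n _ _; exact: sqr_ge0.
  exists (c * Ipi (fun x => h x ^+ 2)) => _ [N _ <-].
  by rewrite /series/= big_mkord.
move=> /cvg_series_cvg_0 /cvgrPdist_lt a20.
apply/cvgrPdist_lt => eps eps0.
have := a20 (eps ^+ 2) (exprn_gt0 2 eps0); apply: filterS => n.
rewrite !sub0r !normrN normrX => H.
by rewrite -(ltr_pXn2r (n := 2))// nnegrE ltW.
Qed.

Lemma riemann_lebesgue_cos h : contf h ->
  (fun n => Ipi (fun x => h x * cos (n%:R * x))) @ \oo --> 0.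
Proof.
(* The shift drops the constant function cos (0 x), whose square has integral pi instead of pi /
   2. *)
move=> ch; rewrite -cvg_shiftS.
apply: (bessel_cvg0 (fun n x => cos (n.+1%:R * x)) (pi / 2)) => //.
- by rewrite divr_gt0// pi_gt0.
- by move=> n; cont.
- by move=> m n; exact: Ipi_coscos.
Qed.

Lemma riemann_lebesgue_sin h : contf h ->
  (fun n => Ipi (fun x => h x * sin (n%:R * x))) @ \oo --> 0.
Proof.
move=> ch; rewrite -cvg_shiftS.
apply: (bessel_cvg0 (fun n x => sin (n.+1%:R * x)) (pi / 2)) => //.
- by rewrite divr_gt0// pi_gt0.
- by move=> n; cont.
- by move=> m n; exact: Ipi_sinsin.
Qed.

(** The real shift l and the phase m are absorbed into the continuous factor by the addition
    formula. The even frequencies are those of products of two functions oscillating at frequencies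
    close to n. *)
Lemma riemann_lebesgue h (l m : R) : contf h ->
  (fun n => Ipi (fun x => h x * cos ((n.*2%:R + l) * x + m))) @ \oo --> 0.
Proof.
move=> ch.
pose h1 x := h x * cos (l * x + m); pose h2 x := h x * sin (l * x + m).
have ch1 : contf h1 by rewrite /h1; cont.
have ch2 : contf h2 by rewrite /h2; cont.
have -> : (fun n => Ipi (fun x => h x * cos ((n.*2%:R + l) * x + m))) =
  (fun n => Ipi (fun x => h1 x * cos (n.*2%:R * x)) - Ipi (fun x => h2 x * sin (n.*2%:R * x))).
  apply/funext => n; rewrite -IpiB; [|by cont|by cont].
  apply: eq_Ipi => x _; rewrite /h1 /h2.
  by rewrite (_ : _ * x + m = n.*2%:R * x + (l * x + m)) ?cosD; ring.
rewrite -[X in _ --> X](subr0 (0 : R)); apply: cvgB.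
- apply: (cvg_comp (fun n => n.*2) _ _ (riemann_lebesgue_cos _ ch1)).
  apply/cvgnyPge => A; exists A => // n /= An; rewrite -addnn; lia.
- apply: (cvg_comp (fun n => n.*2) _ _ (riemann_lebesgue_sin _ ch2)).
  apply/cvgnyPge => A; exists A => // n /= An; rewrite -addnn; lia.
Qed.
End IntegralPi.

(** * The extremal problem on the circle *)

Section Circle.
Context {R : realType}.
Local Notation C := (complex R).
Local Notation normc := (@Normc.normc R).
Local Notation Re := (@complex.Re R).
Local Notation Im := (@complex.Im R).
Implicit Types (x y r : R) (z w : C) (p q : {poly R}).

Lemma cReD z w : Re (z + w) = Re z + Re w. Proof. by case: z w => [a b] [c d]. Qed.
Lemma cImD z w : Im (z + w) = Im z + Im w. Proof. by case: z w => [a b] [c d]. Qed.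
Lemma cReN z : Re (- z) = - Re z. Proof. by case: z. Qed.
Lemma cImN z : Im (- z) = - Im z. Proof. by case: z. Qed.
Lemma cReM z w : Re (z * w) = Re z * Re w - Im z * Im w. Proof. by case: z w => [a b] [c d]. Qed.
Lemma cImM z w : Im (z * w) = Re z * Im w + Im z * Re w. Proof. by case: z w => [a b] [c d]. Qed.
Lemma Re_sum (J : Type) (s : seq J) (P : pred J) (F : J -> C) :
  Re (\sum_(i <- s | P i) F i) = \sum_(i <- s | P i) Re (F i).
Proof. by apply: (big_morph Re) => //; exact: cReD. Qed.
Lemma Im_sum (J : Type) (s : seq J) (P : pred J) (F : J -> C) :
  Im (\sum_(i <- s | P i) F i) = \sum_(i <- s | P i) Im (F i).
Proof. by apply: (big_morph Im) => //; exact: cImD. Qed.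
Lemma complex_eq z w : Re z = Re w -> Im z = Im w -> z = w.
Proof. by case: z w => [a b] [c d] /= -> ->. Qed.

Lemma normcE2 z : normc z ^+ 2 = Re z ^+ 2 + Im z ^+ 2.
Proof. by case: z => a b /=; rewrite sqr_sqrtr// addr_ge0// sqr_ge0. Qed.
Lemma normc_ge0 z : 0 <= normc z. Proof. by case: z => a b /=; exact: sqrtr_ge0. Qed.
Lemma normc_real x : normc (x%:C)%C = `|x|.
Proof. by rewrite /= expr0n/= addr0 sqrtr_sqr. Qed.
Lemma normcX z n : normc (z ^+ n) = normc z ^+ n.
Proof.
elim: n => [|n IH]; first by rewrite !expr0 Normc.normc1.
by rewrite !exprS Normc.normcM IH.
Qed.
Lemma normc_sum (J : Type) (s : seq J) (P : pred J) (F : J -> C) :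
  normc (\sum_(i <- s | P i) F i) <= \sum_(i <- s | P i) normc (F i).
Proof.
elim/big_rec2: _ => [|i y1 y2 _ H]; first by rewrite Normc.normc0.
by apply: le_trans (le_normcD _ _) _; rewrite lerD2l.
Qed.
Lemma normcB z w : normc (z - w) <= normc z + normc w.
Proof. by apply: le_trans (le_normcD _ _) _; rewrite normcN. Qed.
Lemma Re_normc z : `|Re z| <= normc z.
Proof.
rewrite -(ler_pXn2r (n := 2))// ?nnegrE ?normr_ge0 ?normc_ge0//.
by rewrite normcE2 real_normK ?num_real// lerDl sqr_ge0.
Qed.
Lemma Im_normc z : `|Im z| <= normc z.
Proof.
rewrite -(ler_pXn2r (n := 2))// ?nnegrE ?normr_ge0 ?normc_ge0//.
by rewrite normcE2 real_normK ?num_real// lerDr sqr_ge0.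
Qed.
Lemma normc_le_ReIm z : normc z <= `|Re z| + `|Im z|.
Proof.
rewrite -(ler_pXn2r (n := 2))// ?nnegrE ?addr_ge0 ?normr_ge0 ?normc_ge0//.
rewrite normcE2 sqrrD !real_normK ?num_real// lerD2r lerDl.
by rewrite pmulrn_lge0// mulr_ge0.
Qed.

Definition cis x : C := Complex (cos x) (sin x).
Lemma cisD x y : cis (x + y) = cis x * cis y.
Proof. by apply: complex_eq; rewrite ?cReM ?cImM/= ?cosD ?sinD// addrC [cos x * _]mulrC. Qed.
Lemma cis0 : cis 0 = 1. Proof. by rewrite /cis cos0 sin0. Qed.
Lemma cisX x n : cis x ^+ n = cis (n%:R * x).
Proof.
elim: n => [|n IH]; first by rewrite mul0r cis0.
by rewrite exprS IH -cisD -[in RHS]add1n natrD mulrDl mul1r.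
Qed.
Lemma normc_cis x : normc (cis x) = 1.
Proof. by rewrite /= cos2Dsin2 sqrtr1. Qed.

Definition evc p x : C := (map_poly (real_complex R) p).[cis x].
Lemma evcM p q x : evc (p * q) x = evc p x * evc q x.
Proof. by rewrite /evc rmorphM hornerM. Qed.
Lemma evcD p q x : evc (p + q) x = evc p x + evc q x.
Proof. by rewrite /evc rmorphD hornerD. Qed.
Lemma evcB p q x : evc (p - q) x = evc p x - evc q x.
Proof. by rewrite /evc rmorphB hornerD hornerN. Qed.
Lemma evc1 x : evc 1 x = 1.
Proof. by rewrite /evc rmorph1 hornerE. Qed.
Lemma evcX p n x : evc (p ^+ n) x = evc p x ^+ n.
Proof. by rewrite /evc rmorphXn horner_exp. Qed.
Lemma evcZ (c : R) p x : evc (c *: p) x = (c%:C)%C * evc p x.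
Proof. by rewrite /evc map_polyZ hornerZ. Qed.
Lemma evc_prod (J : Type) (s : seq J) (F : J -> {poly R}) x :
  evc (\prod_(i <- s) F i) x = \prod_(i <- s) evc (F i) x.
Proof. by apply: (big_morph (fun p => evc p x)); [move=> p q; exact: evcM|exact: evc1]. Qed.
Lemma evc_XX x : evc 'X x = cis x.
Proof. by rewrite /evc map_polyX hornerX. Qed.
Lemma evc_poly n (F : nat -> R) x :
  evc (\poly_(k < n) F k) x = \sum_(k < n) ((F k)%:C)%C * cis (k%:R * x).
Proof.
rewrite /evc (horner_coef_wide _ (n := n)); last first.
  by rewrite size_map_poly size_poly.
apply: eq_bigr => i _; rewrite coef_map coef_poly ltn_ord cisX//.
Qed.
Lemma evcE p x : evc p x = \sum_(k < size p) ((p`_k)%:C)%C * cis (k%:R * x).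
Proof. by rewrite -evc_poly coefK. Qed.
Lemma Re_evc p x : Re (evc p x) = \sum_(k < size p) p`_k * cos (k%:R * x).
Proof. by rewrite evcE Re_sum; apply: eq_bigr => i _; rewrite cReM/= mul0r subr0. Qed.
Lemma Im_evc p x : Im (evc p x) = \sum_(k < size p) p`_k * sin (k%:R * x).
Proof. by rewrite evcE Im_sum; apply: eq_bigr => i _; rewrite cImM/= mul0r addr0. Qed.

(** * Elementary estimates for sine, cosine and the complex exponential *)

Lemma mean_value_bound (F F' : R -> R) (M r : R) :
  (forall x, `|x| <= `|r| -> is_derive x 1 F (F' x) /\ `|F' x| <= M) ->
  `|F r - F 0| <= M * `|r|.
Proof.
move=> H; have cF x : `|x| <= `|r| -> {for x, continuous F}.
  move=> /H[dF _]; apply: differentiable_continuous; apply/derivable1_diffP; exact: ex_derive.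
have [r0|r0|->] := ltgtP r 0; last by rewrite subrr !normr0 mulr0.
- have [|||c] := @MVT R F F' r 0 => //.
  + by move=> x; rewrite in_itv/= => /andP[rx x0]; apply: (H x _).1; rewrite !ltr0_norm//; lra.
  + apply: continuous_in_subspaceT => x; rewrite inE/= in_itv/= => /andP[rx x0].
    by apply: cF; rewrite !ler0_norm//; lra.
  rewrite in_itv/= => /andP[rc c0] E.
  rewrite distrC E normrM sub0r normrN ler_wpM2r//.
  by apply: (H c _).2; rewrite !ltr0_norm//; lra.
- have [|||c] := @MVT R F F' 0 r => //.
  + by move=> x; rewrite in_itv/= => /andP[rx x0]; apply: (H x _).1; rewrite !gtr0_norm//; lra.
  + apply: continuous_in_subspaceT => x; rewrite inE/= in_itv/= => /andP[rx x0].
    by apply: cF; rewrite !ger0_norm//; lra.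
  rewrite in_itv/= => /andP[rc c0] E.
  rewrite E normrM subr0 ler_wpM2r//.
  by apply: (H c _).2; rewrite !gtr0_norm//; lra.
Qed.

Definition cexp z : C := ((expR (Re z))%:C)%C * cis (Im z).
Lemma cexpD z w : cexp (z + w) = cexp z * cexp w.
Proof. by rewrite /cexp cReD cImD expRD cisD rmorphM/=; ring. Qed.
Lemma normc_cexp z : normc (cexp z) = expR (Re z).
Proof. by rewrite /cexp Normc.normcM normc_cis mulr1 normc_real ger0_norm// expR_ge0. Qed.
Lemma cexp0 : cexp 0 = 1.
Proof. by rewrite /cexp/= expR0 cis0 mulr1. Qed.
Lemma cexpMn z n : cexp (z *+ n) = cexp z ^+ n.
Proof.
elim: n => [|n IH]; first by rewrite mulr0n cexp0.
by rewrite mulrS cexpD IH exprS.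
Qed.

Lemma abs_sin_le x : `|sin x| <= `|x|.
Proof.
have := mean_value_bound sin cos 1 x; rewrite sin0 subr0 mul1r; apply => y _.
by split; [exact: is_derive_sin|exact: cos_max].
Qed.
Lemma cos_sub1 x : `|cos x - 1| <= `|x| ^+ 2.
Proof.
have := mean_value_bound cos (fun y => - sin y) `|x| x; rewrite cos0 expr2; apply => y yx.
split; [exact: is_derive_cos|rewrite normrN; exact: le_trans (abs_sin_le y) yx].
Qed.
Lemma sin_sub x : `|sin x - x| <= `|x| ^+ 3.
Proof.
have := mean_value_bound (fun y => sin y - y) (fun y => cos y - 1) (`|x| ^+ 2) x.
rewrite sin0 !subr0 -exprSr; apply => y yx.
split; first by apply: is_derive_eq.
by apply: le_trans (cos_sub1 y) _; rewrite ler_pXn2r// nnegrE.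
Qed.
Lemma expR_sub1x x : `|x| <= 2^-1 -> `|expR x - 1 - x| <= 2 * `|x| ^+ 2.
Proof.
move=> hx; have := expR_ge1Dx x; have := expR_ge1Dx (- x); rewrite expRN => H1 H2.
rewrite real_normK ?num_real//.
have x1 : 0 < 1 - x by move: hx; rewrite ler_norml => /andP[]; lra.
have e0 := expR_gt0 x.
have : expR x * (1 - x) <= 1.
  by rewrite -ler_pdivlMl// mulr1.
move: hx; rewrite ler_norml => /andP[h1 h2] H3.
rewrite ger0_norm; last by lra.
by have : 0 <= x ^+ 2 * (1 - x *+ 2) by [rewrite mulr_ge0 ?sqr_ge0//; lra|]; nra.
Qed.
Lemma cexp_sub1 z : normc z <= 2^-1 -> normc (cexp z - 1 - z) <= 8 * normc z ^+ 2.
Proof.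
move=> hz; set N := normc z in hz *.
have N0 : 0 <= N := normc_ge0 z.
have ha := Re_normc z; have hb := Im_normc z; rewrite -/N in ha hb.
apply: le_trans (normc_le_ReIm _) _.
rewrite !cReD !cImD !cReN !cImN cReM cImM/= !mul0r subr0 addr0 oppr0 addr0.
set a := Re z in ha *; set b := Im z in hb *.
have hE := expR_sub1x a (le_trans ha hz).
have hE2 : `|expR a - 1 - a| <= 2 * N ^+ 2.
  by apply: le_trans hE _; rewrite ler_pM2l// ler_pXn2r// nnegrE.
have hC : `|cos b - 1| <= N ^+ 2 by apply: le_trans (cos_sub1 b) _; rewrite ler_pXn2r// nnegrE.
have hS : `|sin b - b| <= N ^+ 2 * 2^-1.
  apply: le_trans (sin_sub b) _; rewrite exprSr.
  by apply: ler_pM; [exact: exprn_ge0|exact: normr_ge0|rewrite ler_pXn2r// nnegrE|exact: le_trans hb hz].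
have N2 : N ^+ 2 <= N * 2^-1 by rewrite expr2 ler_wpM2l.
have K1 : `|expR a * cos b - 1 - a| <= 4 * N ^+ 2.
  have -> : expR a * cos b - 1 - a = (expR a - 1 - a) * cos b + (1 + a) * (cos b - 1) by ring.
  apply: le_trans (ler_normD _ _) _; rewrite !normrM.
  have P1 : `|expR a - 1 - a| * `|cos b| <= 2 * N ^+ 2 * 1 by apply: ler_pM => //; exact: cos_max.
  have P2 : `|1 + a| * `|cos b - 1| <= 2 * N ^+ 2.
    apply: ler_pM => //; apply: le_trans (ler_normD _ _) _; rewrite normr1; lra.
  by lra.
have K2 : `|expR a * sin b - b| <= 3 * N ^+ 2.
  have -> : expR a * sin b - b = (expR a - 1 - a) * sin b + a * sin b + (sin b - b) by ring.
  apply: le_trans (ler_normD _ _) _; apply: le_trans (lerD (ler_normD _ _) (lexx _)) _; rewrite !normrM.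
  have P1 : `|expR a - 1 - a| * `|sin b| <= 2 * N ^+ 2 * 2^-1.
    by apply: ler_pM => //; apply: le_trans (abs_sin_le b) _; lra.
  have P2 : `|a| * `|sin b| <= N * N by apply: ler_pM => //; apply: le_trans (abs_sin_le b) _.
  by move: P2; rewrite -expr2; have := sqr_ge0 N; lra.
have := sqr_ge0 N; lra.
Qed.

Lemma subX_bound z w (c : R) n : normc z <= c -> normc w <= c ->
  normc (z ^+ n - w ^+ n) <= n%:R * c ^+ n.-1 * normc (z - w).
Proof.
move=> hz hw; have c0 : 0 <= c := le_trans (normc_ge0 z) hz.
rewrite subrXX Normc.normcM mulrC; apply: ler_wpM2r; first exact: normc_ge0.
apply: le_trans (normc_sum _ _ _ _) _.
apply: le_trans (_ : \sum_(i < n) c ^+ n.-1 <= _); last by rewrite sumr_const card_ord mulr_natl.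
apply: ler_sum => i _; rewrite Normc.normcM !normcX.
have -> : c ^+ n.-1 = c ^+ (n.-1 - i) * c ^+ i.
  by rewrite -exprD subnK// -ltnS prednK// (leq_ltn_trans _ (ltn_ord i)).
 apply: ler_pM; rewrite ?exprn_ge0 ?normc_ge0// lerXn2r// nnegrE ?normc_ge0//.
Qed.

(** With m = n + 1, exp z is the m-th power of exp (z / m), and powers differ by at most m times the
    difference of their bases, up to a bounded factor. A power of 1 + z / m is preferred to a Taylor
    polynomial because its constant coefficient is visibly 1 when z is replaced by a polynomial
    without constant term. *)
Lemma cexp_power_approx z (L : R) n : normc z <= L -> 2 * L <= n.+1%:R ->
  normc (cexp z - (1 + (n.+1%:R^-1%:C)%C * z) ^+ n.+1) <= 8 * L ^+ 2 * expR L / n.+1%:R.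
Proof.
move=> zL Ln; set m := n.+1%:R : R.
have m0 : 0 < m by rewrite ltr0n.
have L0 : 0 <= L := le_trans (normc_ge0 z) zL.
set w := (m^-1%:C)%C * z.
have nw : normc w <= L / m.
  by rewrite Normc.normcM normc_real ger0_norm ?invr_ge0 ?(ltW m0)// [leLHS]mulrC; apply: ler_wpM2r; rewrite ?invr_ge0 ?(ltW m0).
have -> : cexp z = cexp w ^+ n.+1.
  rewrite -cexpMn; congr cexp; rewrite /w -mulrnAl.
  have -> : (m^-1%:C)%C *+ n.+1 = 1 :> C.
    by rewrite -rmorphMn/= -mulr_natr mulVf// gt_eqF.
  by rewrite mul1r.
have Lm2 : L / m <= 2^-1 by rewrite ler_pdivrMr// mulrC; lra.
apply: le_trans (subX_bound _ _ (expR (L / m)) n.+1 _ _) _.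
- by rewrite normc_cexp ler_expR; apply: le_trans (ler_norm _) _; exact: le_trans (Re_normc _) nw.
- apply: le_trans (le_normcD _ _) _; rewrite Normc.normc1.
  apply: le_trans (expR_ge1Dx _); by rewrite lerD2l.
rewrite opprD addrA.
have E1 : expR (L / m) ^+ n.+1.-1 <= expR L.
  rewrite -expRM_natl ler_expR /= mulrA ler_pdivrMr// mulrC; apply: ler_wpM2l => //.
  by rewrite /m ler_nat.
have E2 : normc (cexp w - 1 - w) <= 8 * (L / m) ^+ 2.
  apply: le_trans (cexp_sub1 w (le_trans nw Lm2)) _.
  by rewrite ler_pM2l// ler_pXn2r ?nnegrE ?normc_ge0// mulr_ge0// invr_ge0 ltW.
apply: le_trans (_ : m * expR L * (8 * (L / m) ^+ 2) <= _).
  apply: ler_pM => //; [exact: normc_ge0|by rewrite ler_pM2l].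
by rewrite le_eqVlt; apply/orP; left; apply/eqP; field; rewrite gt_eqF.
Qed.
End Circle.

(** * The logarithm of 1 - r exp(ix) and its power series *)

Section Logarithm.
Context {R : realType}.
Local Notation C := (complex R).
Local Notation normc := (@Normc.normc R).
Local Notation Re := (@complex.Re R).
Local Notation Im := (@complex.Im R).
Implicit Types (x y r : R) (z w : C) (p q : {poly R}).

(** With z = r exp(ix), the functions [sqdist], [lnr], [argr] and [Logr] are |1 - z|^2, ln |1 - z|,
    arg (1 - z) and log (1 - z). For |r| < 1 the real part of 1 - z is positive, so the arctangent
    is the principal argument. A negative r encodes the factor 1 + z. *)
Definition sqdist r x : R := 1 - 2 * r * cos x + r ^+ 2.
Definition lnr r x : R := 2^-1 * ln (sqdist r x).
Definition argr r x : R := atan (- (r * sin x) / (1 - r * cos x)).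
Definition Logr r x : C := Complex (lnr r x) (argr r x).

Lemma onem_rcos_gt0 r x : `|r| < 1 -> 0 < 1 - r * cos x.
Proof.
move=> r1; rewrite subr_gt0; apply: le_lt_trans (ler_norm _) _; rewrite normrM.
apply: le_lt_trans r1; rewrite -[leRHS]mulr1; apply: ler_wpM2l => //; exact: cos_max.
Qed.
Lemma sqdistE r x : sqdist r x = (1 - r * cos x) ^+ 2 + (r * sin x) ^+ 2.
Proof. by rewrite /sqdist exprMn sin2cos2; ring. Qed.
Lemma sqdist_gt0 r x : `|r| < 1 -> 0 < sqdist r x.
Proof.
move=> r1; rewrite sqdistE ltr_pwDl ?sqr_ge0// exprn_gt0//; exact: onem_rcos_gt0.
Qed.
Lemma lnr0 x : lnr 0 x = 0.
Proof. by rewrite /lnr /sqdist mulr0 mul0r subr0 expr0n/= addr0 ln1 mulr0. Qed.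
Lemma argr0 x : argr 0 x = 0.
Proof. by rewrite /argr mul0r oppr0 mul0r atan0. Qed.
Lemma sqdist_normc r x : sqdist r x = normc (1 - (r%:C)%C * cis x) ^+ 2.
Proof.
rewrite normcE2 sqdistE !cReD !cImD !cReN !cImN cReM cImM/=; ring.
Qed.

Lemma is_derive_powsum (c : nat -> R) m y :
  is_derive y 1 (fun t => \sum_(k < m) t ^+ k.+1 / k.+1%:R * c k.+1)
    (\sum_(k < m) y ^+ k * c k.+1).
Proof.
have H k : is_derive y 1 (fun t => t ^+ k.+1 / k.+1%:R * c k.+1) (y ^+ k * c k.+1).
  have -> : (fun t => t ^+ k.+1 / k.+1%:R * c k.+1) = horner ((k.+1%:R^-1 * c k.+1) *: 'X^(k.+1)).
    by apply/funext => t /=; rewrite !hornerE; ring.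
  apply: (is_derive_eq (is_derive_poly _ _)).
  have k0 : (k.+1%:R : R) != 0 by rewrite pnatr_eq0.
  rewrite derivZ derivXn hornerZ hornerMn hornerXn -(mulr_natl (y ^+ _)) /=; set K := k.+1%:R in k0 *.
  by field.
elim: m => [|m IH].
  rewrite big_ord0; under eq_fun do rewrite big_ord0; exact: is_derive_cst.
rewrite big_ord_recr; under eq_fun do rewrite big_ord_recr; exact: is_deriveD.
Qed.

Lemma is_derive_lnr y x : `|y| < 1 -> is_derive y 1 (fun t => lnr t x) ((y - cos x) / sqdist y x).
Proof.
move=> y1; have D0 := sqdist_gt0 y x y1.
have H1 : is_derive y 1 (fun t => sqdist t x) (2 * (y - cos x)).
  have -> : (fun t => sqdist t x) = horner ('X ^+ 2 - (2 * cos x) *: 'X + 1).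
    by apply/funext => t; rewrite /sqdist !hornerE; ring.
  apply: (is_derive_eq (is_derive_poly _ _)).
  rewrite !poly.derivE !hornerE; ring.
have H2 := is_derive1_ln D0.
have H3 := @is_derive1_comp R (@ln R) (fun t => sqdist t x) y _ _ H2 H1.
have -> : (fun t => lnr t x) = 2^-1 \*: (@ln R \o (fun t => sqdist t x)) by [].
apply: is_derive_eq; rewrite /GRing.scale/=; field; rewrite gt_eqF//.
Qed.

Lemma is_derive_argr y x : `|y| < 1 -> is_derive y 1 (fun t => argr t x) (- sin x / sqdist y x).
Proof.
move=> y1; have D0 := sqdist_gt0 y x y1; have A0 := onem_rcos_gt0 y x y1.
have H1 : is_derive y 1 (fun t => - (t * sin x) / (1 - t * cos x)) (- sin x / (1 - y * cos x) ^+ 2).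
  have h1 : is_derive y 1 (fun t => - (t * sin x)) (- sin x).
    have -> : (fun t => - (t * sin x)) = horner (- sin x *: 'X) by apply/funext => t /=; rewrite !hornerE; ring.
    by apply: (is_derive_eq (is_derive_poly _ _)); rewrite !poly.derivE !hornerE; ring.
  have h2 : is_derive y 1 (fun t => 1 - t * cos x) (- cos x).
    have -> : (fun t => 1 - t * cos x) = horner (1 - cos x *: 'X) by apply/funext => t /=; rewrite !hornerE; ring.
    by apply: (is_derive_eq (is_derive_poly _ _)); rewrite !poly.derivE !hornerE; ring.
  have h3 := @is_deriveV R (fun t => 1 - t * cos x) y _ 1 (lt0r_neq0 A0) h2.
  have h4 := is_deriveM h1 h3.
  apply: is_derive_eq; rewrite /GRing.scale/=; field; rewrite gt_eqF//.
have H3 := @is_derive1_comp R (@atan R) (fun t => - (t * sin x) / (1 - t * cos x)) y _ _ (is_derive1_atan (- (y * sin x) / (1 - y * cos x))) H1.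
apply: is_derive_eq; rewrite sqdistE; rewrite sqdistE in D0.
by field; rewrite !gt_eqF//= -exprMn; move: D0; rewrite !expr2; set A := 1 - _; nra.
Qed.

(** The leading complex number is the derivative of log (1 - r exp(ix)) in r at y, that is - exp(ix)
    / (1 - y exp(ix)); the sum cancels the beginning of its geometric series. *)
Lemma geometric_tail y x m : `|y| < 1 ->
  normc (Complex ((y - cos x) / sqdist y x) (- sin x / sqdist y x)
    + \sum_(k < m) ((y ^+ k)%:C)%C * cis (k.+1%:R * x)) <= `|y| ^+ m / (1 - `|y|).
Proof.
move=> y1; set u := (y%:C)%C * cis x.
have D0 := sqdist_gt0 y x y1.
have nu : normc u = `|y| by rewrite Normc.normcM normc_cis mulr1 normc_real.
have n1u : 1 - `|y| <= normc (1 - u).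
  rewrite lerBlDr; have := le_normcD (1 - u) u; rewrite subrK Normc.normc1 nu.
  by [].
have pos : 0 < 1 - `|y| by rewrite subr_gt0.
have u1 : 1 - u != 0.
  apply/negP => /eqP E; move: n1u; rewrite E Normc.normc0; lra.
have -> : Complex ((y - cos x) / sqdist y x) (- sin x / sqdist y x) = - cis x / (1 - u).
  apply: (mulIf u1); rewrite mulfVK//; apply: complex_eq; rewrite ?cReM ?cImM ?cReD ?cImD ?cReN ?cImN ?cReM ?cImM/=.
    rewrite -[RHS](mulfK (x := sqdist y x)) ?gt_eqF// mulrBl.
    have -> : - cos x * sqdist y x = (y - cos x) * (1 - y * cos x) - sin x * (y * sin x).
      by rewrite /sqdist [sin x * _]mulrCA -expr2 sin2cos2; ring.
    by field; rewrite gt_eqF.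
  rewrite -[RHS](mulfK (x := sqdist y x)) ?gt_eqF//.
  have -> : - sin x * sqdist y x = - (y - cos x) * (y * sin x) - sin x * (1 - y * cos x).
    by rewrite /sqdist; ring.
  by field; rewrite gt_eqF.
have -> : \sum_(k < m) ((y ^+ k)%:C)%C * cis (k.+1%:R * x) = cis x * ((1 - u ^+ m) / (1 - u)).
  rewrite -[1 - u ^+ m]opprB subrX1 -mulNr opprB [(1 - u) * _]mulrC mulfK// mulr_sumr.
  apply: eq_bigr => k _; rewrite /u exprMn -cisX exprS rmorphXn/=; ring.
have -> : - cis x / (1 - u) + cis x * ((1 - u ^+ m) / (1 - u)) = - (cis x * u ^+ m) / (1 - u).
  by field.
rewrite Normc.normcM normcN Normc.normcM normc_cis mul1r normcX nu Normc.normcV.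
apply: ler_wpM2l; first by rewrite exprn_ge0.
by rewrite lef_pV2// posrE (lt_le_trans pos).
Qed.

(** [geometric_tail] is integrated in r from 0, where the logarithm and the sum vanish. The mean
    value theorem is applied to the real and imaginary parts separately, whence the factor 2. *)
Lemma Logr_series r x m : `|r| < 1 ->
  normc (Logr r x + \sum_(k < m) ((r ^+ k.+1 / k.+1%:R)%:C)%C * cis (k.+1%:R * x))
    <= 2 * (`|r| ^+ m / (1 - `|r|)).
Proof.
move=> r1; set M := _ / _.
have small y : `|y| <= `|r| -> `|y| < 1 by move=> h; exact: le_lt_trans h r1.
have bound y : `|y| <= `|r| ->
    normc (Complex ((y - cos x) / sqdist y x) (- sin x / sqdist y x)
    + \sum_(k < m) ((y ^+ k)%:C)%C * cis (k.+1%:R * x)) <= M.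
  move=> h; apply: le_trans (geometric_tail y x m (small y h)) _.
  apply: ler_pM; rewrite ?exprn_ge0 ?invr_ge0 ?subr_ge0 ?(ltW (small y h))//.
    by rewrite lerXn2r// nnegrE.
  by rewrite lef_pV2 ?posrE ?subr_gt0 ?(small y h)// lerB.
have M0 : 0 <= M by apply: le_trans (bound r (lexx _)); exact: normc_ge0.
apply: le_trans (normc_le_ReIm _) _; rewrite mulr_natl mulr2n.
have sumRe y : Re (\sum_(k < m) ((y ^+ k)%:C)%C * cis (k.+1%:R * x)) = \sum_(k < m) y ^+ k * cos (k.+1%:R * x).
  by rewrite Re_sum; apply: eq_bigr => k _; rewrite cReM/= mul0r subr0.
have sumIm y : Im (\sum_(k < m) ((y ^+ k)%:C)%C * cis (k.+1%:R * x)) = \sum_(k < m) y ^+ k * sin (k.+1%:R * x).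
  by rewrite Im_sum; apply: eq_bigr => k _; rewrite cImM/= mul0r addr0.
have sum0 (c : nat -> R) : \sum_(k < m) 0 ^+ k.+1 / k.+1%:R * c k.+1 = 0.
  by apply: big1 => k _; rewrite expr0n/= !mul0r.
have Mr : M * `|r| <= M by rewrite -[leRHS]mulr1; apply: ler_wpM2l => //; exact: ltW.
apply: lerD.
- have := mean_value_bound (fun t => lnr t x + \sum_(k < m) t ^+ k.+1 / k.+1%:R * cos (k.+1%:R * x))
     (fun y => (y - cos x) / sqdist y x + \sum_(k < m) y ^+ k * cos (k.+1%:R * x)) M r.
  rewrite (sum0 (fun k => cos (k%:R * x))) lnr0 addr0 subr0.
  rewrite cReD Re_sum.
  have -> : \sum_(i < m) Re (((r ^+ i.+1 / i.+1%:R)%:C)%C * cis (i.+1%:R * x)) =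
    \sum_(k < m) r ^+ k.+1 / k.+1%:R * cos (k.+1%:R * x).
    by apply: eq_bigr => k _; rewrite cReM/= mul0r subr0.
  move=> H; apply: le_trans (H _) Mr => y yr; split.
    apply: is_deriveD; first exact: (is_derive_lnr _ _ (small y yr)).
    exact: (is_derive_powsum (fun k => cos (k%:R * x))).
  apply: le_trans (bound y yr); have := Re_normc (Complex ((y - cos x) / sqdist y x) (- sin x / sqdist y x)
    + \sum_(k < m) ((y ^+ k)%:C)%C * cis (k.+1%:R * x)).
  by rewrite cReD sumRe.
- have := mean_value_bound (fun t => argr t x + \sum_(k < m) t ^+ k.+1 / k.+1%:R * sin (k.+1%:R * x))
     (fun y => - sin x / sqdist y x + \sum_(k < m) y ^+ k * sin (k.+1%:R * x)) M r.
  rewrite (sum0 (fun k => sin (k%:R * x))) argr0 addr0 subr0.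
  rewrite cImD Im_sum.
  have -> : \sum_(i < m) Im (((r ^+ i.+1 / i.+1%:R)%:C)%C * cis (i.+1%:R * x)) =
    \sum_(k < m) r ^+ k.+1 / k.+1%:R * sin (k.+1%:R * x).
    by apply: eq_bigr => k _; rewrite cImM/= mul0r addr0.
  move=> H; apply: le_trans (H _) Mr => y yr; split.
    apply: is_deriveD; first exact: (is_derive_argr _ _ (small y yr)).
    exact: (is_derive_powsum (fun k => sin (k%:R * x))).
  apply: le_trans (bound y yr); have := Im_normc (Complex ((y - cos x) / sqdist y x) (- sin x / sqdist y x)
    + \sum_(k < m) ((y ^+ k)%:C)%C * cis (k.+1%:R * x)).
  by rewrite cImD sumIm.
Qed.
End Logarithm.

(** * Polynomial approximation inside the disc and mean values *)

Section Approximation.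
Context {R : realType}.
Local Notation C := (complex R).
Local Notation normc := (@Normc.normc R).
Local Notation Re := (@complex.Re R).
Local Notation Im := (@complex.Im R).
Implicit Types (x y r : R) (z w : C) (p q : {poly R}) (J : seq (R * R)).

(** The logarithm of the product over (w, phi) in J of ((1 - z exp(i phi)) (1 - z exp(- i phi)))^w
    at z = r exp(ix). Pairing phi with - phi makes the Taylor coefficients in z real. At phi = 0 and
    phi = pi the two factors coincide, so a weight w there means the exponent 2 w. *)
Definition LL J r x : C :=
  \sum_(j <- J) ((j.1)%:C)%C * (Logr r (x + j.2) + Logr r (x - j.2)).

Definition log_poly J r m : {poly R} :=
  \poly_(k < m.+1) (if k is k'.+1 then
     - \sum_(j <- J) j.1 * (r ^+ k / k%:R * (2 * cos (k%:R * j.2))) else 0).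

Lemma evc_log_poly J r m x : evc (log_poly J r m) x =
  - \sum_(j <- J) ((j.1)%:C)%C *
     (\sum_(k < m) ((r ^+ k.+1 / k.+1%:R)%:C)%C * cis (k.+1%:R * (x + j.2))
     + \sum_(k < m) ((r ^+ k.+1 / k.+1%:R)%:C)%C * cis (k.+1%:R * (x - j.2))).
Proof.
rewrite evc_poly big_ord_recl/= mul0r add0r.
transitivity (- \sum_(k < m) \sum_(j <- J) ((j.1)%:C)%C *
   (((r ^+ k.+1 / k.+1%:R)%:C)%C * (cis (k.+1%:R * (x + j.2)) + cis (k.+1%:R * (x - j.2))))).
  rewrite -sumrN; apply: eq_bigr => k _; rewrite /bump/= add1n.
  rewrite rmorphN/= rmorph_sum/= mulNr mulr_suml; congr (- _); apply: eq_bigr => j _.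
  have -> : cis (k.+1%:R * (x + j.2)) + cis (k.+1%:R * (x - j.2)) =
     ((2 * cos (k.+1%:R * j.2))%:C)%C * cis (k.+1%:R * x).
    rewrite mulrDr mulrBr !cisD; apply: complex_eq;
      rewrite ?cReD ?cImD ?cReM ?cImM/= cosN sinN; ring.
  by rewrite !rmorphM/=; ring.
rewrite exchange_big/=; congr (- _); apply: eq_bigr => j _.
rewrite -big_split/= mulr_sumr; apply: eq_bigr => k _; ring.
Qed.

Lemma LL_log_poly J r m x : 0 <= r < 1 ->
  normc (LL J r x - evc (log_poly J r m) x) <= (\sum_(j <- J) `|j.1| * 4 / (1 - r)) * r ^+ m.
Proof.
move=> /andP[r0 r1]; rewrite evc_log_poly opprK -big_split/=.
apply: le_trans (normc_sum _ _ _ _) _; rewrite mulr_suml; apply: ler_sum => j _.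
rewrite -mulrDr Normc.normcM normc_real.
set a := Logr r _; set b := Logr r _; set c := \sum_(k < m) _; set d := \sum_(k < m) _.
have -> : a + b + (c + d) = (a + c) + (b + d) by ring.
have nr : `|r| = r by rewrite ger0_norm.
have r1' : `|r| < 1 by rewrite nr.
have := Logr_series r (x + j.2) m r1'; have := Logr_series r (x - j.2) m r1'.
rewrite -/a -/b -/c -/d nr => h1 h2.
rewrite -!mulrA; apply: ler_wpM2l => //; apply: le_trans (le_normcD _ _) _.
by rewrite [_^-1 * _]mulrC; lra.
Qed.

Lemma small_power (S r e : R) : 0 <= r < 1 -> 0 <= S -> 0 < e -> exists m, S * r ^+ m <= e.
Proof.
move=> /andP[r0 r1] S0 e0.
have nr : `|r| < 1 by rewrite ger0_norm.
have /cvgrPdist_lt H0 := cvg_expr nr.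
have e' : 0 < e / (S + 1) by rewrite divr_gt0// ltr_wpDl.
have [m _ /(_ m (leqnn m))] := H0 _ e'; rewrite /= sub0r normrN ger0_norm ?exprn_ge0// => H.
exists m; apply: le_trans (_ : (S + 1) * r ^+ m <= _).
  by rewrite ler_wpM2r ?exprn_ge0// lerDl.
by rewrite mulrC -ler_pdivlMr ?ltW// ltr_wpDl.
Qed.

(** The logarithm is truncated, then the exponential is replaced by a high power. The truncated
    logarithm has no constant term, hence the constant coefficient 1. *)
Lemma cexp_LL_approx J r (d : R) : 0 <= r < 1 -> 0 < d ->
  exists2 B : {poly R}, B`_0 = 1 & forall x, normc (evc B x - cexp (LL J r x)) <= d.
Proof.
move=> r01 d0; set S := \sum_(j <- J) `|j.1| * 4 / (1 - r).
have S0 : 0 <= S.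
  apply: sumr_ge0 => j _; apply: mulr_ge0; first exact: mulr_ge0.
  by move: r01 => /andP[_ r1]; rewrite invr_ge0 subr_ge0 ltW.
(* Each of the two replacements may cost d / 2. An error eps <= 1/2 in the logarithm costs at most 5
   eps exp(2 S) in the exponential. *)
have e0 : 0 < Num.min 2^-1 (d / (10 * expR (2 * S))).
  by rewrite lt_min invr_gt0 ltr0n/= divr_gt0// mulr_gt0// expR_gt0.
have [m Hm] := small_power S r _ r01 S0 e0.
move: Hm; rewrite le_min => /andP[Hm1 Hm2].
have hL x : normc (LL J r x) <= S.
  have := LL_log_poly J r 0 x r01; rewrite -/S mulr1.
  by rewrite evc_poly big_ord1/= mul0r subr0.
pose l := log_poly J r m.
have hd x : normc (LL J r x - evc l x) <= S * r ^+ m := LL_log_poly J r m x r01.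
have hl x : normc (evc l x) <= 2 * S.
  have -> : evc l x = LL J r x - (LL J r x - evc l x) by ring.
  apply: le_trans (normcB _ _) _; rewrite mulr_natl mulr2n; apply: lerD => //.
  apply: le_trans (hd x) _; rewrite -[leRHS]mulr1; apply: ler_wpM2l => //.
  by case/andP: r01 => ? ?; apply: exprn_ile1 => //; exact: ltW.
set K := 8 * (2 * S) ^+ 2 * expR (2 * S).
have [n Hn] : exists n, Num.max (4 * S) (K / (d / 2)) <= n.+1%:R.
  exists (Num.bound (Num.max (4 * S) (K / (d / 2)))); apply/ltW.
  apply: lt_le_trans (archi_boundP _) _; first by rewrite le_max mulr_ge0.
  by rewrite ler_nat.
move: Hn; rewrite ge_max => /andP[Hn1 Hn2].
exists ((1 + n.+1%:R^-1 *: l) ^+ n.+1).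
  rewrite -horner_coef0 horner_exp hornerD hornerZ hornerC horner_coef0 coef_poly/= mulr0 addr0 expr1n//.
move=> x.
rewrite evcX evcD evc1 evcZ.
have -> : (1 + ((n.+1%:R^-1)%:C)%C * evc l x) ^+ n.+1 - cexp (LL J r x) =
  - (cexp (evc l x) - (1 + ((n.+1%:R^-1)%:C)%C * evc l x) ^+ n.+1) - (cexp (LL J r x) - cexp (evc l x)) by ring.
apply: le_trans (normcB _ _) _; rewrite normcN (splitr d); apply: lerD.
  apply: le_trans (cexp_power_approx _ (2 * S) n (hl x) _) _.
    by rewrite mulrA -natrM.
  rewrite -/K; rewrite ler_pdivrMr ?ltr0n// mulrC -ler_pdivrMr// divr_gt0//.
have -> : LL J r x = evc l x + (LL J r x - evc l x) by ring.
set e := LL J r x - evc l x in hd *.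
have he := hd x; rewrite -/e in he.
rewrite cexpD -[X in _ - X]mulr1 -mulrBr Normc.normcM normc_cexp.
have h1 : expR (Re (evc l x)) <= expR (2 * S).
  by rewrite ler_expR; apply: le_trans (ler_norm _) _; exact: le_trans (Re_normc _) (hl x).
have h2 : normc (cexp e - 1) <= 5 * normc e.
  have -> : cexp e - 1 = (cexp e - 1 - e) + e by ring.
  apply: le_trans (le_normcD _ _) _.
  have n2 : normc e <= 2^-1 := le_trans he Hm1.
  have := cexp_sub1 e n2.
  have : normc e ^+ 2 <= normc e * 2^-1 by rewrite expr2 ler_wpM2l// normc_ge0.
  lra.
apply: le_trans (_ : expR (2 * S) * (5 * (d / (10 * expR (2 * S)))) <= _).
  apply: ler_pM; rewrite ?expR_ge0 ?normc_ge0//.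
  by apply: le_trans h2 _; rewrite ler_pM2l// (le_trans he).
by rewrite le_eqVlt; apply/orP; left; apply/eqP; field; rewrite gt_eqF ?expR_gt0.
Qed.

Definition jac (s t : R) x : R := (1 - cos x) `^ s * (1 + cos x) `^ t.

Lemma onemcos_ge0 x : 0 <= 1 - cos x. Proof. by rewrite subr_ge0 cos_le1. Qed.
Lemma onepcos_ge0 x : 0 <= 1 + cos x. Proof. by have := cos_geN1 x; lra. Qed.

Lemma cont_jac (s t : R) : 0 <= s -> 0 <= t -> contf (jac s t).
Proof.
move=> s0 t0; apply: contM; apply: cont_powR_ge0 => //; try exact: onemcos_ge0; try exact: onepcos_ge0.
- by cont. - by cont.
Qed.

Definition jphase (s t : R) k r x : R :=
  expR (s * lnr r x + t * lnr (- r) x) * cos (k%:R * x + s * argr r x + t * argr (- r) x).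

Lemma cont_jphase s t k r : 0 <= r < 1 -> contf (jphase s t k r).
Proof.
move=> /andP[r0 r1].
have nr : `|r| < 1 by rewrite ger0_norm.
have nr' : `|- r| < 1 by rewrite normrN.
have cl (y : R) : `|y| < 1 -> contf (lnr y).
  move=> y1; apply: (contM (fun=> 2^-1) (fun x => ln (sqdist y x))); first exact: cont_cst.
  have cs : contf (sqdist y) by rewrite /sqdist; cont.
  move=> x; apply: (@continuous_comp _ _ _ (sqdist y) (@ln R)); first exact: cs.
  exact/continuous_ln/sqdist_gt0.
have ca (y : R) : `|y| < 1 -> contf (argr y).
  move=> y1; apply: (cont_comp (fun x => - (y * sin x) / (1 - y * cos x)) (@atan R)).
    by move=> x; exact: continuous_atan.
  apply: contM; first by cont.
  apply: cont_inv; last by cont.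
  by move=> x; rewrite gt_eqF// onem_rcos_gt0.
have c1 := cl r nr; have c2 := cl _ nr'; have c3 := ca r nr; have c4 := ca _ nr'.
rewrite /jphase; apply: contM.
  apply: cont_comp; first exact: continuous_expR.
  apply: contD; apply: contM => //; exact: cont_cst.
apply: cont_cos; apply: contD; [apply: contD|]; [by cont|apply: contM => //; exact: cont_cst..].
Qed.

Lemma jphase_LL s t k r x :
  jphase s t k r x = Re (cis (k%:R * x) * cexp (LL [:: (s / 2, 0); (t / 2, pi)] r x)).
Proof.
have Lpi (u : R) : u = pi \/ u = - pi -> lnr r (x + u) = lnr (- r) x /\ argr r (x + u) = argr (- r) x.
  move=> hu; have [hc hs] : cos (x + u) = - cos x /\ sin (x + u) = - sin x.
    case: hu => ->; first by rewrite cosDpi sinDpi.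
    by rewrite cosB sinB cospi sinpi; split; ring.
  rewrite /lnr /sqdist /argr hc hs sqrrN.
  by split; [congr (_ * ln _); ring|congr (atan (_ / _)); ring].
have [P1 P2] := Lpi pi (or_introl erefl); have [M1 M2] := Lpi (- pi) (or_intror erefl).
have -> : LL [:: (s / 2, 0); (t / 2, pi)] r x =
    Complex (s * lnr r x + t * lnr (- r) x) (s * argr r x + t * argr (- r) x).
  rewrite /LL !big_cons big_nil addr0.
  by apply: complex_eq; rewrite /= addr0 subr0 P1 P2 M1 M2; field.
by rewrite /cexp/= /jphase -addrA cosD; ring.
Qed.

(** The mean value property of the analytic function (1 - z)^s (1 + z)^t, which equals 1 at the
    origin. It is read off from an approximating polynomial B, where only frequency 0
    contributes. *)
Lemma Ipi_jphase s t k r : 0 <= r < 1 ->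
  Ipi (jphase s t k r) = if k == 0%N then pi else 0.
Proof.
move=> r01; apply/eqP; rewrite -subr_eq0 -normr_le0; apply/ler_addgt0Pr => e e0.
rewrite add0r; have d0 : 0 < e / pi by rewrite divr_gt0// pi_gt0.
have [B B0 HB] := cexp_LL_approx [:: (s / 2, 0); (t / 2, pi)] r _ r01 d0.
have EB x : Re (cis (k%:R * x) * evc B x) = \sum_(j < size B) B`_j * cos ((k + j)%:R * x).
  rewrite evcE mulr_sumr Re_sum; apply: eq_bigr => j _.
  by rewrite mulrCA -cisD cReM/= mul0r subr0 natrD mulrDl.
have cB : contf (fun x => Re (cis (k%:R * x) * evc B x)).
  rewrite (_ : (fun x => _) = (fun x => \sum_(j < size B) B`_j * cos ((k + j)%:R * x))); first by cont.
  by apply/funext => x; exact: EB.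
have IB : Ipi (fun x => Re (cis (k%:R * x) * evc B x)) = if k == 0%N then pi else 0.
  transitivity (Ipi (fun x => \sum_(j < size B) B`_j * cos ((k + j)%:R * x))).
    by apply: eq_Ipi => x _; exact: EB.
  rewrite Ipi_sum; last by move=> i _; cont.
  have sB : (0 < size B)%N.
    by rewrite size_poly_gt0; apply/eqP => E; move: B0; rewrite E coef0 => /esym/eqP; rewrite oner_eq0.
  rewrite (bigD1 (Ordinal sB))//= big1 => [|i i0].
    by rewrite IpiZ; [rewrite Ipi_cos_nat addn0 B0 mul1r addr0|cont].
  rewrite IpiZ; last by cont.
  rewrite Ipi_cos_nat addn_eq0 [X in _ && X](_ : _ = false) ?andbF ?mulr0//.
  by apply/negbTE; move: i0; rewrite -val_eqE.
rewrite -IB -IpiB//; last exact: cont_jphase.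
apply: le_trans (Ipi_norm _ _) _; first by apply: contB => //; exact: cont_jphase.
apply: le_trans (_ : Ipi (fun=> e / pi) <= _); last first.
  by rewrite Ipi_cst divfK// gt_eqF// pi_gt0.
apply: le_Ipi; [|exact: cont_cst|].
  by apply: cont_norm; apply: contB => //; exact: cont_jphase.
move=> x _; rewrite jphase_LL -cReN -cReD -mulrN -mulrDr.
apply: le_trans (Re_normc _) _; rewrite Normc.normcM normc_cis mul1r.
by rewrite -normcN opprB.
Qed.
End Approximation.

(** * Boundary values on the unit circle *)

Section RadialLimit.
Context {R : realType}.
Implicit Types (s t x r : R).

Lemma contf_measurable (f : R -> R) (D : set (measurableTypeR R)) : contf f -> measurable D ->
  measurable_fun D (fun x : measurableTypeR R => (f x)%:E).
Proof.
move=> cf mD; apply/measurable_EFinP; apply: measurable_funTS.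
by apply: continuous_measurable_fun; exact: cf.
Qed.

Lemma Ipi_oo (f : R -> R) : contf f ->
  ((Ipi f)%:E = \int[@lebesgue_measure R]_(x in `]0%R, pi[) (f x)%:E)%E.
Proof.
move=> cf; have mf D := contf_measurable f D cf.
rewrite integral_itv_bndo_bndc; last exact: mf.
rewrite integral_itv_obnd_cbnd; last exact: mf.
rewrite /Ipi /Rintegral fineK//.
by apply: integrable_fin_num => //; exact: continuous_integrable_itv.
Qed.

Lemma expR_ln_powR (y e : R) : 0 < y -> expR (e * ln y) = y `^ e.
Proof. by move=> y0; rewrite /powR gt_eqF. Qed.

Lemma half_cos x : cos x = 1 - 2 * sin (x / 2) ^+ 2 /\ cos x = 2 * cos (x / 2) ^+ 2 - 1
  /\ sin x = 2 * (sin (x / 2) * cos (x / 2)).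
Proof.
set y := x / 2; have -> : x = y *+ 2 by rewrite -mulr_natr /y; field.
have := cos2Dsin2 y; rewrite cos_mulr2n sin_mulr2n !mulr2n => E.
by split; [lra|split; ring].
Qed.

Lemma half_bounds x : 0 < x < pi -> 0 < sin (x / 2) /\ 0 < cos (x / 2).
Proof.
move=> /andP[x0 xp]; split.
  by apply: sin_gt0_pihalf; rewrite divr_gt0//= ltr_pM2r.
apply: cos_gt0_pihalf; have := @pi_gt0 R; rewrite ltr_pM2r// xp andbT => p0.
by apply: (@lt_trans _ _ 0); rewrite ?oppr_lt0 divr_gt0.
Qed.

Lemma argr1 x : 0 < x < pi -> argr 1 x = x / 2 - pi / 2.
Proof.
move=> xp; have [s0 c0] := half_bounds x xp; have [h1 [h2 h3]] := half_cos x.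
rewrite /argr !mul1r h3 h1.
have -> : - (2 * (sin (x / 2) * cos (x / 2))) / (1 - (1 - 2 * sin (x / 2) ^+ 2))
  = tan (x / 2 - pi / 2).
  rewrite /tan sinBpihalf cosBpihalf; field.
  by rewrite gt_eqF//= opprB addrC subrK gt_eqF// mulr_gt0// exprn_gt0.
rewrite tanK// in_itv/=; case/andP: xp => x0 xp; have := @pi_gt0 R; lra.
Qed.

Lemma argrN1 x : 0 < x < pi -> argr (-1) x = x / 2.
Proof.
move=> xp; have [s0 c0] := half_bounds x xp; have [h1 [h2 h3]] := half_cos x.
rewrite /argr !mulN1r !opprK h3 h2.
have -> : (2 * (sin (x / 2) * cos (x / 2))) / (1 + (2 * cos (x / 2) ^+ 2 - 1)) = tan (x / 2).
  rewrite /tan; field.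
  by rewrite gt_eqF//= addrC subrK gt_eqF// mulr_gt0// exprn_gt0.
rewrite tanK// in_itv/=; case/andP: xp => x0 xp; have := @pi_gt0 R; lra.
Qed.

Lemma cos_lt1 x : 0 < x < pi -> 0 < 1 - cos x /\ 0 < 1 + cos x.
Proof.
move=> xp; have [s0 c0] := half_bounds x xp; have [h1 [h2 h3]] := half_cos x; split.
  by rewrite h1 opprB addrC subrK mulr_gt0// exprn_gt0.
by rewrite h2 addrC subrK mulr_gt0// exprn_gt0.
Qed.

(** On the circle 1 - exp(ix) and 1 + exp(ix) have squared moduli 2 (1 - cos x) and 2 (1 + cos x),
    and arguments (x - pi) / 2 and x / 2. This is the origin of the frequency shift (s + t) / 2 and
    of the phase s pi / 2. *)
Lemma jphase1 s t k x : 0 < x < pi -> jphase s t k 1 x =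
  2 `^ ((s + t) / 2) * (jac (s / 2) (t / 2) x * cos ((k%:R + (s + t) / 2) * x - s * pi / 2)).
Proof.
move=> xp; have [c1 c2] := cos_lt1 x xp.
rewrite /jphase argr1// argrN1// [RHS]mulrA; congr (_ * _); last by congr (cos _); field.
rewrite /lnr /sqdist sqrrN expr1n mulr1 mulrN1 mulNr opprK.
have -> : 1 - 2 * cos x + 1 = 2 * (1 - cos x) by ring.
have -> : 1 + 2 * cos x + 1 = 2 * (1 + cos x) by ring.
rewrite expRD !mulrA !expR_ln_powR ?mulr_gt0//.
rewrite !powRM ?ltW// /jac mulrDl powRD; last by rewrite pnatr_eq0 implybT.
by ring.
Qed.

Lemma sqdist_pos1 x : 0 < x < pi -> 0 < sqdist 1 x /\ 0 < sqdist (-1) x.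
Proof. by move=> /cos_lt1[h1 h2]; rewrite /sqdist sqrrN expr1n; split; lra. Qed.

Lemma jphase_cvg s t k x : 0 < x < pi ->
  (fun n => jphase s t k (1 - n.+2%:R^-1) x) @ \oo --> jphase s t k 1 x.
Proof.
move=> xp; have [c1 c2] := cos_lt1 x xp; have [d1 d2] := sqdist_pos1 x xp.
have r1 : (fun n => 1 - n.+2%:R^-1 : R) @ \oo --> (1 : R).
  rewrite -[X in _ --> X]subr0; apply: cvgB; first exact: cvg_cst.
  have := @cvg_harmonic R; rewrite -cvg_shiftS; exact.
have r2 : (fun n => - (1 - n.+2%:R^-1) : R) @ \oo --> (-1 : R) by exact: cvgN.
have hl (u : nat -> R) (l : R) : 0 < sqdist l x -> u @ \oo --> l -> (fun n => lnr (u n) x) @ \oo --> lnr l x.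
  move=> l0 ul; apply: cvgMr; apply: (cvg_comp (fun n => sqdist (u n) x) (@ln R)); last exact: continuous_ln.
  rewrite /sqdist; apply: cvgD; last by apply: (cvg_comp u (fun y : R => y ^+ 2)); [exact: ul|exact: exprn_continuous].
  by apply: cvgB; [exact: cvg_cst|apply: cvgMl; exact: cvgMr].
have ha (u : nat -> R) (l : R) : 0 < 1 - l * cos x -> u @ \oo --> l -> (fun n => argr (u n) x) @ \oo --> argr l x.
  move=> l0 ul; apply: (cvg_comp (fun n => - (u n * sin x) / (1 - u n * cos x)) (@atan R)); last exact: continuous_atan.
  apply: cvgM; first by apply: cvgN; exact: cvgMl.
  by apply: cvgV; [rewrite gt_eqF|apply: cvgB; [exact: cvg_cst|exact: cvgMl]].
apply: cvgM.
  apply: (cvg_comp (fun n => s * lnr (1 - n.+2%:R^-1) x + t * lnr (- (1 - n.+2%:R^-1)) x) (@expR R)); last exact: continuous_expR.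
  by apply: cvgD; apply: cvgMr; apply: hl.
apply: (cvg_comp (fun n => k%:R * x + s * argr (1 - n.+2%:R^-1) x + t * argr (- (1 - n.+2%:R^-1)) x) (@cos R)); last exact: continuous_cos.
apply: cvgD; [apply: cvgD; [exact: cvg_cst|]|]; apply: cvgMr; apply: ha => //; rewrite ?mul1r//.
by rewrite mulN1r opprK.
Qed.

Lemma jphase_bound s t k r x : 0 <= s -> 0 <= t -> 0 <= r < 1 ->
  `|jphase s t k r x| <= expR ((s + t) * (2^-1 * ln 4)).
Proof.
move=> s0 t0 /andP[r0 r1]; rewrite /jphase normrM.
apply: le_trans (_ : expR (s * lnr r x + t * lnr (- r) x) * 1 <= _).
  by rewrite ger0_norm ?expR_ge0// ler_wpM2l ?expR_ge0// cos_max.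
rewrite mulr1 ler_expR mulrDl.
have H (y : R) : `|y| < 1 -> lnr y x <= 2^-1 * ln 4.
  move=> y1; rewrite /lnr ler_pM2l// ler_ln ?posrE ?sqdist_gt0// sqdist_normc.
  have -> : 4 = 2 ^+ 2 :> R by rewrite expr2 -natrM.
  rewrite ler_pXn2r ?nnegrE ?normc_ge0//.
  apply: le_trans (normcB _ _) _; rewrite Normc.normc1 Normc.normcM normc_cis mulr1 normc_real; lra.
by apply: lerD; apply: ler_wpM2l => //; apply: H; rewrite ?normrN ger0_norm.
Qed.

(** An exact identity for each k, obtained from [Ipi_jphase] by dominated convergence as r tends to
    1. It makes the square root of the weight times the shifted cosine of index n orthogonal to all
    polynomials in cos x of degree less than n, and not merely asymptotically so. *)
Lemma Ipi_jac_cos s t k : 0 <= s -> 0 <= t ->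
  Ipi (fun x => jac (s / 2) (t / 2) x * cos ((k%:R + (s + t) / 2) * x - s * pi / 2)) =
  if k == 0%N then pi * 2 `^ (- ((s + t) / 2)) else 0.
Proof.
move=> s0 t0; set g := fun x : R => _.
have cg : contf g.
  by apply: contM; [apply: cont_jac; rewrite divr_ge0|cont].
pose r n : R := 1 - n.+2%:R^-1.
have r01 n : 0 <= r n < 1.
  rewrite subr_ge0 invf_le1 ?ltr0n// ler1n/= gtrBl invr_gt0 ltr0n//.
have mu_oo : measurable (`]0, pi[%classic : set R) by [].
have [|||||_ _] := @dominated_convergence _ _ R (@lebesgue_measure R) `]0, pi[%classic mu_oo
   (fun n x => (jphase s t k (r n) x)%:E) (fun x => (2 `^ ((s + t) / 2) * g x)%:E)
   (fun x => (expR ((s + t) * (2^-1 * ln 4)))%:E).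
- by move=> n; apply: contf_measurable => //; exact: cont_jphase.
- apply: contf_measurable => //; apply: contM => //; exact: cont_cst.
- apply/aeW => x; rewrite /= in_itv/= => xp; rewrite -jphase1//.
  by apply/fine_cvgP; split; [exact: nearW|exact: jphase_cvg].
- apply: integrableS (continuous_integrable_itv _ 0 pi (cont_cst _)) => //; exact: subset_itv_oo_cc.
- by apply/aeW => x n _; rewrite lee_fin jphase_bound.
rewrite -Ipi_oo; last by apply: contM => //; exact: cont_cst.
rewrite (_ : (fun n => _) = (fun=> (if k == 0%N then pi else 0)%:E)); last first.
  by apply/funext => n; rewrite -Ipi_oo ?Ipi_jphase//; exact: cont_jphase.
move=> /(cvg_lim (@ereal_hausdorff R)); rewrite lim_cst// => -[].
rewrite IpiZ// => E.
have p0 : 0 < 2 `^ ((s + t) / 2) :> R by rewrite powR_gt0.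
apply: (mulfI (lt0r_neq0 p0)); rewrite -E powRN; case: ifP => _; last by rewrite mulr0.
by field; rewrite gt_eqF.
Qed.
End RadialLimit.

(** * Nearly extremal polynomials that vanish at prescribed points *)

Section SzegoExtremal.
Context {R : realType}.
Local Notation C := (complex R).
Local Notation normc := (@Normc.normc R).
Local Notation Re := (@complex.Re R).
Local Notation Im := (@complex.Im R).
Implicit Types (s t x r y : R) (phis : seq R).

(** Real quadratic factors with zeros exp(if) and exp(- if), normalised to constant coefficient
    1. *)
Definition vanish phis : {poly R} := \prod_(f <- phis) (1 - (2 * cos f) *: 'X + 'X ^+ 2).

Lemma evc_vanish phis x :
  evc (vanish phis) x = \prod_(f <- phis) ((1 - cis (x + f)) * (1 - cis (x - f))).
Proof.
rewrite evc_prod; apply: eq_bigr => f _.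
rewrite evcD evcB evc1 evcZ evcX evc_XX mulrBr mulr1 mulrBl mul1r.
have -> : cis (x + f) * cis (x - f) = cis x ^+ 2.
  by rewrite -cisD cisX; congr cis; ring.
have -> : ((2 * cos f)%:C)%C * cis x = cis (x + f) + cis (x - f).
  rewrite !cisD; apply: complex_eq; rewrite ?cReD ?cImD ?cReM ?cImM/= cosN sinN; ring.
by ring.
Qed.

Lemma vanish_coef0 phis : (vanish phis)`_0 = 1.
Proof.
rewrite -horner_coef0 /vanish horner_prod big1// => f _.
by rewrite !hornerE; ring.
Qed.

Lemma evc_vanish_root phis f : f \in phis -> evc (vanish phis) f = 0.
Proof.
move=> fin; rewrite evc_vanish (big_rem f)//= subrr cis0 subrr.
by rewrite mulr0 mul0r.
Qed.

(** After multiplication by (1 + r)^2 the difference of the two sides is 2 (1 - r)^2 (1 + cos y).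
    Thus a factor 1 - exp(iy), divided by its copy at radius r, has modulus at most 2 / (1 + r),
    which tends to 1. *)
Lemma sqdist1_le r y : 0 <= r < 1 -> sqdist 1 y <= (2 / (1 + r)) ^+ 2 * sqdist r y.
Proof.
move=> /andP[r0 r1]; have p : 0 < (1 + r) ^+ 2 by rewrite exprn_gt0// ltr_wpDr.
rewrite exprMn exprVn mulrAC ler_pdivlMr// /sqdist -subr_ge0.
have -> : 2 ^+ 2 * (1 - 2 * r * cos y + r ^+ 2) - (1 - 2 * 1 * cos y + 1 ^+ 2) * (1 + r) ^+ 2
  = 2 * (1 - r) ^+ 2 * (1 + cos y) by ring.
by rewrite mulr_ge0 ?onepcos_ge0// mulr_ge0// sqr_ge0.
Qed.

Lemma sqdist1_ge0 y : 0 <= sqdist 1 y.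
Proof. by rewrite sqdist_normc sqr_ge0. Qed.
Lemma sqdist1_le4 y : sqdist 1 y <= 4.
Proof. rewrite /sqdist; have := cos_geN1 y; lra. Qed.

Lemma LL_cat (J1 J2 : seq (R * R)) r x : LL (J1 ++ J2) r x = LL J1 r x + LL J2 r x.
Proof. by rewrite /LL big_cat. Qed.

Lemma cexp_LL_cat (J1 J2 : seq (R * R)) r x :
  cexp (LL (J1 ++ J2) r x) = cexp (LL J1 r x) * cexp (LL J2 r x).
Proof. by rewrite LL_cat; exact: cexpD. Qed.

(** The weight -1 in [LL] divides each factor of [vanish] by its copy at radius r. Imposing zeros at
    the mass points therefore costs only a power of 2 / (1 + r), and nothing in the limit. *)
Lemma normc_cexp_masses phis r x : 0 <= r < 1 ->
  (normc (cexp (LL [seq (-1, f) | f <- phis] r x)) * normc (evc (vanish phis) x)) ^+ 2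
  <= ((2 / (1 + r)) ^+ 4) ^+ size phis.
Proof.
move=> r01; have r1' : `|r| < 1 by case/andP: r01 => ? ?; rewrite ger0_norm.
elim: phis => [|f phis IH].
  have -> : LL [seq (-1, f) | f <- [::]] r x = 0 by exact: big_nil.
  by rewrite cexp0 /vanish big_nil evc1 Normc.normc1 mulr1 expr1n.
have -> : [seq (-1, g) | g <- f :: phis] = [:: (-1, f)] ++ [seq (-1, g) | g <- phis] by [].
rewrite cexp_LL_cat (Normc.normcM (cexp _)) evc_vanish big_cons (Normc.normcM (_ * _)) -evc_vanish mulrACA.
rewrite exprMn [leRHS]exprS; apply: ler_pM => //; try exact: sqr_ge0.
have hRe : Re (LL [:: (-1, f)] r x) = - (lnr r (x + f) + lnr r (x - f)).
  by rewrite /LL big_seq1 cReM/= mul0r subr0 mulN1r.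
rewrite exprMn normc_cexp hRe !Normc.normcM.
have E y : (expR (- lnr r y)) ^+ 2 = (sqdist r y)^-1.
  rewrite -expRM_natl /lnr mulrN mulrA mulfV// mul1r expRN lnK// posrE; exact: sqdist_gt0.
rewrite opprD expRD ![in leLHS]exprMn !E.
have D y : normc (1 - cis y) ^+ 2 = sqdist 1 y by rewrite sqdist_normc mul1r.
have F y : (sqdist r y)^-1 * sqdist 1 y <= (2 / (1 + r)) ^+ 2.
  by rewrite mulrC ler_pdivrMr ?sqdist_gt0//; exact: sqdist1_le.
rewrite !D mulrACA [leRHS](_ : _ = (2 / (1 + r)) ^+ 2 * (2 / (1 + r)) ^+ 2); last by rewrite -exprD.
by apply: ler_pM; rewrite ?F// mulr_ge0 ?invr_ge0 ?sqdist1_ge0 ?(ltW (sqdist_gt0 _ _ _)).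
Qed.

Lemma jac_sqdist s t x : jac s t x * 2 `^ (s + t) = sqdist 1 x `^ s * sqdist 1 (x + pi) `^ t.
Proof.
rewrite /jac powRD; last by rewrite pnatr_eq0 implybT.
have -> : sqdist 1 x = 2 * (1 - cos x) by rewrite /sqdist; ring.
have -> : sqdist 1 (x + pi) = 2 * (1 + cos x) by rewrite /sqdist cosDpi; ring.
by rewrite !powRM ?onemcos_ge0 ?onepcos_ge0//; ring.
Qed.

(** The exponential is the reciprocal of the Szego function (1 - z)^s (1 + z)^t at radius r,
    compared by [sqdist1_le] with the boundary weight 2^(s + t) jac, which is |1 - z|^(2 s) |1 +
    z|^(2 t) at |z| = 1. *)
Lemma normc_cexp_weight s t r x : 0 <= s -> 0 <= t -> 0 <= r < 1 ->
  normc (cexp (LL [:: (- (s / 2), 0); (- (t / 2), pi)] r x)) ^+ 2 * (jac s t x * 2 `^ (s + t))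
  <= (2 / (1 + r)) `^ (2 * (s + t)).
Proof.
move=> s0 t0 r01; have r1' : `|r| < 1 by case/andP: r01 => ? ?; rewrite ger0_norm.
have Epi : sqdist r (x - pi) = sqdist r (x + pi).
  by rewrite /sqdist cosB cosDpi cospi sinpi; ring.
rewrite normc_cexp /LL !big_cons big_nil addr0 !cReD !cReM/= addr0 subr0.
have E a y : expR (- (a / 2) * (lnr r y + lnr r y)) ^+ 2 = (sqdist r y `^ a)^-1.
  rewrite -expRM_natl -powRN -expR_ln_powR ?sqdist_gt0//; congr expR; rewrite /lnr; field => //.
rewrite !mul0r !subr0.
have -> : lnr r (x - pi) = lnr r (x + pi) by rewrite /lnr Epi.
rewrite expRD exprMn !E jac_sqdist mulrACA mulrDr powRD; last first.
  suff -> : 2 / (1 + r) != 0 by rewrite implybT.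
  by rewrite mulf_neq0// invr_eq0 gt_eqF// ltr_pwDl//; case/andP: r01.
have r2 : 0 <= 2 / (1 + r) by rewrite divr_ge0// addr_ge0//; case/andP: r01.
have F y a : 0 <= a -> (sqdist r y `^ a)^-1 * sqdist 1 y `^ a <= (2 / (1 + r)) `^ (2 * a).
  move=> a0; rewrite powRrM powR_mulrn// mulrC ler_pdivrMr ?powR_gt0 ?sqdist_gt0//.
  rewrite -powRM ?sqr_ge0 ?(ltW (sqdist_gt0 _ _ _))//.
  apply: ge0_ler_powR => //; rewrite ?nnegrE ?sqdist1_ge0//; last exact: sqdist1_le.
  by rewrite mulr_ge0 ?sqr_ge0 ?(ltW (sqdist_gt0 _ _ _)).
by apply: ler_pM; rewrite ?mulr_ge0 ?invr_ge0 ?powR_ge0// F.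
Qed.

(** E approximates the reciprocal Szego function, corrected by the factors of [vanish]. The weight
    2^(s + t) jac has geometric mean 1, so the constant 1 is the best possible under the
    normalisation of the constant coefficient. *)
Lemma szego_extremal s t phis (e : R) : 0 <= s -> 0 <= t -> 0 < e ->
  exists E : {poly R}, [/\ E`_0 = 1, (forall f, f \in phis -> evc E f = 0)
    & forall x, normc (evc E x) ^+ 2 * (jac s t x * 2 `^ (s + t)) <= 1 + e].
Proof.
move=> s0 t0 e0.
pose h := Num.min (2^-1) (e / 2).
have h0 : 0 < h by rewrite lt_min invr_gt0 ltr0n/= divr_gt0.
have h2 : h <= 2^-1 by rewrite ge_min lexx.
have he : h <= e / 2 by rewrite ge_min lexx orbT.
(* g exceeds by 1 the total exponent of 2 / (1 + r) in the two preceding bounds: 2 (s + t) from the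
   weight and 4 from each point of [phis]. With rho = (1 + h)^(1/g) the product of these bounds is
   at most 1 + h, and r is then solved from 2 / (1 + r) = rho. *)
pose k := size phis; pose g := 2 * (s + t) + 4 * k%:R + 1 : R.
have g1 : 1 <= g by rewrite lerDr addr_ge0 ?mulr_ge0 ?addr_ge0.
have g0 : 0 < g by exact: lt_le_trans g1.
pose rho := (1 + h) `^ (g^-1).
have rho1 : 1 < rho.
  rewrite /rho -expR_ln_powR ?ltr_wpDr ?(ltW h0)// -[X in X < _]expR0 ltr_expR.
  by rewrite mulr_gt0 ?invr_gt0// ln_gt0// ltrDl.
have rho2 : rho < 2.
  apply: le_lt_trans (ler1_powR _ _) _; rewrite ?lerDl ?(ltW h0)// ?invf_le1//; lra.
pose r := 2 / rho - 1.
have r01 : 0 <= r < 1.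
  have p : 0 < rho by exact: lt_trans rho1.
  by rewrite subr_ge0 ler_pdivlMr// mul1r (ltW rho2)/= ltrBlDr ltr_pdivrMr//; lra.
have rE : 2 / (1 + r) = rho by rewrite /r addrC subrK; field; rewrite gt_eqF// (lt_trans _ rho1).
(* A crude bound for the weight times the squared modulus of [vanish], each |1 - exp(iy)| being at
   most 2. It controls the effect of the approximation error d. *)
pose Zmax := 16 ^+ k * (4 `^ s * 4 `^ t) : R.
have Zmax0 : 0 <= Zmax by rewrite mulr_ge0 ?exprn_ge0 ?mulr_ge0 ?powR_ge0.
pose d := Num.min 1 (e / 2 / (2 + 2 * Zmax)).
have d0 : 0 < d by rewrite lt_min ltr01/= !divr_gt0// ltr_wpDr// mulr_ge0.
pose J := [:: (- (s / 2), 0 : R); (- (t / 2), pi)] ++ [seq (-1, f) | f <- phis].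
have [B B0 HB] := cexp_LL_approx J r d r01 d0.
exists (B * vanish phis); split.
- by rewrite -horner_coef0 hornerM !horner_coef0 B0 vanish_coef0 mulr1.
- by move=> f fin; rewrite evcM evc_vanish_root// mulr0.
move=> x; rewrite evcM Normc.normcM exprMn -mulrA.
set Z := normc (evc (vanish phis) x) ^+ 2 * _.
set b := normc (cexp (LL J r x)).
have Z0 : 0 <= Z by rewrite mulr_ge0 ?sqr_ge0// mulr_ge0 ?powR_ge0// /jac mulr_ge0// powR_ge0.
have ZZ : Z <= Zmax.
  rewrite /Z jac_sqdist; apply: ler_pM; rewrite ?sqr_ge0 ?mulr_ge0 ?powR_ge0//.
    have H y : normc (1 - cis y) <= 2.
      by apply: le_trans (normcB _ _) _; rewrite Normc.normc1 normc_cis; lra.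
    rewrite evc_vanish /k; elim: (phis) => [|f ph IH]; first by rewrite big_nil Normc.normc1 expr1n.
    rewrite big_cons /= [leRHS]exprS !Normc.normcM !exprMn.
    apply: ler_pM; rewrite ?mulr_ge0 ?sqr_ge0 ?normc_ge0//.
    have -> : 16 = 2 ^+ 2 * 2 ^+ 2 :> R by rewrite -!natrX -natrM.
    by apply: ler_pM; rewrite ?sqr_ge0// ler_pXn2r ?nnegrE ?normc_ge0.
  by apply: ler_pM; rewrite ?powR_ge0//; apply: ge0_ler_powR;
    rewrite ?nnegrE ?sqdist1_ge0 ?sqdist1_le4.
have bZ : b ^+ 2 * Z <= 1 + h.
  rewrite /b /J cexp_LL_cat (Normc.normcM (cexp _)) exprMn /Z.
  set A := normc (cexp _); set A' := normc (cexp _); set V := normc (evc _ _); set W := jac _ _ _ * _.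
  have -> : A ^+ 2 * A' ^+ 2 * (V ^+ 2 * W) = (A ^+ 2 * W) * (A' * V) ^+ 2 by ring.
  apply: le_trans (_ : rho `^ (2 * (s + t)) * (rho ^+ 4) ^+ k <= _).
    rewrite -rE; apply: ler_pM; rewrite ?sqr_ge0//.
    - by rewrite mulr_ge0 ?sqr_ge0// mulr_ge0 ?powR_ge0// /jac mulr_ge0// powR_ge0.
    - exact: normc_cexp_weight.
    - exact: normc_cexp_masses.
  have r0 : 0 <= rho by rewrite (le_trans _ (ltW rho1)).
  rewrite -exprM -powR_mulrn// -powRD; last by rewrite (gt_eqF (lt_trans ltr01 rho1)) implybT.
  apply: le_trans (_ : rho `^ g <= _).
    by apply: ler_powR; rewrite ?(ltW rho1)// natrM /g lerDl.
  by rewrite /rho -powRrM mulVf ?gt_eqF// powRr1// ltW// ltr_wpDr// ltW.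
have bB : normc (evc B x) <= b + d.
  have -> : evc B x = cexp (LL J r x) + (evc B x - cexp (LL J r x)) by ring.
  by apply: le_trans (le_normcD _ _) _; rewrite lerD2l.
have b0 : 0 <= b := normc_ge0 _.
have d1 : d <= 1 by rewrite ge_min lexx.
have dZ : d * (2 + 2 * Zmax) <= e / 2.
  by rewrite -ler_pdivlMr ?ge_min ?lexx ?orbT// ltr_wpDr// mulr_ge0.
apply: le_trans (_ : (b + d) ^+ 2 * Z <= _).
  by apply: ler_wpM2r => //; rewrite ler_pXn2r ?nnegrE ?normc_ge0 ?addr_ge0 ?(ltW d0).
have E1 : 2 * b * Z <= b ^+ 2 * Z + Z.
  by have := mulr_ge0 (sqr_ge0 (b - 1)) Z0; rewrite (_ : (b - 1) ^+ 2 * Z = b ^+ 2 * Z - 2 * b * Z + Z); [lra|ring].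
have E2 : d * (2 * b * Z) <= d * (1 + h + Zmax) by rewrite ler_pM2l//; lra.
have E3 : d * (d * Z) <= d * Zmax.
  by rewrite ler_pM2l//; apply: le_trans (_ : 1 * Z <= _); [rewrite ler_wpM2r|rewrite mul1r].
have E4 : d * h <= d by rewrite ger_pMr//; lra.
have -> : (b + d) ^+ 2 * Z = b ^+ 2 * Z + d * (2 * b * Z) + d * (d * Z) by ring.
lra.
Qed.
End SzegoExtremal.

(** * Cutoffs and power weights *)

Section Cutoffs.
Context {R : realType}.
Implicit Types (d e x y r : R) (f : R -> R).

Definition clamp d x : R := Num.max d (Num.min x (pi - d)).
(* Freezing the weight outside [d, pi - d] makes it continuous on the whole line. *)
Definition jacc d (u v : R) x : R := jac u v (clamp d x).

Lemma cont_clamp d : contf (clamp d).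
Proof. by rewrite /clamp; cont. Qed.
Lemma clamp_id d x : d <= x <= pi - d -> clamp d x = x.
Proof. by move=> /andP[h1 h2]; rewrite /clamp (min_idPl _)// (max_idPr _). Qed.
Lemma clamp_in d x : 0 < d -> d < pi / 2 -> 0 < clamp d x < pi.
Proof.
move=> d0 d1; rewrite /clamp lt_max d0/= gt_max; have p := @pi_gt0 R.
apply/andP; split; first by lra.
by rewrite gt_min; apply/orP; right; lra.
Qed.
Lemma jac_ge0 (u v : R) x : 0 <= jac u v x.
Proof. by rewrite mulr_ge0// powR_ge0. Qed.
Lemma jacD (u v u' v' : R) x : 0 < x < pi -> jac (u + u') (v + v') x = jac u v x * jac u' v' x.
Proof.
move=> /cos_lt1[h1 h2]; have n1 : 1 - cos x != 0 by rewrite gt_eqF.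
have n2 : 1 + cos x != 0 by rewrite gt_eqF.
by rewrite /jac !powRD ?n1 ?n2 ?implybT//; ring.
Qed.
Lemma jacX (u v r : R) x : jac u v x `^ r = jac (u * r) (v * r) x.
Proof. by rewrite /jac powRM ?powR_ge0// -!powRrM. Qed.
Lemma cont_jacc d (u v : R) : 0 < d -> d < pi / 2 -> contf (jacc d u v).
Proof.
move=> d0 d1; have cc := cont_clamp d.
apply: contM; apply: cont_powR; try by cont.
- by move=> x; have [] := cos_lt1 _ (clamp_in d x d0 d1).
- by move=> x; have [] := cos_lt1 _ (clamp_in d x d0 d1).
Qed.
Lemma jaccE d (u v : R) x : d <= x <= pi - d -> jacc d u v x = jac u v x.
Proof. by move=> h; rewrite /jacc clamp_id. Qed.

(* A continuous minorant of the indicator of ]1, +oo[: integrals of continuous functions then bound distribution functions from below. *)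
Definition ramp x : R := Num.min 1 (Num.max 0 (x - 1)).
Lemma cont_ramp f : contf f -> contf (fun x => ramp (f x)).
Proof. by move=> cf; rewrite /ramp; cont. Qed.
Lemma ramp_ge0 x : 0 <= ramp x.
Proof. by rewrite /ramp le_min ler01/= le_max lexx. Qed.
Lemma ramp_le1 x : ramp x <= 1.
Proof. by rewrite /ramp ge_min lexx. Qed.
Lemma ramp_mono x y : x <= y -> ramp x <= ramp y.
Proof.
move=> xy; rewrite /ramp le_min ge_min lexx/= ge_min; apply/orP; right.
by rewrite ge_max le_max lexx/= le_max lerB// orbT.
Qed.
Lemma ramp_gt1 x : ramp x != 0 -> 1 < x.
Proof.
by apply: contraNlt => x1; rewrite /ramp (max_idPl _) ?(min_idPr _)//; lra.
Qed.
Lemma ramp_2 x : 2 <= x -> ramp x = 1.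
Proof. by move=> x2; rewrite /ramp (min_idPl _)// le_max; apply/orP; right; lra. Qed.

(** If |A - B| exceeds 4 S, one of |A|, |B| is at least 2 S, where the ramp is saturated. This
    passes from the difference of two consecutive partial sums to the sums themselves. *)
Lemma ramp_sub (A B S : R) : 0 < S ->
  ramp (`|A - B| / (4 * S)) <= ramp (`|A| / S) + ramp (`|B| / S).
Proof.
move=> S0; have := ramp_ge0 (`|A| / S); have := ramp_ge0 (`|B| / S) => hB hA.
have [->|/ramp_gt1] := eqVneq (ramp (`|A - B| / (4 * S))) 0; first exact: addr_ge0.
rewrite ltr_pdivlMr ?mulr_gt0// mul1r => h; have := ler_normB A B => h2.
apply: le_trans (ramp_le1 _) _.
have [hh|hh] := leP (2 * S) `|A|.
  by rewrite (ramp_2 (`|A| / S)) ?lerDl// ler_pdivlMr.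
by rewrite addrC (ramp_2 (`|B| / S)) ?lerDl// ler_pdivlMr//; lra.
Qed.

Definition tri e x : R := Num.max 0 (1 - `|x / e - 3|).
Lemma cont_tri e : contf (tri e).
Proof. by rewrite /tri; cont. Qed.
Lemma tri_ge0 e x : 0 <= tri e x. Proof. by rewrite /tri le_max lexx. Qed.
Lemma tri_le1 e x : tri e x <= 1.
Proof. by rewrite /tri ge_max ler01/= gerBl. Qed.
Lemma tri_supp e x : 0 < e -> tri e x != 0 -> 2 * e <= x <= 4 * e.
Proof.
move=> e0; apply: contraNP => h; apply/eqP; rewrite /tri; apply/max_idPl.
rewrite subr_le0 leNgt ltr_norml; apply/negP => /andP[h1 h2]; case: h.
rewrite ltrBrDr ltr_pdivlMr// in h1; rewrite ltrBlDr ltr_pdivrMr// in h2.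
by apply/andP; split; lra.
Qed.

Definition plateau e x : R := Num.min 1 (Num.max 0 (x / e - 1)) * Num.min 1 (Num.max 0 (2 - 2 * x)).
Lemma cont_plateau e : contf (plateau e).
Proof. by rewrite /plateau; cont. Qed.
Lemma plateau01 e x : 0 <= plateau e x <= 1.
Proof.
rewrite /plateau; set A := Num.min _ _; set B := Num.min _ _.
have A0 : 0 <= A by rewrite le_min ler01 le_max lexx.
have B0 : 0 <= B by rewrite le_min ler01 le_max lexx.
have A1 : A <= 1 by rewrite ge_min lexx.
have B1 : B <= 1 by rewrite ge_min lexx.
by rewrite mulr_ge0//= -[leRHS]mulr1 ler_pM.
Qed.
Lemma plateau_supp e x : 0 < e -> plateau e x != 0 -> e <= x <= 1.
Proof.
move=> e0; apply: contraNP => h; apply/eqP; rewrite /plateau.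
have [xe|ex] := ltP x e.
  rewrite [Num.max 0 (x / e - 1)](max_idPl _) ?(min_idPr ler01) ?mul0r//.
  by rewrite subr_le0 ler_pdivrMr// mul1r ltW.
rewrite [Num.max 0 (2 - 2 * x)](max_idPl _) ?(min_idPr ler01) ?mulr0//.
by case: (leP x 1) => [x1|x1]; [case: h; rewrite ex x1|lra].
Qed.
Lemma plateau1 e x : 0 < e -> 2 * e <= x <= 2^-1 -> plateau e x = 1.
Proof.
move=> e0 /andP[h1 h2]; have k1 : 2 <= x / e by rewrite ler_pdivlMr.
rewrite /plateau !(min_idPl _) ?mul1r// le_max; apply/orP; right; lra.
Qed.

Lemma Ipi_sub f (a b : R) (G F : R -> R) : contf f -> (forall x, 0 <= x <= pi -> 0 <= f x) ->
  0 <= a -> a < b -> b <= pi ->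
  (forall x, a <= x <= b -> is_derive x 1 F (G x)) -> (forall x, a <= x <= b -> {for x, continuous G}) ->
  (forall x, a <= x <= b -> G x <= f x) -> F b - F a <= Ipi f.
Proof.
move=> cf f0 a0 ab bp dF cG Gf.
have sub : (`[a, b] `<=` `[0, pi])%classic.
  by move=> x; rewrite /= !in_itv/= => /andP[h1 h2]; apply/andP; split; lra.
have cGab : {within `[a, b], continuous G}.
  by apply: continuous_in_subspaceT => x; rewrite inE/= in_itv/= => h; exact: cG.
have E : (\int[@lebesgue_measure R]_(x in `[a, b]) (G x)%:E = (F b)%:E - (F a)%:E)%E.
  have cF x : a <= x <= b -> {for x, continuous F}.
    move=> h; apply: differentiable_continuous; apply/derivable1_diffP.
    by have := dF x h => ?; exact: ex_derive.
  apply: continuous_FTC2 => //.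
  - split.
    + by move=> x; rewrite in_itv/= => /andP[h1 h2]; have := dF x _ => /(_ _)[]//; apply/andP; split; exact: ltW.
    + by apply/cvg_at_right_filter/cF; rewrite lexx ltW.
    + by apply/cvg_at_left_filter/cF; rewrite lexx ltW.
  - move=> x; rewrite in_itv/= => /andP[h1 h2]; rewrite derive1E.
    by have := dF x _ => /(_ _)[]//; apply/andP; split; exact: ltW.
have iG : (@lebesgue_measure R).-integrable `[a, b] (EFin \o G).
  by apply: continuous_compact_integrable => //; exact: segment_compact.
have -> : F b - F a = (\int[@lebesgue_measure R]_(x in `[a, b]) G x)%R.
  by rewrite /Rintegral E.
apply: (@le_trans _ _ (\int[@lebesgue_measure R]_(x in `[a, b]) f x)%R).
  by apply: le_Rintegral => //; exact: continuous_integrable_itv.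
apply: fine_le.
- by apply: integrable_fin_num => //; exact: continuous_integrable_itv.
- by apply: integrable_fin_num => //; exact: continuous_integrable_itv.
apply: ge0_subset_integral => //.
- exact: contf_measurable.
Qed.

Lemma Ipi_ge_cst f (a b m : R) : contf f -> (forall x, 0 <= x <= pi -> 0 <= f x) ->
  0 <= a -> a < b -> b <= pi -> (forall x, a <= x <= b -> m <= f x) -> m * (b - a) <= Ipi f.
Proof.
move=> cf f0 a0 ab bp mf; rewrite mulrBr.
apply: (Ipi_sub f a b (fun=> m) (fun x => m * x)) => //.
- by move=> x _; apply: is_derive_eq; rewrite /GRing.scale/= mulr1.
- by move=> x _; exact: cvg_cst.
Qed.

Lemma Ipi_tri e : 0 < e -> 4 * e <= pi -> e / 2 <= Ipi (tri e).
Proof.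
move=> e0 ep; have -> : e / 2 = 2^-1 * ((7 / 2) * e - (5 / 2) * e) by field.
apply: Ipi_ge_cst; rewrite ?mulr_ge0 ?(ltW e0)//; try lra.
- exact: cont_tri.
- by move=> x _; exact: tri_ge0.
move=> x /andP[h1 h2]; rewrite /tri le_max; apply/orP; right.
rewrite lerBrDl -lerBrDr ler_norml; apply/andP; split.
  by rewrite lerBrDr ler_pdivlMr//; lra.
by rewrite lerBlDr ler_pdivrMr//; lra.
Qed.

(** The minimum covers both signs of r, for which the power is monotone in opposite directions. *)
Lemma powR_between (m z L r : R) : 0 < m -> 1 <= L -> m <= z <= L * m ->
  m `^ r * Num.min 1 (L `^ r) <= z `^ r.
Proof.
move=> m0 L1 /andP[mz zL]; have z0 : 0 < z := lt_le_trans m0 mz.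
have [r0|r0] := leP 0 r.
  apply: le_trans (_ : m `^ r * 1 <= _).
    by apply: ler_wpM2l; rewrite ?powR_ge0// ge_min lexx.
  by rewrite mulr1; apply: ge0_ler_powR; rewrite ?nnegrE ?(ltW m0) ?(ltW z0).
apply: le_trans (_ : m `^ r * L `^ r <= _).
  by apply: ler_wpM2l; rewrite ?powR_ge0// ge_min lexx orbT.
rewrite -powRM ?(ltW m0) ?(le_trans ler01 L1)// -[r]opprK powRN [leRHS]powRN.
rewrite lef_pV2 ?posrE ?powR_gt0// ?mulr_gt0 ?(lt_le_trans ltr01 L1)//.
by apply: ge0_ler_powR; rewrite ?nnegrE ?oppr_ge0 ?(ltW r0) ?(ltW z0)// 1?mulrC// mulr_ge0 ?(ltW m0) ?(le_trans ler01 L1).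
Qed.

Lemma onemcos_upper x : 1 - cos x <= x ^+ 2.
Proof.
have := cos_sub1 x; rewrite real_normK ?num_real// ler_norml => /andP[h1 h2]; lra.
Qed.
Lemma onemcos_lower x : 0 <= x <= 1 -> x ^+ 2 / 4 <= 1 - cos x.
Proof.
move=> /andP[x0 x1]; have [-> _] := half_cos x.
rewrite opprB addrC subrK; set y := x / 2.
have y0 : 0 <= y by rewrite divr_ge0.
have y1 : y <= 2^-1 by rewrite /y; lra.
have := sin_sub y; rewrite (ger0_norm y0) ler_norml => /andP[h1 h2].
have y3 : y ^+ 3 <= y / 4.
  have -> : y ^+ 3 = y * (y * y) by ring.
  by apply: ler_wpM2l => //; apply: le_trans (_ : 2^-1 * 2^-1 <= _); [exact: ler_pM|lra].
have s1 : 3 / 4 * y <= sin y by lra.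
have : (3 / 4 * y) ^+ 2 <= sin y ^+ 2 by rewrite ler_pXn2r// nnegrE; lra.
have -> : x = 2 * y by rewrite /y; field.
have -> : (3 / 4 * y) ^+ 2 = 9 / 16 * y ^+ 2 by field.
have -> : (2 * y) ^+ 2 / 4 = y ^+ 2 by field.
have := sqr_ge0 y; lra.
Qed.

(** On [2 e, 4 e] with 4 e <= 1, 1 - cos x lies between e^2 and 16 e^2, and 1 + cos x between 1 and
    2; hence 16 and 2. *)
Definition jacmin (u v : R) : R := Num.min 1 (16 `^ u) * Num.min 1 (2 `^ v).
Lemma jacmin_gt0 (u v : R) : 0 < jacmin u v.
Proof. by rewrite mulr_gt0// lt_min ltr01 powR_gt0. Qed.

Lemma jac_lower (u v e x : R) : 0 < e -> 4 * e <= 1 -> 2 * e <= x <= 4 * e ->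
  (e ^+ 2) `^ u * jacmin u v <= jac u v x.
Proof.
move=> e0 e1 /andP[h1 h2]; rewrite /jac /jacmin mulrA.
have x01 : 0 <= x <= 1 by apply/andP; split; lra.
have A := onemcos_upper x; have B := onemcos_lower x x01.
have c1 := cos_le1 x.
have x2 : x ^+ 2 <= (4 * e) ^+ 2 by rewrite ler_pXn2r// nnegrE; lra.
have x3 : (2 * e) ^+ 2 <= x ^+ 2 by rewrite ler_pXn2r// nnegrE; lra.
rewrite !exprMn in x2 x3.
have xx : x ^+ 2 <= 1 by rewrite expr_le1//; lra.
apply: ler_pM; rewrite ?mulr_ge0 ?powR_ge0 ?le_min ?ler01 ?powR_ge0//.
  by apply: powR_between; rewrite ?exprn_gt0 ?ler1n//; apply/andP; split; lra.
rewrite -[X in X <= _]mul1r -[X in X * _](congr1 (@^~ v) (@powR1 R)).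
by apply: powR_between; rewrite ?ler1n//; apply/andP; split; lra.
Qed.

Lemma jac_lower_inv (u v x : R) : u <= - 2^-1 -> 0 < x <= 1 ->
  Num.min 1 (2 `^ v) / x <= jac u v x.
Proof.
move=> u2 /andP[x0 x1]; have A := onemcos_upper x; have B := onemcos_lower x.
have xx : x ^+ 2 <= 1 by rewrite expr_le1// ltW.
have x20 : 0 < x ^+ 2 by rewrite exprn_gt0.
have pos : 0 < 1 - cos x by apply: lt_le_trans (B _); [lra|apply/andP; split; lra].
rewrite /jac mulrC; apply: ler_pM; rewrite ?invr_ge0 ?(ltW x0) ?le_min ?ler01 ?powR_ge0//.
  apply: le_trans (_ : (1 - cos x) `^ (- 2^-1) <= _).
    rewrite powRN lef_pV2 ?posrE ?powR_gt0// powR12_sqrt ?(ltW pos)//.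
    by rewrite -[leRHS]ger0_norm ?(ltW x0)// -sqrtr_sqr ler_sqrt ?(ltW x20).
  apply: ger_powR => //; rewrite pos/=; lra.
rewrite -[X in X <= _]mul1r -[X in X * _](congr1 (@^~ v) (@powR1 R)).
by have := cos_le1 x => ?; apply: powR_between; rewrite ?ler1n//; apply/andP; split; lra.
Qed.
End Cutoffs.

(** * Power weights cut off near the endpoint *)

Section Windows.
Context {R : realType}.
Implicit Types (d e x y u v : R) (w : R -> R).

Lemma jac_half x : 0 < x < pi -> jac 2^-1 2^-1 x = sin x.
Proof.
move=> x0; have [h1 h2] := cos_lt1 _ x0.
have sx : 0 < sin x by apply: sin_gt0_pi.
rewrite /jac -powRM ?ltW// -(@ger0_norm _ (sin x)) ?ltW// -sqrtr_sqr -powR12_sqrt ?sqr_ge0//.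
by congr (_ `^ _); have := cos2Dsin2 x; move: (cos x) (sin x) => C D; nra.
Qed.

Lemma jac10 x : jac 1 0 x = 1 - cos x.
Proof. by rewrite /jac powRr1 ?onemcos_ge0// powRr0 mulr1. Qed.

(** A continuous version of [jac u v] restricted to [e, 1]. For suitable exponents its integral
    [mass] is the truncated integral of K^q * omega on which both exponent bounds rest. *)
Definition window e u v x : R := plateau e x * jacc e u v x.
Definition mass e u v : R := Ipi (window e u v).

Lemma window_supp e u v x : 0 < e -> window e u v x != 0 -> e <= x <= 1.
Proof. by move=> e0; rewrite mulf_eq0 negb_or => /andP[h _]; exact: plateau_supp. Qed.

Lemma cont_window e u v : 0 < e <= 8^-1 -> contf (window e u v).
Proof.
move=> /andP[e0 e1]; apply: contM; first exact: cont_plateau.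
by apply: cont_jacc => //; have := @pi_ge2 R; lra.
Qed.

Lemma window_ge0 e u v x : 0 <= window e u v x.
Proof. by apply: mulr_ge0; [case/andP: (plateau01 e x)|exact: jac_ge0]. Qed.

Lemma supp_in d e x : 0 < d <= e -> e <= 8^-1 -> e <= x <= 1 -> d <= x <= pi - d /\ 0 < x < pi.
Proof.
move=> /andP[d0 de] e1 /andP[ex x1]; have := @pi_ge2 R => p2.
by split; apply/andP; split; lra.
Qed.

Lemma windowE e u v x : 0 < e <= 8^-1 -> window e u v x = plateau e x * jac u v x.
Proof.
move=> /andP[e0 e1]; rewrite /window.
have [->|h] := eqVneq (plateau e x) 0; first by rewrite !mul0r.
by rewrite jaccE//; case: (supp_in e e x _ e1 (plateau_supp _ _ e0 h)); rewrite ?e0 ?lexx.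
Qed.

Lemma windowM e u v u' v' x : 0 < e <= 8^-1 ->
  window e u v x * jac u' v' x = window e (u + u') (v + v') x.
Proof.
move=> ee; rewrite !windowE//; case/andP: ee => e0 e1.
have [->|h] := eqVneq (plateau e x) 0; first by rewrite !mul0r.
by rewrite jacD ?mulrA//; case: (supp_in e e x _ e1 (plateau_supp _ _ e0 h)); rewrite ?e0 ?lexx.
Qed.

Lemma window_sin e u v x : 0 < e <= 8^-1 ->
  window e u v x * sin x = window e (u + 2^-1) (v + 2^-1) x.
Proof.
move=> ee; rewrite -windowM//; case/andP: ee => e0 e1.
have [->|h] := eqVneq (window e u v x) 0; first by rewrite !mul0r.
by rewrite jac_half//; case: (supp_in e e x _ e1 (window_supp _ _ _ _ e0 h)); rewrite ?e0 ?lexx.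
Qed.

Lemma mass_gt0 e u v : 0 < e <= 8^-1 -> 0 < mass e u v.
Proof.
move=> ee; case/andP: (ee) => e0 e1.
apply: (@lt_le_trans _ _ ((e ^+ 2) `^ u * jacmin u v * (4 * e - 2 * e))).
  by rewrite !mulr_gt0 ?powR_gt0 ?exprn_gt0 ?jacmin_gt0//; lra.
have p2 := @pi_ge2 R; apply: Ipi_ge_cst; try lra.
- exact: cont_window.
- by move=> x _; exact: window_ge0.
move=> x hx; rewrite windowE// plateau1 ?mul1r//; first by apply: jac_lower => //; lra.
by case/andP: hx => ? ?; apply/andP; split; lra.
Qed.

(* With exponent at most [-1/2] the weight dominates [1/x], whose integral over [2e, 1/2] is logarithmic in [e]. *)
Lemma mass_unbounded u v N : u <= - 2^-1 -> exists2 e, 0 < e <= 8^-1 & N <= mass e u v.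
Proof.
move=> u2; set m := Num.min 1 (2 `^ v) : R.
have m0 : 0 < m by rewrite lt_min ltr01 powR_gt0.
(* The primitive m ln gives m (ln (1/2) - ln (2 e)) as a lower bound; the summand 8 absorbs the
   crude estimate ln (1/2) >= -8. *)
set e := Num.min (8^-1) (expR (- (`|N| / m + 8))) / 2.
have e0 : 0 < e by rewrite divr_gt0// lt_min expR_gt0 andbT invr_gt0.
have e8 : 2 * e <= 8^-1 by rewrite /e mulrC divfK ?pnatr_eq0// ge_min lexx.
have ee : 0 < e <= 8^-1 by rewrite e0/=; lra.
exists e => //.
have p2 := @pi_ge2 R.
have ln2 : - 8 <= ln (2^-1 : R).
  rewrite -ler_expR lnK ?posrE//; apply: le_trans (_ : expR (-1) <= _).
    by rewrite ler_expR; lra.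
  rewrite expRN lef_pV2 ?posrE ?expR_gt0//; have := @expR_ge1Dx R 1; lra.
have le1 : ln (2 * e) <= - (`|N| / m + 8).
  rewrite -ler_expR lnK; last by rewrite posrE mulr_gt0.
  by rewrite (_ : 2 * e = Num.min (8^-1) (expR (- (`|N| / m + 8)))) ?ge_min ?lexx ?orbT// /e mulrC divfK ?pnatr_eq0.
apply: (@le_trans _ _ (m * ln (2^-1) - m * ln (2 * e))).
  rewrite -mulrBr -ler_pdivrMl// mulrC; apply: le_trans (_ : `|N| / m <= _).
    by rewrite ler_pM2r ?invr_gt0// ler_norm.
  by have := le1; lra.
apply: (Ipi_sub _ _ _ (fun x => m * x^-1) (fun x => m * ln x)); try lra.
- exact: cont_window.
- by move=> x _; exact: window_ge0.
- move=> x /andP[h1 _]; have x0 : 0 < x by lra.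
  by have := is_derive1_ln x0 => D; apply: is_derive_eq; rewrite /GRing.scale/=; ring.
- move=> x /andP[h1 _]; have x0 : x != 0 by rewrite gt_eqF//; lra.
  by apply: cvgM; [exact: cvg_cst|exact: cvgV x0 cvg_id].
move=> x /andP[h1 h2]; rewrite windowE// plateau1 ?mul1r//; last by apply/andP.
by apply: jac_lower_inv => //; apply/andP; split; lra.
Qed.

(** As p > 1, the inequality bounds [mass] to the power p - 1 by D / A, against [mass_unbounded]. *)
Lemma mass_contra (A D p u v : R) : 0 < A -> 1 < p -> u <= - 2^-1 ->
  (forall e, 0 < e <= 8^-1 -> A * mass e u v `^ p <= D * mass e u v) -> False.
Proof.
move=> A0 p1 u2 H.
have [e ee he] := mass_unbounded u v (((`|D| + 1) / A) `^ (p - 1)^-1) u2.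
have m0 := mass_gt0 e u v ee.
have p10 : 0 < p - 1 by lra.
have : (`|D| + 1) / A <= mass e u v `^ (p - 1).
  have -> : (`|D| + 1) / A = (((`|D| + 1) / A) `^ (p - 1)^-1) `^ (p - 1).
    by rewrite -powRrM mulVf ?gt_eqF// powRr1// divr_ge0 ?(ltW A0)// addr_ge0.
  by apply: ge0_ler_powR; rewrite ?nnegrE ?powR_ge0 ?(ltW p10)// ltW.
rewrite ler_pdivrMr// => h; have := H e ee.
have -> : mass e u v `^ p = mass e u v `^ (p - 1) * mass e u v.
  rewrite -[X in _ * X](powRr1 (ltW m0)) -powRD ?subrK//.
  by rewrite (gt_eqF m0) implybT.
rewrite mulrA ler_pM2r// => h2; have := ler_norm D; lra.
Qed.
End Windows.

(** * Asymptotics of the orthonormal polynomials *)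

Section Chebyshev.
Context {R : realType}.
Implicit Types (p q : {poly R}) (x : R).

Fixpoint cheb_pair n : {poly R} * {poly R} :=
  if n is m.+1 then let: (a, b) := cheb_pair m in (b, 2 *: ('X * b) - a) else (1, 'X).
Definition cheb n := (cheb_pair n).1.

Lemma cheb_pair2 n : (cheb_pair n).2 = cheb n.+1.
Proof. by rewrite /cheb /=; case: (cheb_pair n). Qed.
Lemma cheb0 : cheb 0 = 1. Proof. by []. Qed.
Lemma cheb1 : cheb 1 = 'X. Proof. by []. Qed.
Lemma chebSS n : cheb n.+2 = 2 *: ('X * cheb n.+1) - cheb n.
Proof.
rewrite -!cheb_pair2 /=; rewrite /cheb.
by case E: (cheb_pair n) => [a b].
Qed.

Lemma cheb_ind (Q : nat -> Prop) : Q 0%N -> Q 1%N -> (forall n, Q n -> Q n.+1 -> Q n.+2) -> forall n, Q n.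
Proof.
move=> q0 q1 qS n; suff: Q n /\ Q n.+1 by case.
by elim: n => [//|n [h1 h2]]; split=> //; exact: qS.
Qed.

Lemma cheb_cos n x : (cheb n).[cos x] = cos (n%:R * x).
Proof.
elim/cheb_ind: n => [||n IH1 IH2].
- by rewrite cheb0 hornerC mul0r cos0.
- by rewrite cheb1 hornerX mul1r.
rewrite chebSS hornerD hornerN hornerZ hornerM hornerX IH1 IH2.
have -> : n.+2%:R * x = n.+1%:R * x + x by rewrite -[n.+2]addn1 natrD; ring.
have -> : n%:R * x = n.+1%:R * x - x by rewrite -[n.+1]addn1 natrD; ring.
by rewrite cosB cosD; ring.
Qed.

Lemma size_cheb n : (size (cheb n) <= n.+1)%N.
Proof.
elim/cheb_ind: n => [||n IH1 IH2].
- by rewrite cheb0 size_poly1.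
- by rewrite cheb1 size_polyX.
rewrite chebSS; apply: leq_trans (size_polyD _ _) _; rewrite size_polyN geq_max.
rewrite (leq_trans IH1) ?andbT; last by lia.
apply: leq_trans (size_scale_leq _ _) _; apply: leq_trans (size_polyMleq _ _) _.
by rewrite size_polyX.
Qed.

Lemma cheb_lead n : (cheb n.+1)`_n.+1 = 2 ^+ n.
Proof.
elim: n => [|n IH]; first by rewrite cheb1 coefX.
rewrite chebSS coefB coefZ coefXM/= IH exprS (nth_default 0 (s := cheb n)) ?subr0//.
by apply: leq_trans (size_cheb n) _; lia.
Qed.

(** The leading coefficient of the Chebyshev polynomial is 2^(n - 1) for n >= 1 and 1 for n = 0;
    [n.-1] gives both. *)
Lemma cheb_expansion n p : (size p <= n.+1)%N ->
  exists c : nat -> R, p = \sum_(k < n.+1) c k *: cheb k /\ p`_n = c n * (2 ^+ n.-1).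
Proof.
elim: n p => [|n IH] p sp.
  exists (fun=> p`_0); rewrite big_ord1 cheb0 mulr1; split=> //.
  by rewrite {1}(size1_polyC sp) alg_polyC.
pose d := p`_n.+1 / 2 ^+ n.
have [|c [E _]] := IH (p - d *: cheb n.+1).
  apply/leq_sizeP => j nj; rewrite coefB coefZ.
  have [->|jn] := eqVneq j n.+1; first by rewrite cheb_lead divfK ?subrr// expf_neq0// pnatr_eq0.
  have nj' : (n.+2 <= j)%N by lia.
  have h1 : (size p <= j)%N := leq_trans sp nj'.
  have h2 : (size (cheb n.+1) <= j)%N := leq_trans (size_cheb _) nj'.
  by rewrite (nth_default _ h1) (nth_default _ h2) mulr0 subr0.
exists (fun k => if (k == n.+1)%N then d else c k); split; last first.
  by rewrite eqxx divfK// expf_neq0// pnatr_eq0.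
rewrite big_ord_recr/= eqxx.
rewrite (eq_bigr (fun k : 'I_n.+1 => c k *: cheb k)); first by rewrite -E subrK.
by move=> k _; rewrite ifN// neq_ltn ltn_ord.
Qed.
End Chebyshev.

Lemma cvg_sum_ord (R : realType) n (u : nat -> nat -> R) (l : nat -> R) :
  (forall k, (k < n)%N -> u k @ \oo --> l k) ->
  (fun m => \sum_(k < n) u k m) @ \oo --> \sum_(k < n) l k.
Proof.
elim: n => [|n IH] H.
  by rewrite big_ord0; under eq_fun do rewrite big_ord0; exact: cvg_cst.
rewrite big_ord_recr/=; under eq_fun do rewrite big_ord_recr/=.
by apply: cvgD; [apply: IH => k kn; apply: H; exact: ltnW|exact: H].
Qed.

Lemma jac_lower_ex (R : realType) (e u v : R) : 0 < e -> 4 * e <= 1 ->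
  exists2 m, 0 < m & forall x, 2 * e <= x <= 4 * e -> m <= jac u v x.
Proof.
move=> e0 e1; exists ((e ^+ 2) `^ u * jacmin u v).
  by rewrite mulr_gt0 ?jacmin_gt0// powR_gt0// exprn_gt0.
by move=> x; exact: jac_lower.
Qed.

Lemma common_index N1 N2 N3 : exists n, [/\ (N1 <= n.+1)%N, (N2 <= n.+1)%N & (N3 <= n.+1)%N].
Proof. by exists (N1 + N2 + N3)%N; split; lia. Qed.

Lemma sqr_add_le (R : realDomainType) (Q G W : R) : Q ^+ 2 <= W -> (Q + G) ^+ 2 <= 2 * G ^+ 2 + 2 * W.
Proof. by have := sqr_ge0 (Q - G); nra. Qed.

Lemma common_index4 N1 N2 N3 N4 N5 : exists n, [/\ (N1 <= n)%N, (N2 <= n)%N, (N3 <= n)%N & (N4 <= n)%N /\ (N5 <= n)%N].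
Proof. by exists (N1 + N2 + N3 + N4 + N5)%N; do !split; lia. Qed.

Lemma windowMc (R : realType) (e u v u' v' x : R) : 0 < e <= 8^-1 ->
  window e u v x * jacc e u' v' x = window e (u + u') (v + v') x.
Proof.
move=> /andP[e0 e8]; rewrite /window -mulrA -jacD//.
by apply: clamp_in => //; have := @pi_ge2 R; lra.
Qed.

Lemma half_scale (R : realFieldType) (x l : R) : 0 < l -> x + x = 16 * x / l * (l / 8).
Proof. by move=> l0; field; rewrite gt_eqF. Qed.

Lemma scale_out (R : realFieldType) (x y z l : R) :
  64 * (16 * (128 * x / y * z) / l) = x * (64 * (16 * (128 * z / y) / l)).
Proof. ring. Qed.

(** * Orthonormal expansions, three-term recurrence and Christoffel-Darboux formula *)

Section JacobiPolynomials.
Context {R : realType}.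
Local Notation normc := (@Normc.normc R).
Variables (s t : R) (K : nat) (c M : 'I_K -> R) (P : nat -> {poly R}).
Hypotheses (s0 : 0 <= s) (t0 : 0 <= t) (c1 : forall i, -1 <= c i <= 1) (M0 : forall i, 0 < M i).
Implicit Types (p q : {poly R}) (x : R).

(** The scalar product of L^2(nu) in the angular variable; the Jacobian sin is already part of
    [jac s t]. *)
Definition inner p q : R :=
  Ipi (fun x => p.[cos x] * q.[cos x] * jac s t x) + \sum_i M i * (p.[c i] * q.[c i]).

Hypotheses (sP : forall n, size (P n) = n.+1) (lP : forall n, 0 < lead_coef (P n))
  (oP : forall i j, inner (P i) (P j) = (i == j)%:R).

Let cj : contf (jac s t) := cont_jac s t s0 t0.

Lemma cont_hcos p : contf (fun x => p.[cos x]).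
Proof. by apply: cont_horner; apply: cont_cos; exact: cont_id. Qed.

Let chc := cont_hcos.

Lemma innerC p q : inner p q = inner q p.
Proof.
rewrite /inner; congr (_ + _); first by apply: eq_Ipi => x _; ring.
by apply: eq_bigr => i _; ring.
Qed.
Lemma innerDl p1 p2 q : inner (p1 + p2) q = inner p1 q + inner p2 q.
Proof.
rewrite /inner addrACA -IpiD; [|by cont; exact: chc|by cont; exact: chc].
rewrite -big_split/=; congr (_ + _); first by apply: eq_Ipi => x _; rewrite hornerD; ring.
by apply: eq_bigr => i _; rewrite hornerD; ring.
Qed.
Lemma innerZl a p q : inner (a *: p) q = a * inner p q.
Proof.
rewrite /inner mulrDr -IpiZ; last by cont; exact: chc.
rewrite mulr_sumr; congr (_ + _); first by apply: eq_Ipi => x _; rewrite hornerZ; ring.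
by apply: eq_bigr => i _; rewrite hornerZ; ring.
Qed.
Lemma inner0l q : inner 0 q = 0.
Proof. by rewrite -(scale0r (0 : {poly R})) innerZl mul0r. Qed.
Lemma innerDr p q1 q2 : inner p (q1 + q2) = inner p q1 + inner p q2.
Proof. by rewrite innerC innerDl !(innerC _ p). Qed.
Lemma innerZr a p q : inner p (a *: q) = a * inner p q.
Proof. by rewrite innerC innerZl innerC. Qed.
Lemma inner_suml n (f : nat -> {poly R}) q :
  inner (\sum_(k < n) f k) q = \sum_(k < n) inner (f k) q.
Proof.
by elim: n => [|n IH]; rewrite ?big_ord0 ?inner0l// !big_ord_recr/= innerDl IH.
Qed.
Lemma innerXl p q : inner ('X * p) q = inner p ('X * q).
Proof.
rewrite /inner; congr (_ + _); first by apply: eq_Ipi => x _; rewrite !hornerM !hornerX; ring.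
by apply: eq_bigr => i _; rewrite !hornerM !hornerX; ring.
Qed.
Lemma inner_ge0 p : 0 <= inner p p.
Proof.
rewrite addr_ge0 ?sumr_ge0//.
  by apply: Ipi_ge0 => x _; rewrite mulr_ge0 -?expr2 ?sqr_ge0// mulr_ge0 ?powR_ge0.
by move=> i _; rewrite mulr_ge0 ?(ltW (M0 i))// -expr2 sqr_ge0.
Qed.

Lemma lead_coefP n : lead_coef (P n) = (P n)`_n.
Proof. by rewrite lead_coefE sP. Qed.

Lemma expansion n p : (size p <= n)%N -> p = \sum_(j < n) inner p (P j) *: P j.
Proof.
move=> sp; have [d ->] : exists d : nat -> R, p = \sum_(j < n) d j *: P j.
  elim: n p sp => [|n IH] p sp.
    by exists (fun=> 0); rewrite big_ord0; apply/eqP; rewrite -size_poly_leq0.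
  pose e := p`_n / lead_coef (P n).
  have [|d E] := IH (p - e *: P n).
    apply/leq_sizeP => j nj; rewrite coefB coefZ.
    have [->|jn] := eqVneq j n; first by rewrite -lead_coefP divfK ?subrr// gt_eqF.
    have nj' : (n.+1 <= j)%N by lia.
    by rewrite !nth_default ?mulr0 ?subr0// ?sP//; exact: leq_trans sp nj'.
  exists (fun k => if (k == n)%N then e else d k).
  rewrite big_ord_recr/= eqxx (eq_bigr (fun k : 'I_n => d k *: P k)); first by rewrite -E subrK.
  by move=> k _; rewrite ifN// neq_ltn ltn_ord.
apply: eq_bigr => j _; congr (_ *: _).
rewrite (inner_suml n (fun k => d k *: P k)) (bigD1 j)//= big1 => [|k kj].
  by rewrite innerZl oP eqxx mulr1 addr0.
by rewrite innerZl oP [_ == _](negbTE kj) mulr0.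
Qed.

Lemma inner_P_small n q : (size q <= n)%N -> inner q (P n) = 0.
Proof.
move=> sq; rewrite (expansion n q sq) (inner_suml n (fun j => inner q (P j) *: P j)).
by apply: big1 => j _; rewrite innerZl oP ltn_eqF ?mulr0.
Qed.

Lemma inner_P_lead n q : (size q <= n.+1)%N -> inner q (P n) = q`_n / lead_coef (P n).
Proof.
move=> sq; have := expansion n.+1 q sq; rewrite big_ord_recr/=.
set r := \sum_(j < n) _ => E.
have -> : q`_n = inner q (P n) * lead_coef (P n).
  rewrite {1}E coefD coefZ lead_coefP; rewrite (_ : r`_n = 0) ?add0r//.
  rewrite coef_sum big1// => j _; rewrite coefZ nth_default ?mulr0// sP.
  exact: ltn_ord.
by rewrite mulfK// gt_eqF.
Qed.

Lemma bessel_P n q : inner q (P n) ^+ 2 <= inner q q.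
Proof.
set a := inner q (P n); have := inner_ge0 (q - a *: P n).
rewrite innerDl !innerDr -scaleNr !innerZl !innerZr oP eqxx/= (innerC (P n)) -/a.
rewrite (_ : _ + _ = inner q q - a ^+ 2); last by ring.
by rewrite subr_ge0.
Qed.

Definition rho n : R := lead_coef (P n) / lead_coef (P n.+1).

Lemma rho_gt0 n : 0 < rho n. Proof. by rewrite divr_gt0. Qed.

Lemma recurrence n : exists b, 'X * P n.+1 = rho n.+1 *: P n.+2 + b *: P n.+1 + rho n *: P n.
Proof.
have sX m : size ('X * P m) = m.+2.
  by rewrite mulrC size_mulX ?sP// -size_poly_eq0 sP.
have lX m : inner ('X * P m) (P m.+1) = rho m.
  by rewrite inner_P_lead ?sX// coefXM/= -lead_coefP.
exists (inner ('X * P n.+1) (P n.+1)).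
have sXn : (size ('X * P n.+1)%R <= n.+3)%N by rewrite sX.
have E := expansion n.+3 _ sXn; rewrite !big_ord_recr/= big1 ?add0r in E.
  rewrite {1}E lX innerXl innerC lX addrC -!addrA; congr (_ + _); exact: addrC.
move=> j _; rewrite innerXl innerC inner_P_small ?scale0r//.
by rewrite sX; case: j => j /=; lia.
Qed.

Lemma recurrence0 : exists b, 'X * P 0%N = rho 0%N *: P 1%N + b *: P 0%N.
Proof.
have sX m : size ('X * P m) = m.+2.
  by rewrite mulrC size_mulX ?sP// -size_poly_eq0 sP.
exists (inner ('X * P 0%N) (P 0%N)).
have sX0 : (size ('X * P 0%N)%R <= 2)%N by rewrite sX.
have E := expansion 2 _ sX0; rewrite !big_ord_recr/= big_ord0 add0r in E.
rewrite {1}E addrC; congr (_ *: _ + _).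
by rewrite inner_P_lead ?sX// coefXM/= -lead_coefP.
Qed.

Lemma christoffel_darboux n (x y : R) :
  (x - y) * kernelL P n x y = rho n * ((P n.+1).[x] * (P n).[y] - (P n).[x] * (P n.+1).[y]).
Proof.
elim: n => [|n IH].
  have [b E] := recurrence0.
  have Ex z : z * (P 0%N).[z] = rho 0%N * (P 1%N).[z] + b * (P 0%N).[z].
    by have := congr1 (horner ^~ z) E; rewrite !hornerE.
  rewrite /kernelL big_ord1; have := Ex x; have := Ex y.
  set A := (P 0%N).[x]; set B := (P 0%N).[y] => Ey Ex'.
  have -> : (x - y) * (A * B) = (x * A) * B - (y * B) * A by ring.
  by rewrite Ex' Ey; ring.
have [b E] := recurrence n.
have Ex z : z * (P n.+1).[z] = rho n.+1 * (P n.+2).[z] + b * (P n.+1).[z] + rho n * (P n).[z].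
  by have := congr1 (horner ^~ z) E; rewrite !hornerE.
rewrite /kernelL big_ord_recr/= mulrDr; rewrite /kernelL in IH; rewrite IH.
have := Ex x; have := Ex y.
set A := (P n.+1).[x]; set B := (P n.+1).[y] => Ey Ex'.
have -> : (x - y) * (A * B) = (x * A) * B - (y * B) * A by ring.
by rewrite Ex' Ey; ring.
Qed.

(** * Leading coefficients and L^2 asymptotics *)

Let csj : contf (jac (s / 2) (t / 2)).
Proof. by apply: cont_jac; rewrite divr_ge0. Qed.

(* [hw] is the square root of the weight; [gn n] is the asymptotic profile of the weighted polynomial [vn n]. *)
Definition hw x : R := jac (s / 2) (t / 2) x.
Definition vn n x : R := (P n).[cos x] * hw x.
Definition ph n x : R := (n%:R + (s + t) / 2) * x - s * pi / 2.
Definition gn n x : R := Num.sqrt (2 / pi) * cos (ph n x).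
Definition lead2 n : R := lead_coef (P n) / 2 ^+ n.
Definition K0 : R := pi * 2 `^ (- ((s + t) / 2)).

Lemma hw2 x : hw x ^+ 2 = jac s t x.
Proof.
rewrite /hw /jac exprMn -!powR_mulrn ?powR_ge0// -!powRrM.
by congr (_ `^ _ * _ `^ _); field.
Qed.
Lemma hw_ge0 x : 0 <= hw x. Proof. by rewrite mulr_ge0 ?powR_ge0. Qed.
Lemma cont_hw : contf hw. Proof. exact: csj. Qed.
Lemma cont_vn n : contf (vn n).
Proof. by apply: contM; [exact: chc|exact: csj]. Qed.
Lemma cont_cosph n : contf (fun x => cos (ph n x)).
Proof. by rewrite /ph; cont. Qed.
Lemma cont_sinph n : contf (fun x => sin (ph n x)).
Proof. by rewrite /ph; cont. Qed.
Lemma cont_gn n : contf (gn n).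
Proof. by apply: contM; [exact: cont_cst|exact: cont_cosph]. Qed.

Lemma Ipi_vn2 n : Ipi (fun x => vn n x ^+ 2) <= 1.
Proof.
rewrite -[leRHS](_ : (n == n)%:R = 1); last by rewrite eqxx.
rewrite -oP /inner; rewrite -[leLHS]addr0; apply: lerD; last first.
  by apply: sumr_ge0 => i _; rewrite mulr_ge0 ?(ltW (M0 i))// -expr2 sqr_ge0.
rewrite le_eqVlt; apply/orP; left; apply/eqP; apply: eq_Ipi => x _.
by rewrite -hw2 /vn; ring.
Qed.

(** The product of the cosines has frequency parameters n + 1 + k and n + 1 - k in [Ipi_jac_cos],
    and only the second can vanish. The index n + 1 matters: at index 0 both vanish for k = 0 and
    the value doubles. *)
Lemma Ipi_cheb_phase n k : (k <= n.+1)%N ->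
  Ipi (fun x => cos (k%:R * x) * hw x * cos (ph n.+1 x)) = if k == n.+1 then K0 / 2 else 0.
Proof.
move=> kn.
have E := fun m => Ipi_jac_cos s t m s0 t0.
transitivity (2^-1 * (Ipi (fun x => hw x * cos (((n.+1 + k)%:R + (s + t) / 2) * x - s * pi / 2))
   + Ipi (fun x => hw x * cos (((n.+1 - k)%:R + (s + t) / 2) * x - s * pi / 2)))).
  have cc m : contf (fun x => hw x * cos ((m%:R + (s + t) / 2) * x - s * pi / 2)).
    by apply: contM; [exact: csj|cont].
  rewrite -IpiD// -IpiZ; last by cont.
  apply: eq_Ipi => x _.
  have e1 : ((n.+1 + k)%:R + (s + t) / 2) * x - s * pi / 2 = k%:R * x + ph n.+1 x by rewrite /ph natrD; ring.
  have e2 : ((n.+1 - k)%:R + (s + t) / 2) * x - s * pi / 2 = - (k%:R * x - ph n.+1 x) by rewrite /ph natrB//; ring.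
  by rewrite e1 e2 cosN mulrAC cosMcos; ring.
rewrite !E addSn/= add0r subn_eq0 [(k == _)]eqn_leq kn/=.
by case: ifP => _; rewrite ?mulr0// /K0 mulrC.
Qed.

Lemma Ipi_poly_phase n p : (size p <= n.+2)%N ->
  Ipi (fun x => p.[cos x] * hw x * cos (ph n.+1 x)) = p`_n.+1 / 2 ^+ n * (K0 / 2).
Proof.
move=> sp; have [d [E Ed]] := cheb_expansion n.+1 p sp.
transitivity (Ipi (fun x => \sum_(k < n.+2) d k * (cos (k%:R * x) * hw x * cos (ph n.+1 x)))).
  apply: eq_Ipi => x _; rewrite E horner_sum !mulr_suml; apply: eq_bigr => k _.
  by rewrite hornerZ cheb_cos -!mulrA.
have ck k : contf (fun x => cos (k%:R * x) * hw x * cos (ph n.+1 x)).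
  by apply: contM; [apply: contM; [cont|exact: csj]|exact: cont_cosph].
rewrite Ipi_sum; last by move=> k _; apply: contM => //; exact: cont_cst.
rewrite (eq_bigr (fun k : 'I_n.+2 => d k * (if (k == n.+1 :> nat) then K0 / 2 else 0))); last first.
  by move=> k _; rewrite IpiZ// Ipi_cheb_phase// -ltnS.
rewrite big_ord_recr/= eqxx big1 => [|k _]; last by rewrite ltn_eqF ?mulr0.
by rewrite add0r Ed/= mulfK// expf_neq0// pnatr_eq0.
Qed.

Lemma Ipi_vn_phase n : Ipi (fun x => vn n.+1 x * cos (ph n.+1 x)) = lead2 n.+1 * K0.
Proof.
rewrite /vn Ipi_poly_phase ?sP// /lead2 lead_coefE sP/= exprS.
by field; rewrite expf_neq0// pnatr_eq0.
Qed.

(** At cos x and for n at least the size of E this is the real part of exp(inx) times the conjugate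
    of E(exp(ix)), the usual passage from polynomials on the circle to polynomials on [-1, 1]. *)
Definition testpoly (E : {poly R}) n : {poly R} := \sum_(k < size E) E`_k *: cheb (n - k).

Lemma testpoly_cos (E : {poly R}) n x : (size E <= n)%N ->
  (testpoly E n).[cos x] = complex.Re (cis (n%:R * x) * conjc (evc E x)).
Proof.
move=> En; rewrite /testpoly horner_sum.
have -> : complex.Re (cis (n%:R * x) * conjc (evc E x)) =
   cos (n%:R * x) * complex.Re (evc E x) + sin (n%:R * x) * complex.Im (evc E x).
  by case: (evc E x) => a b /=; ring.
rewrite Re_evc Im_evc !mulr_sumr -big_split/=; apply: eq_bigr => k _.
rewrite hornerZ cheb_cos natrB; last by apply: leq_trans En; apply: ltnW.
by rewrite mulrBl cosB; ring.
Qed.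

Lemma testpoly_size (E : {poly R}) n : (size (testpoly E n) <= n.+1)%N.
Proof.
apply: leq_trans (size_sum _ _ _) _; apply/bigmax_leqP => k _.
apply: leq_trans (size_scale_leq _ _) _; apply: leq_trans (size_cheb _) _.
by rewrite ltnS leq_subr.
Qed.

Lemma testpoly_lead (E : {poly R}) n : E`_0 = 1 -> (testpoly E n.+1)`_n.+1 = 2 ^+ n.
Proof.
move=> E0; have sE : (0 < size E)%N.
  by rewrite size_poly_gt0; apply/eqP => E'; move: E0; rewrite E' coef0 => /esym/eqP; rewrite oner_eq0.
rewrite /testpoly coef_sum (bigD1 (Ordinal sE))//= subn0 coefZ cheb_lead E0 mul1r.
rewrite big1 ?addr0// => k k0; rewrite coefZ [X in _ * X]nth_default ?mulr0//.
apply: leq_trans (size_cheb _) _; move: k0; rewrite -val_eqE/=; lia.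
Qed.

(** For complex w, (Re w)^2 = (|w|^2 + Re (w^2)) / 2. The second part oscillates at frequency about
    2 n and is expanded so that the Riemann-Lebesgue lemma applies to each term. *)
Lemma testpoly_norm (E : {poly R}) n : (size E <= n)%N ->
  Ipi (fun x => (testpoly E n).[cos x] ^+ 2 * jac s t x) =
  2^-1 * Ipi (fun x => normc (evc E x) ^+ 2 * jac s t x)
  + \sum_(k < size E) \sum_(l < size E) 2^-1 * E`_k * E`_l *
      Ipi (fun x => jac s t x * cos ((n.*2%:R + - (k + l)%:R) * x + 0)).
Proof.
move=> En.
have cc m : contf (fun x => jac s t x * cos ((n.*2%:R + - m%:R) * x + 0)).
  by apply: contM => //; cont.
have cre : contf (fun x => complex.Re (evc E x)).
  rewrite (_ : (fun x => _) = (fun x => \sum_(k < size E) E`_k * cos (k%:R * x))); first by cont.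
  by apply/funext => x; exact: Re_evc.
have cim : contf (fun x => complex.Im (evc E x)).
  rewrite (_ : (fun x => _) = (fun x => \sum_(k < size E) E`_k * sin (k%:R * x))); first by cont.
  by apply/funext => x; exact: Im_evc.
have cn : contf (fun x => normc (evc E x) ^+ 2 * jac s t x).
  apply: contM => //; rewrite (_ : (fun x => _) = (fun x => complex.Re (evc E x) ^+ 2 + complex.Im (evc E x) ^+ 2)); first by cont.
  by apply/funext => x; exact: normcE2.
transitivity (2^-1 * Ipi (fun x => normc (evc E x) ^+ 2 * jac s t x)
  + Ipi (fun x => \sum_(k < size E) \sum_(l < size E) 2^-1 * E`_k * E`_l *
      (jac s t x * cos ((n.*2%:R + - (k + l)%:R) * x + 0)))); last first.
  congr (_ + _); rewrite Ipi_sum => [|k _]; last by cont.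
  apply: eq_bigr => k _; rewrite Ipi_sum => [|l _]; last by cont.
  by apply: eq_bigr => l _; rewrite IpiZ.
rewrite -IpiZ// -IpiD; [|by cont|by cont].
apply: eq_Ipi => x _; rewrite testpoly_cos//.
have -> : \sum_(k < size E) \sum_(l < size E) 2^-1 * E`_k * E`_l *
      (jac s t x * cos ((n.*2%:R + - (k + l)%:R) * x + 0)) =
   2^-1 * jac s t x * complex.Re (cis (n.*2%:R * x) * conjc (evc E x * evc E x)).
  have -> : complex.Re (cis (n.*2%:R * x) * conjc (evc E x * evc E x)) =
     \sum_(k < size E) \sum_(l < size E) E`_k * E`_l * cos (n.*2%:R * x - (k + l)%:R * x).
    rewrite {1}evcE mulr_suml.
    have conj_sum (J : Type) (r : seq J) (F : J -> complex R) : conjc (\sum_(i <- r) F i) = \sum_(i <- r) conjc (F i).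
      by apply: (big_morph conjc) => [[a b] [d e]|]; rewrite /= ?opprD// oppr0.
    rewrite conj_sum mulr_sumr Re_sum; apply: eq_bigr => k _.
    rewrite evcE mulr_sumr conj_sum mulr_sumr Re_sum; apply: eq_bigr => l _.
    rewrite natrD mulrDl cosB; rewrite cosD sinD /=; ring.
  rewrite mulr_sumr; apply: eq_bigr => k _; rewrite mulr_sumr; apply: eq_bigr => l _.
  rewrite addr0 mulrDl mulNr; ring.
have -> : cis (n.*2%:R * x) = cis (n%:R * x) * cis (n%:R * x).
  by rewrite -cisD -addnn natrD mulrDl.
rewrite normcE2; case: (evc E x) => a b; rewrite /cis/=.
have := cos2Dsin2 (n%:R * x); set C := cos _; set S := sin _ => CS.
have -> : 2^-1 * ((a ^+ 2 + b ^+ 2) * jac s t x) = 2^-1 * ((a ^+ 2 + b ^+ 2) * (C ^+ 2 + S ^+ 2) * jac s t x) by rewrite CS mulr1.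
by field.
Qed.

(** Bessel's inequality for q = [testpoly E n] and [P n]: the scalar product is 2^(n - 1) over the
    leading coefficient of [P n], and for large n the squared norm of q is at most (pi / 2) 2^(- (s
    + t)) (1 + e). *)
Lemma lead2_lower (e : R) : 0 < e -> \forall n \near \oo,
  (2 * pi * 2 `^ (- (s + t))) * lead2 n ^+ 2 * (1 + e) >= 1.
Proof.
move=> e0; pose phis := [seq acos (c i) | i <- enum 'I_K].
have e20 : 0 < e / 2 by rewrite divr_gt0.
have [E [E0 Ev En]] := szego_extremal s t phis (e / 2) s0 t0 e20.
set W := 2 `^ (- (s + t)) : R; have W0 : 0 < W by rewrite powR_gt0.
pose S n := \sum_(k < size E) \sum_(l < size E) 2^-1 * E`_k * E`_l *
      Ipi (fun x => jac s t x * cos ((n.*2%:R + - (k + l)%:R) * x + 0)).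
have S0 : S @ \oo --> 0.
  rewrite (_ : 0 = \sum_(k < size E) \sum_(l < size E) (2^-1 * E`_k * E`_l * 0)); last first.
    by rewrite big1// => k _; rewrite big1// => l _; rewrite mulr0.
  rewrite /S; apply: (cvg_sum_ord _ _ (fun k n => \sum_(l < size E) 2^-1 * E`_k * E`_l *
    Ipi (fun x => jac s t x * cos ((n.*2%:R + - (k + l)%:R) * x + 0))) (fun k => \sum_(l < size E) (2^-1 * E`_k * E`_l * 0))) => k _.
  apply: (cvg_sum_ord _ _ (fun l n => 2^-1 * E`_k * E`_l *
    Ipi (fun x => jac s t x * cos ((n.*2%:R + - (k + l)%:R) * x + 0))) (fun l => 2^-1 * E`_k * E`_l * 0)) => l _; apply: cvgMr.
  exact: riemann_lebesgue.
have d0 : 0 < 2^-1 * pi * W * (e / 2) by rewrite !mulr_gt0 ?pi_gt0 ?invr_gt0.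
have /cvgrPdist_lt /(_ _ d0) HS := S0.
near=> n.
have [m nE] : exists m, n = m.+1.
  by exists n.-1; rewrite prednK//; near: n; exists 1%N.
have szn : (size E <= n)%N by near: n; exists (size E).
have hS : `|S n| < 2^-1 * pi * W * (e / 2).
  have : `|0 - S n| < 2^-1 * pi * W * (e / 2) by near: n; exact: HS.
  by rewrite sub0r normrN.
pose q := testpoly E n.
(* E was chosen to vanish at the angles of the mass points, so the discrete part of the norm of q is
   0. *)
have qc i : q.[c i] = 0.
  have ci := c1 i; rewrite -(acosK (x := c i)) ?in_itv//= /q testpoly_cos//.
  rewrite Ev; last by apply/mapP; exists i; rewrite ?mem_enum.
  by rewrite /= oppr0 !mulr0 subr0.
have nq : inner q q <= 2^-1 * pi * W * (1 + e).
  rewrite /inner big1 ?addr0; last by move=> i _; rewrite qc mulr0 mulr0.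
  have -> : Ipi (fun x => q.[cos x] * q.[cos x] * jac s t x) = Ipi (fun x => q.[cos x] ^+ 2 * jac s t x).
    by apply: eq_Ipi => x _; rewrite expr2.
  rewrite testpoly_norm// -/(S n).
  have : Ipi (fun x => normc (evc E x) ^+ 2 * jac s t x) <= Ipi (fun=> W * (1 + e / 2)).
    apply: le_Ipi; [|exact: cont_cst|].
      apply: contM => //; rewrite (_ : (fun x => _) = (fun x => (\sum_(k < size E) E`_k * cos (k%:R * x)) ^+ 2 + (\sum_(k < size E) E`_k * sin (k%:R * x)) ^+ 2)); first by cont.
      by apply/funext => x; rewrite normcE2 Re_evc Im_evc.
    move=> x _; have := En x; rewrite mulrA.
    rewrite -ler_pdivlMr ?powR_gt0// => /le_trans; apply.
    by rewrite /W powRN mulrC.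
  rewrite Ipi_cst => h.
  have := ler_norm (S n); move: hS; lra.
have iq : inner q (P n) = 2 ^+ m / lead_coef (P n).
  rewrite (inner_P_lead)//; last exact: testpoly_size.
  by congr (_ / _); rewrite /q nE testpoly_lead.
have := bessel_P n q; rewrite iq => h.
have := le_trans h nq.
have lp := lP n; have p2 : 0 < 2 ^+ m :> R by rewrite exprn_gt0.
rewrite expr_div_n ler_pdivrMr ?exprn_gt0// => h'.
have e2 : 2 ^+ n = 2 * 2 ^+ m :> R by rewrite nE exprS.
rewrite /lead2 expr_div_n e2.
have -> : 2 * pi * W * (lead_coef (P n) ^+ 2 / (2 * 2 ^+ m) ^+ 2) * (1 + e) =
  (2^-1 * pi * W * (1 + e) * lead_coef (P n) ^+ 2) / (2 ^+ m) ^+ 2.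
  by field; rewrite gt_eqF.
by rewrite ler_pdivlMr ?exprn_gt0// mul1r.
Unshelve. all: by end_near. Qed.

Definition yn n : R := Num.sqrt (2 / pi) * (lead2 n * K0).

Lemma two_pi_gt0 : 0 < 2 / pi :> R. Proof. by rewrite divr_gt0// pi_gt0. Qed.
Lemma K0_gt0 : 0 < K0. Proof. by rewrite mulr_gt0 ?pi_gt0// powR_gt0. Qed.
Lemma lead2_gt0 n : 0 < lead2 n. Proof. by rewrite divr_gt0// exprn_gt0. Qed.
Lemma yn_gt0 n : 0 < yn n.
Proof. by apply: mulr_gt0; [rewrite sqrtr_gt0 two_pi_gt0|exact: mulr_gt0 (lead2_gt0 n) K0_gt0]. Qed.
Let pin0 : (pi : R) != 0.
Proof. by rewrite gt_eqF// pi_gt0. Qed.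
Lemma yn2 n : yn n ^+ 2 = 2 * pi * 2 `^ (- (s + t)) * lead2 n ^+ 2.
Proof.
rewrite /yn /K0; move: (lead2 n) => L; rewrite !exprMn sqr_sqrtr ?(ltW two_pi_gt0)// -(powR_mulrn 2 (powR_ge0 _ _)) -powRrM.
have -> : - ((s + t) / 2) * 2 = - (s + t) by field.
have aux (w y : R) : w != 0 -> 2 / w * (L ^+ 2 * (w ^+ 2 * y)) = 2 * w * y * L ^+ 2 by move=> w0; field.
exact: aux pin0.
Qed.

Lemma Ipi_vn_gn n : Ipi (fun x => vn n.+1 x * gn n.+1 x) = yn n.+1.
Proof.
rewrite /yn -Ipi_vn_phase -IpiZ; last by apply: contM; [exact: cont_vn|exact: cont_cosph].
by apply: eq_Ipi => x _; rewrite /gn; ring.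
Qed.

Lemma cos_sqr_half (x : R) : cos x ^+ 2 = 2^-1 * (1 + cos (x + x)).
Proof. by rewrite cosD; have := cos2Dsin2 x; rewrite -!expr2; lra. Qed.
Lemma sin_sqr_half (x : R) : sin x ^+ 2 = 2^-1 * (1 - cos (x + x)).
Proof. by rewrite cosD; have := cos2Dsin2 x; rewrite -!expr2; lra. Qed.

Lemma phase_osc (h : R -> R) : contf h ->
  (fun n => Ipi (fun x => h x * cos (ph n x + ph n x))) @ \oo --> 0 /\
  (fun n => Ipi (fun x => h x * sin (ph n x + ph n x))) @ \oo --> 0.
Proof.
move=> ch; split.
- have := riemann_lebesgue h (s + t) (- (s * pi)) ch.
  rewrite (_ : (fun n => _) = (fun n => Ipi (fun x => h x * cos (ph n x + ph n x))))//.
  apply/funext => n; apply: eq_Ipi => x _; congr (_ * cos _).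
  by rewrite /ph -addnn natrD; field.
- have := riemann_lebesgue h (s + t) (- (s * pi) - pi / 2) ch.
  rewrite (_ : (fun n => _) = (fun n => Ipi (fun x => h x * sin (ph n x + ph n x))))//.
  apply/funext => n; apply: eq_Ipi => x _; rewrite -cosBpihalf; congr (_ * cos _).
  by rewrite /ph -addnn natrD; field.
Qed.

Lemma Ipi_gn2 (h : R -> R) : contf h ->
  (fun n => Ipi (fun x => h x * gn n x ^+ 2)) @ \oo --> Ipi h / pi.
Proof.
move=> ch; have [osc _] := phase_osc h ch.
have -> : (fun n => Ipi (fun x => h x * gn n x ^+ 2)) =
   (fun n => pi^-1 * (Ipi h + Ipi (fun x => h x * cos (ph n x + ph n x)))).
  apply/funext => n.
  have c1' : contf (fun x => h x * cos (ph n x + ph n x)) by rewrite /ph; cont.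
  rewrite -IpiD// -IpiZ; last by apply: contD.
  apply: eq_Ipi => x _; rewrite /gn exprMn sqr_sqrtr ?(ltW two_pi_gt0)// cos_sqr_half.
  have aux (w a b : R) : w != 0 -> a * (2 / w * (2^-1 * (1 + b))) = w^-1 * (a + a * b) by move=> w0; field.
  exact: aux pin0.
rewrite mulrC -[X in pi^-1 * X]addr0; apply: cvgMr; apply: cvgD => //; exact: cvg_cst.
Qed.

Lemma Ipi_gn2_1 : (fun n => Ipi (fun x => gn n x ^+ 2)) @ \oo --> (1 : R).
Proof.
have := Ipi_gn2 (fun=> 1) (cont_cst 1).
rewrite Ipi_cst mul1r divff ?gt_eqF ?pi_gt0//.
rewrite (_ : (fun n => _) = (fun n => Ipi (fun x => gn n x ^+ 2)))//.
by apply/funext => n; apply: eq_Ipi => x _; rewrite mul1r.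
Qed.

(** For n >= 1, [yn n] is the scalar product of [vn n] and [gn n]. Cauchy-Schwarz bounds its square
    by the squared norm of [gn n], which tends to 1; the square is also exactly the quantity that
    [lead2_lower] bounds from below. *)
Lemma yn_cvg : yn @ \oo --> (1 : R).
Proof.
suff y2 : (fun n => yn n ^+ 2) @ \oo --> (1 : R).
  have -> : yn = (fun n => Num.sqrt (yn n ^+ 2)).
    by apply/funext => n; rewrite sqrtr_sqr ger0_norm// ltW// yn_gt0.
  rewrite -[X in _ --> X]sqrtr1; apply: (cvg_comp (fun n => yn n ^+ 2) (@Num.sqrt R)); first exact: y2.
  exact: sqrt_continuous.
have up : \forall n \near \oo, yn n ^+ 2 <= Ipi (fun x => gn n x ^+ 2).
  near=> n; have [m ->] : exists m, n = m.+1 by exists n.-1; rewrite prednK//; near: n; exists 1%N.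
  rewrite -Ipi_vn_gn; apply: le_trans (Ipi_cauchy_schwarz _ _ (cont_vn _) (cont_gn _)) _.
  rewrite -[leRHS]mul1r; apply: ler_wpM2r; last exact: Ipi_vn2.
  by apply: Ipi_ge0 => x _; exact: sqr_ge0.
apply/cvgrPdist_le => e e0.
have /cvgrPdist_le /(_ _ e0) H := Ipi_gn2_1.
have L := lead2_lower e e0.
near=> n.
have h1 : yn n ^+ 2 <= Ipi (fun x => gn n x ^+ 2) by near: n; exact: up.
have h2 : `|1 - Ipi (fun x => gn n x ^+ 2)| <= e by near: n; exact: H.
have h3 : 2 * pi * 2 `^ (- (s + t)) * lead2 n ^+ 2 * (1 + e) >= 1 by near: n; exact: L.
rewrite -yn2 in h3; move: h2; rewrite !ler_norml => /andP[h2 h2'].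
apply/andP; split; first by lra.
rewrite lerBlDr; have y0 : 0 <= yn n ^+ 2 by exact: sqr_ge0.
by have [y1|y1] := leP 1 (yn n ^+ 2); [lra|nra].
Unshelve. all: by end_near. Qed.

(** Expanding the square gives at most 1 - 2 * 1 + 1 in the limit. Only the upper bound 1 for the
    norm of [vn n] enters, so the share of the norm of [P n] carried by the masses need not be
    estimated. *)
Lemma vn_gn_L2 : (fun n => Ipi (fun x => (vn n x - gn n x) ^+ 2)) @ \oo --> (0 : R).
Proof.
apply: (@squeeze_cvgr _ _ _ _ (fun=> 0) (fun n => 1 - 2 * yn n + Ipi (fun x => gn n x ^+ 2))).
- near=> n; have [m ->] : exists m, n = m.+1 by exists n.-1; rewrite prednK//; near: n; exists 1%N.
  apply/andP; split; first by apply: Ipi_ge0 => x _; exact: sqr_ge0.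
  have cv := cont_vn m.+1; have cg := cont_gn m.+1.
  have -> : Ipi (fun x => (vn m.+1 x - gn m.+1 x) ^+ 2) =
    Ipi (fun x => vn m.+1 x ^+ 2) - 2 * yn m.+1 + Ipi (fun x => gn m.+1 x ^+ 2).
    rewrite -Ipi_vn_gn -IpiZ; last by cont.
    rewrite -IpiB; [|by cont|by cont]. rewrite -IpiD; [|by cont|by cont].
    by apply: eq_Ipi => x _; ring.
  by rewrite lerD2r lerD2r Ipi_vn2.
- exact: cvg_cst.
- have : (fun n => 1 - 2 * yn n + Ipi (fun x => gn n x ^+ 2)) @ \oo --> (1 - 2 * 1 + 1 : R).
    apply: cvgD; last exact: Ipi_gn2_1.
    apply: cvgB; first exact: cvg_cst.
    by apply: cvgMr; exact: yn_cvg.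
  by rewrite (_ : 1 - 2 * 1 + 1 = 0 :> R); last by lra.
Unshelve. all: by end_near. Qed.

(** [rho n] is half of [yn n / yn n.+1], hence tends to 1/2. *)
Lemma rho_bounds : \forall n \near \oo, 4^-1 <= rho n <= 1.
Proof.
have h : 0 < 4^-1 :> R by rewrite invr_gt0.
have /cvgrPdist_le /(_ _ h) H := yn_cvg.
have H' : \forall n \near \oo, `|1 - yn n.+1| <= 4^-1.
  by case: H => N _ HN; exists N => // n /= Nn; apply: HN; exact: leqW.
near=> n.
have h1 : `|1 - yn n| <= 4^-1 by near: n; exact: H.
have h2 : `|1 - yn n.+1| <= 4^-1 by near: n; exact: H'.
have -> : rho n = 2^-1 * (yn n / yn n.+1).
  have sq0 : 0 < Num.sqrt (2 / pi) :> R by rewrite sqrtr_gt0 two_pi_gt0.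
  rewrite /rho /yn /lead2 exprS; field.
  by rewrite !gt_eqF ?lP ?K0_gt0 ?exprn_gt0//= sqrtr_gt0 two_pi_gt0.
move: h1 h2; rewrite !ler_norml => /andP[a1 a2] /andP[b1 b2].
have p := yn_gt0 n.+1.
by rewrite mulrA ler_pdivrMr// ler_pdivlMr//; apply/andP; split; lra.
Unshelve. all: by end_near. Qed.

(** * Size of functions close to the profile, and pairings with oscillating functions *)

Let chw : contf hw := cont_hw.
Implicit Types (y e d eta : R) (k w h chi : R -> R).

Lemma two_div_pi : 2^-1 <= (2 / pi : R) <= 1.
Proof.
have p0 := @pi_gt0 R; have p2 := @pi_ge2 R; have p4 : (pi : R) <= 4 by have := @pihalf_lt2 R; lra.
by rewrite ler_pdivlMr// ler_pdivrMr// mul1r p2 andbT; lra.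
Qed.

Lemma mul_pi2 y : pi / 2 * (y / pi) = y / 2.
Proof.
have aux (w : R) : w != 0 -> w / 2 * (y / w) = y / 2 by move=> w0; field.
by apply: aux; rewrite gt_eqF// pi_gt0.
Qed.

Lemma gn2_le n x : gn n x ^+ 2 <= 2 / pi.
Proof.
have := two_div_pi => /andP[h1 h2].
rewrite /gn exprMn sqr_sqrtr; last by lra.
rewrite -[leRHS]mulr1; apply: ler_wpM2l; first by lra.
have := cos2Dsin2 (ph n x); have := sqr_ge0 (sin (ph n x)); lra.
Qed.

(** A quadratic minorant that turns L^2 closeness to the profile into a lower bound for a
    distribution function. If |y| >= 1/8 the ramp is 1 and pi / 2 * g^2 <= 1. Otherwise either |g|
    <= 1/4 and the first term is not positive, or |y - g| >= |g| / 2 and the second term outweighs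
    it. *)
Lemma ramp_lower n x (y : R) :
  pi / 2 * (gn n x ^+ 2 - 16^-1) - 8 * (y - gn n x) ^+ 2 <= ramp (16 * `|y|).
Proof.
set g := gn n x; have g2 : g ^+ 2 <= 2 / pi := gn2_le n x.
have p0 := @pi_gt0 R; have p4 : (pi : R) <= 4 by have := @pihalf_lt2 R; lra.
have [h|h] := leP (8^-1) `|y|.
  rewrite ramp_2; last by lra.
  have : pi / 2 * g ^+ 2 <= 1.
    apply: le_trans (_ : pi / 2 * (2 / pi) <= _); first by rewrite ler_pM2l// divr_gt0.
    by rewrite mul_pi2 divff.
  by have := sqr_ge0 (y - g); nra.
apply: le_trans (ramp_ge0 _).
have [hg|hg] := leP `|g| (4^-1).
  have : g ^+ 2 <= 16^-1.
    rewrite -real_normK ?num_real//; apply: le_trans (_ : (4^-1) ^+ 2 <= _).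
      by rewrite ler_pXn2r// nnegrE.
    by rewrite exprVn -natrX.
  by have := sqr_ge0 (y - g); nra.
have h2 : `|g| / 2 <= `|y - g|.
  have := ler_normB g y; rewrite distrC => ?; have := lerB_dist g y; rewrite (distrC g); lra.
have : (`|g| / 2) ^+ 2 <= (y - g) ^+ 2.
  by rewrite -[(y - g) ^+ 2]real_normK ?num_real// ler_pXn2r ?nnegrE ?divr_ge0.
rewrite expr_div_n real_normK ?num_real//; have := sqr_ge0 g; nra.
Qed.

(** The index is chosen before h, because h will depend on n. The integral of chi * gn^2 tends to
    that of chi over pi, so [ramp_lower] yields 1/2 of the integral of chi, less 1/16 for the limit,
    1/8 for the threshold and 1/16 for the distance to the profile. *)
Lemma ramp_mass chi : contf chi -> (forall x, 0 <= chi x) -> 0 < Ipi chi ->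
  \forall n \near \oo, forall h, contf h -> Ipi (fun x => chi x * (h x - gn n x) ^+ 2) <= Ipi chi / 128 ->
  Ipi chi / 4 <= Ipi (fun x => chi x * ramp (16 * `|h x|)).
Proof.
move=> cc c0 I0.
have e0 : 0 < Ipi chi / 32 by rewrite divr_gt0.
have /cvgrPdist_le /(_ _ e0) H := Ipi_gn2 chi cc.
near=> n => h ch hh.
have hn : `|Ipi chi / pi - Ipi (fun x => chi x * gn n x ^+ 2)| <= Ipi chi / 32 by near: n; exact: H.
have p0 := @pi_gt0 R; have p4 : (pi : R) <= 4 by have := @pihalf_lt2 R; lra.
have cg := cont_gn n.
have : pi / 2 * (Ipi (fun x => chi x * gn n x ^+ 2) - 16^-1 * Ipi chi) - 8 * Ipi (fun x => chi x * (h x - gn n x) ^+ 2)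
    <= Ipi (fun x => chi x * ramp (16 * `|h x|)).
  rewrite -[16^-1 * _]IpiZ// -IpiB; [|by cont|by cont].
  rewrite -IpiZ; last by cont. rewrite -IpiZ; last by cont. rewrite -IpiB; [|by cont|by cont].
  apply: le_Ipi; [by cont|by apply: contM => //; apply: cont_ramp; cont|].
  move=> x _; have := ler_wpM2l (c0 x) (ramp_lower n x (h x)).
  by apply: le_trans; rewrite le_eqVlt; apply/orP; left; apply/eqP; ring.
apply: le_trans; move: hn; rewrite ler_norml => /andP[_ hn].
set G := Ipi (fun x => chi x * gn n x ^+ 2) in hn *.
have E := mul_pi2 (Ipi chi).
have : pi / 2 * (Ipi chi / pi - G) <= 2 * (Ipi chi / 32).
  apply: le_trans (_ : pi / 2 * (Ipi chi / 32) <= _); first by rewrite ler_pM2l// divr_gt0.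
  by apply: ler_wpM2r; [exact: ltW|lra].
have : pi / 2 * (16^-1 * Ipi chi) <= 2 * (16^-1 * Ipi chi).
  by apply: ler_wpM2r; [rewrite mulr_ge0 ?(ltW I0)|lra].
move: E hh; rewrite !mulrBr; set I := Ipi chi; set X := pi / 2 * _; set Y := pi / 2 * _; set Z := pi / 2 * G.
lra.
Unshelve. all: by end_near. Qed.

(** r is the offset between the index of the polynomial and that of the phase. Cauchy-Schwarz needs
    only the norm of the fixed function k, since the oscillating factor is bounded by 1. *)
Lemma pairing_gap (r : nat) k (w : nat -> R -> R) : contf k -> (forall n, contf (w n)) -> (forall n x, `|w n x| <= 1) ->
  (fun n => Ipi (fun x => vn (r + n) x * (k x * w n x)) - Ipi (fun x => gn (r + n) x * (k x * w n x))) @ \oo --> 0.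
Proof.
move=> ck cw w1.
have L2 : (fun n => Ipi (fun x => (vn (r + n) x - gn (r + n) x) ^+ 2)) @ \oo --> 0.
  by have := vn_gn_L2; rewrite -(cvg_shiftn r); under eq_fun do rewrite addnC.
set B := Ipi (fun x => k x ^+ 2) + 1.
have B0 : 0 < B by rewrite ltr_wpDl// Ipi_ge0// => x _; exact: sqr_ge0.
apply/cvgrPdist_le => e e0.
have d0 : 0 < e ^+ 2 / B by rewrite divr_gt0// exprn_gt0.
have /cvgrPdist_le /(_ _ d0) := L2; apply: filterS => n.
rewrite sub0r normrN => hn; rewrite sub0r normrN.
have cv := cont_vn (r + n); have cg := cont_gn (r + n); have cwn := cw n.
rewrite -IpiB; [|by cont|by cont].
rewrite -(ler_pXn2r (n := 2)) ?nnegrE ?normr_ge0 ?(ltW e0)// real_normK ?num_real//.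
have -> : Ipi (fun x => vn (r + n) x * (k x * w n x) - gn (r + n) x * (k x * w n x)) =
   Ipi (fun x => (vn (r + n) x - gn (r + n) x) * (k x * w n x)) by apply: eq_Ipi => x _; ring.
apply: le_trans (Ipi_cauchy_schwarz _ _ _ _) _; [by cont|by cont|].
apply: le_trans (_ : e ^+ 2 / B * B <= _); last by rewrite divfK// gt_eqF.
apply: ler_pM.
- by apply: Ipi_ge0 => x _; exact: sqr_ge0.
- by apply: Ipi_ge0 => x _; exact: sqr_ge0.
- exact: le_trans (ler_norm _) hn.
apply: le_trans (_ : Ipi (fun x => k x ^+ 2) <= _); last by rewrite lerDl.
apply: le_Ipi; [by cont|by cont|].
move=> x _; rewrite exprMn -[leRHS]mulr1; apply: ler_wpM2l; first exact: sqr_ge0.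
by rewrite -real_normK ?num_real// expr_le1.
Qed.

Lemma pairing_cos k : contf k ->
  (fun n => Ipi (fun x => vn n x * (k x * cos (ph n x)))) @ \oo --> Num.sqrt (2 / pi) / 2 * Ipi k.
Proof.
move=> ck; have [osc _] := phase_osc k ck.
have gap := pairing_gap 0 k (fun n x => cos (ph n x)) ck (cont_cosph) (fun n x => cos_max _).
rewrite -[X in _ --> X]add0r.
have -> : (fun n => Ipi (fun x => vn n x * (k x * cos (ph n x)))) =
  (fun n => (Ipi (fun x => vn n x * (k x * cos (ph n x))) - Ipi (fun x => gn n x * (k x * cos (ph n x))))
    + Num.sqrt (2 / pi) / 2 * (Ipi k + Ipi (fun x => k x * cos (ph n x + ph n x)))).
  apply/funext => n.
  have -> : Ipi (fun x => gn n x * (k x * cos (ph n x))) =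
     Num.sqrt (2 / pi) / 2 * (Ipi k + Ipi (fun x => k x * cos (ph n x + ph n x))).
    have cp : contf (fun x => k x * cos (ph n x + ph n x)) by rewrite /ph; cont.
    rewrite -IpiD// -IpiZ; last by cont.
    apply: eq_Ipi => x _; rewrite /gn.
    have := cos_sqr_half (ph n x); set C := cos (ph n x) => E.
    have -> : Num.sqrt (2 / pi) * C * (k x * C) = Num.sqrt (2 / pi) * (k x * C ^+ 2) by ring.
    by rewrite E; field.
  by rewrite subrK.
apply: cvgD => //; apply: cvgMr; rewrite -[X in _ --> X]addr0; apply: cvgD => //; exact: cvg_cst.
Qed.

Lemma pairing_sin k : contf k ->
  (fun n => Ipi (fun x => vn n x * (k x * sin (ph n x)))) @ \oo --> (0 : R).
Proof.
move=> ck; have [_ osc] := phase_osc k ck.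
have gap := pairing_gap 0 k (fun n x => sin (ph n x)) ck (cont_sinph) (fun n x => sin_max _).
rewrite -[X in _ --> X]add0r.
have -> : (fun n => Ipi (fun x => vn n x * (k x * sin (ph n x)))) =
  (fun n => (Ipi (fun x => vn n x * (k x * sin (ph n x))) - Ipi (fun x => gn n x * (k x * sin (ph n x))))
    + Num.sqrt (2 / pi) / 2 * (Ipi (fun x => k x * sin (ph n x + ph n x)))).
  apply/funext => n.
  have -> : Ipi (fun x => gn n x * (k x * sin (ph n x))) =
     Num.sqrt (2 / pi) / 2 * (Ipi (fun x => k x * sin (ph n x + ph n x))).
    rewrite -IpiZ; last by rewrite /ph; cont.
    by apply: eq_Ipi => x _; rewrite /gn sinD; field.
  by rewrite subrK.
by apply: cvgD => //; rewrite -[X in _ --> X](mulr0 (Num.sqrt (2 / pi) / 2)); apply: cvgMr.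
Qed.

(** The profile of index n + 1 has phase ph n + x, and cos (ph n + x) sin (ph n) averages to - sin x
    / 2, whereas cos (ph n) sin (ph n) averages to 0. With the sine phase, only the coefficient of
    index n + 1 in the Christoffel-Darboux formula survives, so the image is asymptotically a
    multiple of the single polynomial [P n]. *)
Lemma pairing_sin_succ k : contf k ->
  (fun n => Ipi (fun x => vn n.+1 x * (k x * sin (ph n x)))) @ \oo -->
    - (Num.sqrt (2 / pi) / 2 * Ipi (fun x => k x * sin x)).
Proof.
move=> ck.
have ck1 : contf (fun x => k x * sin x) by cont.
have ck2 : contf (fun x => k x * cos x) by cont.
have [osc1 _] := phase_osc _ ck1; have [_ osc2] := phase_osc _ ck2.
have gap := pairing_gap 1 k (fun n x => sin (ph n x)) ck (cont_sinph) (fun n x => sin_max _).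
rewrite -[X in _ --> X]add0r.
set S := Num.sqrt (2 / pi) / 2.
have -> : (fun n => Ipi (fun x => vn n.+1 x * (k x * sin (ph n x)))) =
  (fun n => (Ipi (fun x => vn n.+1 x * (k x * sin (ph n x))) - Ipi (fun x => gn n.+1 x * (k x * sin (ph n x))))
    + (S * Ipi (fun x => k x * cos x * sin (ph n x + ph n x))
       - S * (Ipi (fun x => k x * sin x) - Ipi (fun x => k x * sin x * cos (ph n x + ph n x))))).
  apply/funext => n.
  have -> : Ipi (fun x => gn n.+1 x * (k x * sin (ph n x))) =
     (S * Ipi (fun x => k x * cos x * sin (ph n x + ph n x))
       - S * (Ipi (fun x => k x * sin x) - Ipi (fun x => k x * sin x * cos (ph n x + ph n x)))).
    have cp1 : contf (fun x => k x * cos x * sin (ph n x + ph n x)) by rewrite /ph; cont.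
    have cp2 : contf (fun x => k x * sin x * cos (ph n x + ph n x)) by rewrite /ph; cont.
    rewrite -IpiB// -IpiZ// -IpiZ; last by cont. rewrite -IpiB; [|by cont|by cont].
    apply: eq_Ipi => x _; rewrite /gn.
    have -> : ph n.+1 x = ph n x + x by rewrite /ph -natr1; ring.
    have := sin_sqr_half (ph n x); rewrite sinD (cosD (ph n x) x); set C := cos (ph n x); set D := sin (ph n x) => E.
    have -> : k x * sin x - k x * sin x * cos (ph n x + ph n x) = k x * sin x * (2 * D ^+ 2) by rewrite E; field.
    by rewrite /S; field.
  by rewrite subrK.
apply: cvgD => //; rewrite -[X in _ --> X]add0r; apply: cvgB.
  by rewrite -[X in _ --> X](mulr0 S); apply: cvgMr.
by apply: cvgMr; rewrite -[X in _ --> X]subr0; apply: cvgB => //; exact: cvg_cst.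
Qed.

(** * Partial sums of continuous functions and their size near the endpoint *)

Definition pcoef n k : R := Ipi (fun y => (P n).[cos y] * k y * jac s t y).
(** Only the absolutely continuous part of the measure appears, since the functions to be tested are
    set to 0 at the mass points. *)
Definition psum n k x : R := Ipi (fun y => kernelL P n (cos x) (cos y) * k y * jac s t y).

Lemma psum_sum n k x : contf k -> psum n k x = \sum_(j < n.+1) (P j).[cos x] * pcoef j k.
Proof.
move=> ck; transitivity (Ipi (fun y => \sum_(j < n.+1) (P j).[cos x] * ((P j).[cos y] * k y * jac s t y))).
  apply: eq_Ipi => y _; rewrite /kernelL !mulr_suml; apply: eq_bigr => j _; ring.
rewrite Ipi_sum; last by move=> j _; cont; exact: chc.
by apply: eq_bigr => j _; rewrite IpiZ//; cont; exact: chc.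
Qed.

Lemma cont_psum n k : contf k -> contf (psum n k).
Proof.
move=> ck; rewrite (_ : psum n k = fun x => \sum_(j < n.+1) (P j).[cos x] * pcoef j k).
  by apply: cont_sum => j _; cont; exact: chc.
by apply/funext => x; exact: psum_sum.
Qed.

Lemma psumS n k x : contf k -> psum n.+1 k x - psum n k x = (P n.+1).[cos x] * pcoef n.+1 k.
Proof. by move=> ck; rewrite !psum_sum// [X in X - _]big_ord_recr/= addrAC subrr add0r. Qed.

Lemma sqrt_2pi : 2^-1 <= Num.sqrt (2 / (pi : R)).
Proof.
have /andP[h _] := two_div_pi.
rewrite -[leLHS](@ger0_norm R)// -sqrtr_sqr ler_sqrt ?(ltW two_pi_gt0)//.
by apply: le_trans h; rewrite expr2; lra.
Qed.

Lemma vn_gn_small (m : R) : 0 < m -> exists N, forall n, (N <= n)%N ->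
  Ipi (fun x => (vn n x - gn n x) ^+ 2) <= m.
Proof.
move=> m0; have /cvgrPdist_le /(_ _ m0) := vn_gn_L2.
case=> N _ H; exists N => n Nn; have := H n Nn.
by rewrite sub0r normrN => h; exact: le_trans (ler_norm _) h.
Qed.

Lemma near_ge (u : nat -> R) l m : u @ \oo --> l -> m < l -> exists N, forall n, (N <= n)%N -> m <= u n.
Proof. by move=> ul ml; have [N _ H] := cvgr_ge _ ul _ ml; exists N. Qed.

Lemma ramp_mass_ex chi : contf chi -> (forall x, 0 <= chi x) -> 0 < Ipi chi ->
  exists N, forall n h, (N <= n)%N -> contf h -> Ipi (fun x => chi x * (h x - gn n x) ^+ 2) <= Ipi chi / 128 ->
  Ipi chi / 4 <= Ipi (fun x => chi x * ramp (16 * `|h x|)).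
Proof.
move=> cc c0 I0; have [N _ H] := ramp_mass chi cc c0 I0.
by exists N => n h Nn; exact: H.
Qed.

Section Kernel.
Variables (e : R) (k : R -> R).
Hypotheses (ee : 0 < e <= 8^-1) (ck : contf k) (sk : forall x, k x != 0 -> e <= x <= 1).

(** The quotient of k by 1 - cos, with the denominator frozen outside [e, pi - e] to keep it
    continuous. *)
Definition divk x : R := k x * jacc e (-1) 0 x.

Lemma cont_divk : contf divk.
Proof.
case/andP: ee => e0 e8; apply: contM => //; apply: cont_jacc => //.
by have := @pi_ge2 R; lra.
Qed.

Lemma divk_mul x : divk x * (1 - cos x) = k x.
Proof.
rewrite /divk -jac10; have [->|h] := eqVneq (k x) 0; first by rewrite !mul0r.
case/andP: ee => e0 e8.
have [|h1 h2] := supp_in e e x _ e8 (sk x h); first by rewrite e0 lexx.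
by rewrite jaccE// -mulrA -jacD// addNr addr0 /jac !powRr0 !mulr1.
Qed.

Lemma cont_kernel n x : contf (fun y => kernelL P n (cos x) (cos y)).
Proof. by rewrite /kernelL; apply: cont_sum => j _; cont; exact: chc. Qed.

(* Near the endpoint [1 - cos x] is small, so the first term dominates. *)
Lemma psum_CD n x : psum n k x = rho n * ((P n.+1).[cos x] * pcoef n divk - (P n).[cos x] * pcoef n.+1 divk)
   + (1 - cos x) * psum n divk x.
Proof.
have cd := cont_divk; have cK := cont_kernel n x; have ch0 := chc (P n); have ch1 := chc (P n.+1).
rewrite /psum /pcoef mulrBr !mulrA.
rewrite -!IpiZ; try by cont.
rewrite -IpiB; [|by cont|by cont]; rewrite -IpiD; [|by cont|by cont].
(* k y is [divk y] times (1 - cos x) + (cos x - cos y), and the Christoffel-Darboux formula absorbs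
   the second summand. *)
apply: eq_Ipi => y _; rewrite -{1}(divk_mul y); have := christoffel_darboux n (cos x) (cos y).
set L := kernelL _ _ _ _; move: (P n).[cos x] (P n.+1).[cos x] (P n).[cos y] (P n.+1).[cos y] => p1 p2 p3 p4 E.
have -> : rho n * p2 * (p3 * divk y * jac s t y) - rho n * p1 * (p4 * divk y * jac s t y)
   = (rho n * (p2 * p3 - p1 * p4)) * (divk y * jac s t y) by ring.
by rewrite -E; ring.
Qed.
End Kernel.

(** Away from the support of k the Christoffel-Darboux formula replaces the kernel by products of
    polynomials, whose integrals are controlled because [vn] has norm at most 1. The majorant k0
    makes the constant independent of n although k will carry the phase of index n. *)
Lemma psum_far e k k0 n x : contf k -> contf k0 -> (forall y, `|k y| <= k0 y) ->
  (forall y, k y != 0 -> e ^+ 2 / 8 <= cos x - cos y) -> 0 < e ->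
  `|hw x * psum n k x| * (e ^+ 2 / 8) <=
  rho n * (1 + Ipi (fun y => (k0 y * hw y) ^+ 2)) * (`|vn n.+1 x| + `|vn n x|).
Proof.
move=> ck ck0 kk0 far e0; have cK := cont_kernel n x.
set Z := 1 + _.
have Zn m : Ipi (fun y => `|(P m).[cos y] * k y * jac s t y|) <= Z.
  have cm := chc (P m); have cv := cont_vn m.
  apply: (@le_trans _ _ (Ipi (fun y => vn m y ^+ 2 + (k0 y * hw y) ^+ 2))).
    apply: le_Ipi; [by apply: cont_norm; cont|by cont|] => y _.
    have -> : (P m).[cos y] * k y * jac s t y = vn m y * (k y * hw y) by rewrite -hw2 /vn; ring.
    have h1 : `|k y * hw y| <= k0 y * hw y.
      by rewrite normrM (ger0_norm (hw_ge0 _)); apply: ler_wpM2r; [exact: hw_ge0|].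
    rewrite normrM -[vn m y ^+ 2]real_normK ?num_real//.
    have := normr_ge0 (vn m y); have := normr_ge0 (k y * hw y).
    move: h1; move: `|vn m y| `|k y * hw y| (k0 y * hw y) => A B D BD B0 A0.
    have := sqr_ge0 (A - D); nra.
  rewrite IpiD; [|by cont|by cont]; apply: lerD => //; exact: (Ipi_vn2 m).
have r0 : 0 < rho n := rho_gt0 n.
have d0 : 0 < e ^+ 2 / 8 by rewrite divr_gt0 ?exprn_gt0.
set p1 := (P n).[cos x]; set p2 := (P n.+1).[cos x].
have main : `|psum n k x| * (e ^+ 2 / 8) <= rho n * (`|p2| * Z + `|p1| * Z).
  have cm := chc (P n); have cm1 := chc (P n.+1).
  have ck1 : contf (fun y => kernelL P n (cos x) (cos y) * k y * jac s t y) by cont.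
  apply: (@le_trans _ _ (e ^+ 2 / 8 * Ipi (fun y => `|kernelL P n (cos x) (cos y) * k y * jac s t y|))).
    by rewrite mulrC; apply: ler_wpM2l; [exact: ltW|exact: Ipi_norm].
  have cA1 : contf (fun y => `|(P n).[cos y] * k y * jac s t y|) by apply: cont_norm; cont.
  have cA2 : contf (fun y => `|(P n.+1).[cos y] * k y * jac s t y|) by apply: cont_norm; cont.
  apply: (@le_trans _ _ (rho n * (`|p2| * Ipi (fun y => `|(P n).[cos y] * k y * jac s t y|)
      + `|p1| * Ipi (fun y => `|(P n.+1).[cos y] * k y * jac s t y|)))); last first.
    by apply: ler_wpM2l; [exact: ltW|apply: lerD; apply: ler_wpM2l => //].
  rewrite -!IpiZ; try by cont. 
  rewrite -IpiD; [|by cont|by cont]. rewrite -IpiZ; last by cont.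
  apply: le_Ipi; [by cont|by cont|] => y _.
  have [->|h] := eqVneq (k y) 0; first by rewrite !(mulr0, mul0r) normr0 !mulr0 addr0 mulr0.
  have := christoffel_darboux n (cos x) (cos y); have := far y h; rewrite -/p1 -/p2.
  set L := kernelL _ _ _ _ => h1 h2.
  move: (jac s t y) => jy; rewrite !normrM; set W := `|k y| * `|jy|.
  have W0 : 0 <= W by exact: mulr_ge0.
  have : e ^+ 2 / 8 * `|L| <= rho n * (`|p2| * `|(P n).[cos y]| + `|p1| * `|(P n.+1).[cos y]|).
    apply: (@le_trans _ _ (`|cos x - cos y| * `|L|)).
      by apply: ler_wpM2r => //; exact: le_trans h1 (ler_norm _).
    rewrite -normrM h2 normrM (gtr0_norm r0); apply: ler_wpM2l; first exact: ltW.
    by rewrite -!normrM; exact: ler_normB.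
  move=> /(ler_wpM2r W0); rewrite /W => h3.
  apply: le_trans (le_trans _ h3) _; rewrite le_eqVlt; apply/orP; left; apply/eqP; ring.
have hh : 0 <= hw x := hw_ge0 x.
have := ler_wpM2l hh main; rewrite /vn (normrM p1) (normrM p2) (normrM (hw x)) (ger0_norm hh).
by move=> h4; apply: le_trans (le_trans _ h4) _; rewrite le_eqVlt; apply/orP; left; apply/eqP; ring.
Qed.

Lemma window_far e x y : 0 < e <= 8^-1 -> e <= y <= 1 -> 128 * x ^+ 2 <= 16 * e ^+ 2 ->
  e ^+ 2 / 8 <= cos x - cos y.
Proof.
move=> /andP[e0 e8] /andP[ey y1] xe.
have h1 := onemcos_upper x.
have y01 : 0 <= y <= 1 by rewrite y1 andbT; exact: le_trans (ltW e0) ey.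
have h2 := onemcos_lower y y01.
have : e ^+ 2 <= y ^+ 2 by rewrite ler_pXn2r// nnegrE ?(ltW e0)//; case/andP: y01.
lra.
Qed.

(** The term of [psum_CD] containing [P n] is the main one. The other has the small coefficient of
    index n, and the remainder is [psum_far] with 1 - cos x <= 16 eta^2 over the gap e^2 / 8, whence
    128. *)
Lemma psum_near e k k0 n eta x : 0 < e <= 8^-1 -> contf k -> contf k0 -> (forall y, k y != 0 -> e <= y <= 1) ->
  (forall y, `|divk e k y| <= k0 y) -> 0 < eta -> 128 * eta ^+ 2 <= e ^+ 2 -> 2 * eta <= x <= 4 * eta ->
  `|hw x * psum n k x + rho n * pcoef n.+1 (divk e k) * vn n x| <=
  rho n * (`|pcoef n (divk e k)| + 128 * eta ^+ 2 / e ^+ 2 * (1 + Ipi (fun y => (k0 y * hw y) ^+ 2)))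
   * (`|vn n.+1 x| + `|vn n x|).
Proof.
move=> ee ck ck0 sk kk0 eta0 etae /andP[x1 x2]; have e0 : 0 < e by case/andP: ee.
have xx : x ^+ 2 <= 16 * eta ^+ 2.
  have -> : 16 * eta ^+ 2 = (4 * eta) ^+ 2 by ring.
  by rewrite ler_pXn2r// nnegrE; [apply: le_trans x1|]; rewrite mulr_ge0// ltW.
have far y : divk e k y != 0 -> e ^+ 2 / 8 <= cos x - cos y.
  rewrite mulf_eq0 negb_or => /andP[h _]; apply: window_far => //; first exact: sk.
  lra.
have := psum_far e (divk e k) k0 n x (cont_divk e k ee ck) ck0 kk0 far e0.
rewrite (psum_CD e k ee ck sk n x).
set Z := 1 + _; set A := pcoef n _; set B := pcoef n.+1 _; set F := psum n (divk e k) x => hF.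
have r0 : 0 < rho n := rho_gt0 n.
have -> : hw x * (rho n * ((P n.+1).[cos x] * A - (P n).[cos x] * B) + (1 - cos x) * F) + rho n * B * vn n x
   = rho n * (A * vn n.+1 x) + (1 - cos x) * (hw x * F) by rewrite /vn; ring.
apply: le_trans (ler_normD _ _) _; rewrite (normrM (rho n)) (normrM A) (gtr0_norm r0).
rewrite (normrM (1 - cos x)) (ger0_norm (onemcos_ge0 x)).
have V1 := normr_ge0 (vn n.+1 x); have V0 := normr_ge0 (vn n x).
set V := `|vn n.+1 x| + `|vn n x| in hF *.
have V1V : `|vn n.+1 x| <= V by rewrite lerDl.
rewrite (mulrDr (rho n)) (mulrDl _ _ V); apply: lerD.
  by rewrite -(mulrA (rho n)); apply: ler_wpM2l; [exact: ltW|exact: ler_wpM2l].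
have e20 : 0 < e ^+ 2 by rewrite exprn_gt0.
have -> : rho n * (128 * eta ^+ 2 / e ^+ 2 * Z) * V = (16 * eta ^+ 2) * (rho n * Z * V / (e ^+ 2 / 8)).
  by field; rewrite gt_eqF.
apply: ler_pM; [exact: onemcos_ge0|exact: normr_ge0|exact: le_trans (onemcos_upper x) xx|].
by rewrite ler_pdivlMr// divr_gt0.
Qed.

(** Divided by - rho * B, the weighted image is [vn n] up to a relative error r, hence close to
    [gn n] in L^2; this is the hypothesis of [ramp_mass] for chi = [tri eta]. *)
Lemma near_profile e k k0 n eta r : 0 < e <= 8^-1 -> contf k -> contf k0 -> (forall y, k y != 0 -> e <= y <= 1) ->
  (forall y, `|divk e k y| <= k0 y) -> 0 < eta <= 1 -> 128 * eta ^+ 2 <= e ^+ 2 ->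
  let B := pcoef n.+1 (divk e k) in
  B != 0 ->
  (`|pcoef n (divk e k)| + 128 * eta ^+ 2 / e ^+ 2 * (1 + Ipi (fun y => (k0 y * hw y) ^+ 2))) <= r * `|B| ->
  (64 * r) ^+ 2 <= eta -> Ipi (fun x => (vn n x - gn n x) ^+ 2) <= eta / 32 / 32 ->
  Ipi (fun x => tri eta x * (- (hw x * psum n k x) / (rho n * B) - gn n x) ^+ 2) <= Ipi (tri eta) / 128.
Proof.
move=> ee ck ck0 sk kk0 /andP[eta0 eta1] etae B B0 rB r2 o.
have r0 : 0 < rho n := rho_gt0 n.
have cv := cont_vn n; have cv1 := cont_vn n.+1; have cg := cont_gn n; have cf := cont_psum n k ck.
have ct := cont_tri eta.
have rB0 : rho n * B != 0 by rewrite mulf_neq0// gt_eqF.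
have pw x : tri eta x * (- (hw x * psum n k x) / (rho n * B) - gn n x) ^+ 2 <=
   2 * (vn n x - gn n x) ^+ 2 + 4 * r ^+ 2 * (vn n.+1 x ^+ 2 + vn n x ^+ 2).
  have N1 := sqr_ge0 (vn n x - gn n x); have N2 := sqr_ge0 (vn n x); have N3 := sqr_ge0 (vn n.+1 x).
  have N4 := sqr_ge0 r.
  have [->|h] := eqVneq (tri eta x) 0.
    by rewrite mul0r; apply: addr_ge0; [exact: mulr_ge0|apply: mulr_ge0; [exact: mulr_ge0|exact: addr_ge0]].
  have xs := tri_supp _ _ eta0 h.
  have := psum_near e k k0 n eta x ee ck ck0 sk kk0 eta0 etae xs; rewrite -/B => H.
  have D : `|- (hw x * psum n k x) / (rho n * B) - vn n x| <= r * (`|vn n.+1 x| + `|vn n x|).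
    have -> : - (hw x * psum n k x) / (rho n * B) - vn n x = - (hw x * psum n k x + rho n * B * vn n x) / (rho n * B).
      by field; rewrite B0 gt_eqF.
    rewrite normrM normrN normfV ler_pdivrMr ?normr_gt0//; apply: le_trans H _.
    rewrite (normrM (rho n)) (gtr0_norm r0).
    have := ler_wpM2r (addr_ge0 (normr_ge0 (vn n.+1 x)) (normr_ge0 (vn n x))) (ler_wpM2l (ltW r0) rB).
    by move=> H; apply: le_trans H _; rewrite le_eqVlt; apply/orP; left; apply/eqP; ring.
  have T1 := tri_le1 eta x; have T0 := tri_ge0 eta x.
  apply: (@le_trans _ _ ((- (hw x * psum n k x) / (rho n * B) - gn n x) ^+ 2)).
    by rewrite -[leRHS]mul1r; apply: ler_wpM2r => //; exact: sqr_ge0.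
  rewrite -[- (hw x * psum n k x) / (rho n * B)](subrK (vn n x)).
  move: D N1; set Q := _ - vn n x; rewrite -addrA; set G := vn n x - gn n x => D N1.
  have Q2 : Q ^+ 2 <= r ^+ 2 * (2 * (vn n.+1 x ^+ 2 + vn n x ^+ 2)).
    rewrite -real_normK ?num_real//; apply: (@le_trans _ _ ((r * (`|vn n.+1 x| + `|vn n x|)) ^+ 2)).
      by rewrite ler_pXn2r ?nnegrE ?normr_ge0//; apply: le_trans D.
    rewrite exprMn; apply: ler_wpM2l => //.
    rewrite -[vn n.+1 x ^+ 2]real_normK ?num_real// -[vn n x ^+ 2]real_normK ?num_real//.
    by have := sqr_ge0 (`|vn n.+1 x| - `|vn n x|); move: `|vn n.+1 x| `|vn n x| => x1 x2; nra.
  have -> : 4 * r ^+ 2 * (vn n.+1 x ^+ 2 + vn n x ^+ 2) = 2 * (r ^+ 2 * (2 * (vn n.+1 x ^+ 2 + vn n x ^+ 2))) by ring.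
  exact: sqr_add_le.
have I1 := Ipi_vn2 n; have I2 := Ipi_vn2 n.+1.
(* (64 r)^2 <= eta gives 8 r^2 <= eta / 512, so the total is at most eta / 256, and the integral of
   [tri eta] is at least eta / 2. *)
apply: (@le_trans _ _ (2 * (eta / 32 / 32) + 4 * r ^+ 2 * (1 + 1))); last first.
  have eta4 : 4 * eta <= pi.
    have e1 : e <= 8^-1 by case/andP: ee. have e0 : 0 < e by case/andP: ee.
    have p2 := @pi_ge2 R. have e2 : e ^+ 2 <= 64^-1 by nra. 
    have : eta <= 2^-1 by rewrite leNgt; apply/negP => h; nra.
    lra.
  by have := Ipi_tri eta eta0 eta4; lra.
apply: (@le_trans _ _ (Ipi (fun x => 2 * (vn n x - gn n x) ^+ 2 + 4 * r ^+ 2 * (vn n.+1 x ^+ 2 + vn n x ^+ 2)))).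
  by apply: le_Ipi; [by cont|by cont|] => x _; exact: pw.
rewrite IpiD; [|by cont|by cont]; rewrite IpiZ; last by cont. rewrite IpiZ; last by cont.
rewrite IpiD; [|by cont|by cont]; apply: lerD; first by rewrite ler_pM2l.
by apply: ler_wpM2l; [rewrite mulr_ge0 ?sqr_ge0|exact: lerD].
Qed.
(** * Testing the weak-type bound *)

Variables (a b p C : R).
Hypothesis p1 : 1 < p.
(* The part of the weak-type bound that is seen by functions supported in [d, pi - d]. *)
Definition weak_type : Prop := forall d n k chi S, 0 < d -> d < pi / 2 -> contf k -> contf chi ->
  (forall x, k x != 0 -> d <= x <= pi - d) -> (forall x, chi x != 0 -> d <= x <= pi - d) ->
  (forall x, 0 <= chi x <= 1) -> 0 < S ->
  S `^ p * Ipi (fun x => chi x * ramp (`|jacc d a b x * psum n k x| / S) * jac s t x)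
    <= C * Ipi (fun x => (jacc d a b x * `|k x|) `^ p * jac s t x).
Hypotheses (C0 : 0 <= C) (wt : weak_type).

Let p0 : 0 < p := lt_trans ltr01 p1.

Let q : R := p / (p - 1).
Lemma conj_expo : (q - 1) * p = q.
Proof. by rewrite /q; field; rewrite gt_eqF// subr_gt0. Qed.

(** With K = [jac X Y], this is u^-1 * K^(q-1) * w cut off to [e, 1]; w is the oscillating
    factor. *)
Definition testf e (X Y : R) w x : R := window e (- a + (q - 1) * X) (- b + (q - 1) * Y) x * w x.

Section TestFunction.
Variables (e d X Y : R) (w : R -> R).
Hypotheses (ee : 0 < e <= 8^-1) (cw : contf w) (w1 : forall x, `|w x| <= 1).
Let e0 : 0 < e. Proof. by case/andP: ee. Qed.

Lemma cont_testf : contf (testf e X Y w).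
Proof. by apply: contM => //; exact: cont_window. Qed.

Lemma testf_supp x : testf e X Y w x != 0 -> e <= x <= 1.
Proof. by rewrite mulf_eq0 negb_or => /andP[h _]; exact: window_supp h. Qed.

(** Since (q - 1) p = q, the p-th power of u |f| is K^q times the p-th power of a number in [0, 1],
    which p > 1 makes at most the cutoff itself. Every freezing level d <= e gives the same
    integrand. *)
Lemma Ipi_testf : 0 < d <= e ->
  Ipi (fun x => (jacc d a b x * `|testf e X Y w x|) `^ p * jac s t x) <= mass e (q * X + s) (q * Y + t).
Proof.
move=> de; have [d0 dle] := andP de; have e8 : e <= 8^-1 by case/andP: ee.
have ck := cont_testf; have cW u v := cont_window e u v ee.
have p2 := @pi_ge2 R.
have cjd : contf (jacc d a b) by apply: cont_jacc => //; lra.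
apply: le_Ipi => //.
  apply: contM => //; apply: cont_powR_ge0; rewrite ?(ltW p0)//; last by cont.
  by move=> x; rewrite mulr_ge0 ?jac_ge0.
move=> x _; rewrite /testf.
have [->|h] := eqVneq (window e (- a + (q - 1) * X) (- b + (q - 1) * Y) x) 0.
  by rewrite mul0r normr0 mulr0 powR0 ?gt_eqF// mul0r window_ge0.
have [dx xpi] := supp_in d e x de e8 (window_supp _ _ _ _ e0 h).
rewrite jaccE// !windowE//; have /andP[pl0 pl1] := plateau01 e x.
set pl := plateau e x in pl0 pl1 *.
have -> : jac a b x * `|pl * jac (- a + (q - 1) * X) (- b + (q - 1) * Y) x * w x| =
    (pl * `|w x|) * jac ((q - 1) * X) ((q - 1) * Y) x.
  have -> : jac ((q - 1) * X) ((q - 1) * Y) x = jac a b x * jac (- a + (q - 1) * X) (- b + (q - 1) * Y) x.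
    by rewrite -jacD//; congr jac; ring.
  by rewrite normrM (ger0_norm (mulr_ge0 pl0 (jac_ge0 _ _ _))); ring.
rewrite powRM; [|by rewrite mulr_ge0|exact: jac_ge0].
rewrite jacX.
have -> : (q - 1) * X * p = q * X by rewrite mulrAC conj_expo.
have -> : (q - 1) * Y * p = q * Y by rewrite mulrAC conj_expo.
rewrite -mulrA -jacD//; apply: ler_wpM2r; first exact: jac_ge0.
set z := pl * `|w x|; have z0 : 0 <= z by rewrite mulr_ge0.
have zp : z <= pl by rewrite -[leRHS]mulr1 ler_wpM2l.
apply: le_trans zp; have [->|zn] := eqVneq z 0; first by rewrite powR0// gt_eqF.
rewrite -[leRHS](powRr1 z0); apply: ger_powR; last exact: ltW.
by rewrite lt_neqAle eq_sym zn z0/=; apply: le_trans pl1; rewrite -[leRHS]mulr1 ler_wpM2l.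
Qed.

Lemma pcoef_testf n : pcoef n (testf e X Y w) =
  Ipi (fun x => vn n x * (window e (s / 2 - a + (q - 1) * X) (t / 2 - b + (q - 1) * Y) x * w x)).
Proof.
apply: eq_Ipi => x _; rewrite -hw2 /vn /testf.
have -> : window e (s / 2 - a + (q - 1) * X) (t / 2 - b + (q - 1) * Y) x =
   window e (- a + (q - 1) * X) (- b + (q - 1) * Y) x * hw x.
  by rewrite windowM//; congr window; ring.
ring.
Qed.
End TestFunction.

(** The rank-one difference is split by [ramp_sub] between two partial sums, and the weak-type bound
    for each gives the factor 2. In the level m c / 64, 16 comes from [ramp_mass] and 4 from
    [ramp_sub]. *)
Lemma increment_test d eta n k (m w0 : R) : 0 < d < pi / 2 -> d <= 2 * eta -> 4 * eta <= 1 -> contf k ->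
  (forall x, k x != 0 -> d <= x <= pi - d) -> 0 < m -> 0 < w0 -> 0 < pcoef n.+1 k ->
  (forall x, 2 * eta <= x <= 4 * eta -> m <= jac (a - s / 2) (b - t / 2) x) ->
  (forall x, 2 * eta <= x <= 4 * eta -> w0 <= jac s t x) ->
  Ipi (tri eta) / 4 <= Ipi (fun x => tri eta x * ramp (16 * `|vn n.+1 x|)) ->
  (m * pcoef n.+1 k / 64) `^ p * (w0 * (Ipi (tri eta) / 4)) <=
    2 * (C * Ipi (fun x => (jacc d a b x * `|k x|) `^ p * jac s t x)).
Proof.
move=> /andP[d0 dp] deta eta1 ck sk m0 w00; move Ecn: (pcoef n.+1 k) => cn cn0 hm hw0 mass.
have eta0 : 0 < eta by lra.
have p2 := @pi_ge2 R.
have [S S0 ES] : exists2 S, 0 < S & m * cn / 64 = S by exists (m * cn / 64); rewrite ?divr_gt0// mulr_gt0.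
have ct := cont_tri eta.
have st x : tri eta x != 0 -> d <= x <= pi - d.
  by move=> /(tri_supp _ _ eta0)/andP[h1 h2]; apply/andP; split; lra.
have tpi x : tri eta x != 0 -> 0 < x < pi.
  by move=> /(tri_supp _ _ eta0)/andP[h1 h2]; apply/andP; split; lra.
have t01 x : 0 <= tri eta x <= 1 by rewrite tri_ge0 tri_le1.
have W1 := wt d n.+1 k (tri eta) S d0 dp ck ct sk st t01 S0.
have W2 := wt d n k (tri eta) S d0 dp ck ct sk st t01 S0.
rewrite ES mulr_natl mulr2n; apply: le_trans (lerD W1 W2); rewrite -mulrDr.
apply: ler_wpM2l; first exact: powR_ge0.
have cjd : contf (jacc d a b) by exact: cont_jacc.
have cr i : contf (fun x => ramp (`|jacc d a b x * psum i k x| / S)).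
  by apply: cont_ramp; have ci := cont_psum i k ck; cont.
have cr1 := cr n.+1; have cr2 := cr n.
have crv : contf (fun x => ramp (16 * `|vn n.+1 x|)) by apply: cont_ramp; have cv := cont_vn n.+1; cont.
apply: (@le_trans _ _ (w0 * Ipi (fun x => tri eta x * ramp (16 * `|vn n.+1 x|)))).
  by apply: ler_wpM2l; [exact: ltW|exact: mass].
rewrite -IpiZ; last by cont. rewrite -IpiD; [|by cont|by cont].
apply: le_Ipi; [by cont|by cont|] => x _.
have [->|tx] := eqVneq (tri eta x) 0; first by rewrite !mul0r mulr0 addr0.
have xs := tri_supp _ _ eta0 tx.
have xpi := tpi x tx.
have bound : 16 * `|vn n.+1 x| <= `|jacc d a b x * psum n.+1 k x - jacc d a b x * psum n k x| / (4 * S).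
  rewrite ler_pdivlMr; last exact: mulr_gt0.
  rewrite -mulrBr psumS// Ecn jaccE; last exact: st.
  have -> : jac a b x * ((P n.+1).[cos x] * cn) = jac (a - s / 2) (b - t / 2) x * (vn n.+1 x * cn).
    have -> : jac a b x = jac (a - s / 2) (b - t / 2) x * hw x by rewrite -jacD//; congr jac; ring.
    rewrite /vn; ring.
  rewrite (normrM (jac _ _ _)) (normrM (vn n.+1 x) cn) (gtr0_norm cn0) (ger0_norm (jac_ge0 _ _ _)).
  have -> : 16 * `|vn n.+1 x| * (4 * S) = m * (`|vn n.+1 x| * cn) by rewrite -ES; field.
  by apply: ler_wpM2r; [rewrite mulr_ge0// ltW|exact: hm].
have r := le_trans (ramp_mono _ _ bound) (ramp_sub _ _ S S0).
move: (ramp_ge0 (16 * `|vn n.+1 x|)) r (tri_ge0 eta x) (hw0 x xs).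
move: (ramp (16 * `|vn n.+1 x|)) (ramp (`|jacc d a b x * psum n.+1 k x| / S)) (ramp (`|jacc d a b x * psum n k x| / S)) (tri eta x) (jac s t x).
move=> r0 r1 r2 T j r00 r012 T0 wj.
have -> : w0 * (T * r0) = T * (r0 * w0) by ring.
have -> : T * r1 * j + T * r2 * j = T * ((r1 + r2) * j) by ring.
by apply: ler_wpM2l => //; apply: ler_pM => //; exact: ltW.
Qed.

Lemma weak_type_upper : exists2 A, 0 < A & forall e, 0 < e <= 8^-1 ->
  let L := mass e (q * (- a - s / 2) + s) (q * (- b - t / 2) + t) in A * L `^ p <= (2 * C) * L.
Proof.
(* The image is tested on the fixed interval [1/2, 1], contained in [e, pi - e] for every admissible
   e; hence A does not depend on e. *)
have [eta [eta0 eta1 eta8]] : exists eta : R, [/\ 0 < eta, 4 * eta <= 1 & 8^-1 <= 2 * eta].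
  by exists (4^-1); split; [rewrite invr_gt0|rewrite divff|lra].
have I0 : 0 < Ipi (tri eta).
  apply: lt_le_trans (Ipi_tri eta eta0 _); first exact: divr_gt0.
  by apply: le_trans eta1 _; have := @pi_ge2 R; lra.
have [m m0 hm] := jac_lower_ex R eta (a - s / 2) (b - t / 2) eta0 eta1.
have [w0 w00 hw0] := jac_lower_ex R eta s t eta0 eta1.
exists ((m / 8 / 64) `^ p * (w0 * (Ipi (tri eta) / 4))).
  by rewrite mulr_gt0 ?powR_gt0 ?divr_gt0 ?mulr_gt0.
move=> e ee /=; case/andP: (ee) => e0 e8.
set X := - a - s / 2; set Y := - b - t / 2.
have L0 := mass_gt0 e (q * X + s) (q * Y + t) ee; set L := mass _ _ _ in L0 *.
(* Here u^-1 * omega^(1/2) = K * omega, so the paired density u^-1 * K^(q-1) * omega^(1/2) is K^q *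
   omega. *)
have EL : Ipi (window e (s / 2 - a + (q - 1) * X) (t / 2 - b + (q - 1) * Y)) = L.
  have aux (s' a' q' : R) : s' / 2 - a' + (q' - 1) * (- a' - s' / 2) = q' * (- a' - s' / 2) + s' by field.
  by rewrite /L /mass /X /Y !aux.
have lim := pairing_cos _ (cont_window e (s / 2 - a + (q - 1) * X) (t / 2 - b + (q - 1) * Y) ee); rewrite EL in lim.
(* The limit sqrt (2 / pi) / 2 * L is at least L / 4. *)
have [|N1 HN1] := near_ge _ _ (L / 8) lim.
  by have := sqrt_2pi; move: (Num.sqrt _) L L0 {EL lim} => z l l0 z0; nra.
have [|N2 HN2] := vn_gn_small (Ipi (tri eta) / 128); first by rewrite divr_gt0.
have [N3 HN3] := ramp_mass_ex (tri eta) (cont_tri eta) (tri_ge0 eta) I0.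
have [n [l1 l2 l3]] := common_index N1 N2 N3.
have ccos := cont_cosph n.+1.
have cos1 x : `|cos (ph n.+1 x)| <= 1 := cos_max _.
have ck := cont_testf e X Y _ ee ccos.
have := pcoef_testf e X Y (fun x => cos (ph n.+1 x)) ee n.+1.
have := HN1 _ l1; move=> cL Ec; rewrite -Ec in cL.
have cn0 := lt_le_trans (divr_gt0 L0 (ltr0Sn _ 7)) cL.
have ep : 0 < e < pi / 2 by rewrite e0/=; apply: le_lt_trans e8 _; have := @pi_ge2 R; lra.
have kd x (h : testf e X Y (fun x => cos (ph n.+1 x)) x != 0) : e <= x <= pi - e.
  by case: (supp_in e e x _ e8 (testf_supp e X Y _ ee x h)) => //; rewrite e0 lexx.
have mass1 : Ipi (tri eta) / 4 <= Ipi (fun x => tri eta x * ramp (16 * `|vn n.+1 x|)).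
  apply: (HN3 n.+1 _ l3 (cont_vn n.+1)); apply: le_trans (HN2 n.+1 l2).
  have cv := cont_vn n.+1; have cg := cont_gn n.+1; have ct := cont_tri eta.
  apply: le_Ipi; [by cont|by cont|] => x _.
  by rewrite -[leRHS]mul1r; apply: ler_wpM2r; [exact: sqr_ge0|exact: tri_le1].
have := increment_test e eta n _ m w0 ep (le_trans e8 eta8) eta1 ck kd m0 w00 cn0 hm hw0 mass1.
have T : Ipi (fun x => (jacc e a b x * `|testf e X Y (fun x => cos (ph n.+1 x)) x|) `^ p * jac s t x) <= L.
  by apply: Ipi_testf => //; rewrite e0 lexx.
move=> H; have {}H := le_trans H (ler_wpM2l (ler0n _ 2) (ler_wpM2l C0 T)); rewrite -(mulrA 2 C L).
apply: le_trans H; rewrite mulrAC; apply: ler_wpM2r.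
  exact: mulr_ge0 (ltW w00) (divr_ge0 (ltW I0) (ler0n _ _)).
have m8 : 0 <= m / 8 / 64 := divr_ge0 (divr_ge0 (ltW m0) (ler0n _ _)) (ler0n _ _).
rewrite -(powRM _ m8 (ltW L0)); apply: (ge0_ler_powR (ltW p0)).
- by rewrite nnegrE; exact: mulr_ge0 m8 (ltW L0).
- by rewrite nnegrE; exact: divr_ge0 (mulr_ge0 (ltW m0) (ltW cn0)) (ler0n _ _).
have -> : m / 8 / 64 * L = m * (L / 8) / 64 by move: L {EL L0 lim HN1 T cL cn0} => l; field.
by apply: ler_wpM2r; [rewrite invr_ge0 ler0n|apply: ler_wpM2l; [exact: ltW|exact: cL]].
Qed.

(** The test for a single partial sum, whose modulus is a known multiple of |h|. The dependence on
    eta is kept explicit, since eta will tend to 0. *)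
Lemma amplitude_test eta n k h (amp m w0 : R) : 0 < eta -> 4 * eta <= 1 -> contf k -> contf h ->
  (forall x, k x != 0 -> 2 * eta <= x <= pi - 2 * eta) ->
  (forall x, 2 * eta <= x <= 4 * eta -> `|hw x * psum n k x| = amp * `|h x|) ->
  0 < amp -> 0 < m -> 0 < w0 ->
  (forall x, 2 * eta <= x <= 4 * eta -> m <= jac (a - s / 2) (b - t / 2) x) ->
  (forall x, 2 * eta <= x <= 4 * eta -> w0 <= jac s t x) ->
  Ipi (tri eta) / 4 <= Ipi (fun x => tri eta x * ramp (16 * `|h x|)) ->
  (m * amp / 16) `^ p * (w0 * (eta / 8)) <=
    C * Ipi (fun x => (jacc (2 * eta) a b x * `|k x|) `^ p * jac s t x).
Proof.
move=> eta0 eta1 ck ch sk hF amp0 m0 w00 hm hw0 mass.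
have p2 := @pi_ge2 R.
have S0 : 0 < m * amp / 16 by rewrite divr_gt0// mulr_gt0.
have d0 : 0 < 2 * eta by rewrite mulr_gt0.
have d1 : 2 * eta < pi / 2 by lra.
have ct := cont_tri eta.
have st x : tri eta x != 0 -> 2 * eta <= x <= pi - 2 * eta.
  by move=> /(tri_supp _ _ eta0)/andP[h1 h2]; rewrite h1/=; lra.
have t01 x : 0 <= tri eta x <= 1 by rewrite tri_ge0 tri_le1.
apply: le_trans (wt (2 * eta) n k (tri eta) _ d0 d1 ck ct sk st t01 S0).
apply: ler_wpM2l; first exact: powR_ge0.
have I0 : eta / 8 <= Ipi (tri eta) / 4.
  have ep : 4 * eta <= pi by lra.
  by have := Ipi_tri eta eta0 ep; lra.
apply: (@le_trans _ _ (w0 * Ipi (fun x => tri eta x * ramp (16 * `|h x|)))).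
  by apply: ler_wpM2l; [exact: ltW|exact: le_trans I0 mass].
have cr : contf (fun x => ramp (16 * `|h x|)) by apply: cont_ramp; cont.
have cr2 : contf (fun x => ramp (`|jacc (2 * eta) a b x * psum n k x| / (m * amp / 16))).
  have cf := cont_psum n k ck; have cjd := cont_jacc (2 * eta) a b d0 d1.
  by apply: cont_ramp; cont.
rewrite -IpiZ; last by cont. apply: le_Ipi; [by cont|by cont|] => x _.
have [->|tx] := eqVneq (tri eta x) 0; first by rewrite !mul0r mulr0.
have xs := tri_supp _ _ eta0 tx.
have xpi : 0 < x < pi by case/andP: xs => h1 h2; apply/andP; split; lra.
have bound : 16 * `|h x| <= `|jacc (2 * eta) a b x * psum n k x| / (m * amp / 16).
  rewrite ler_pdivlMr// jaccE; last exact: st.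
  have -> : jac a b x * psum n k x = jac (a - s / 2) (b - t / 2) x * (hw x * psum n k x).
    by rewrite mulrA -jacD//; congr (jac _ _ _ * _); ring.
  rewrite (normrM (jac _ _ _)) hF// (ger0_norm (jac_ge0 _ _ _)).
  have -> : 16 * `|h x| * (m * amp / 16) = m * (amp * `|h x|) by field.
  by apply: ler_wpM2r; [rewrite mulr_ge0// ltW|exact: hm].
have := ramp_mono _ _ bound; have := ramp_ge0 (16 * `|h x|); have := hw0 x xs; have := tri_ge0 eta x.
move: (tri eta x) (ramp (16 * `|h x|)) (ramp (`|_| / _)) (jac s t x) => T r1 r2 j T0 wj r10 r12.
have -> : w0 * (T * r1) = T * (r1 * w0) by ring.
rewrite -mulrA; apply: ler_wpM2l => //; apply: ler_pM => //; exact: ltW.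
Qed.

(** The shifts by 1/2 come from sin / (1 - cos), which is [jac (- 2^-1) 2^-1]. Below, u1 and v1 are
    the exponents of u^-1 * K^(q-1) * omega^(1/2) / (1 - cos), the density in the
    Christoffel-Darboux coefficients. *)
Let X : R := - a - s / 2 - 2^-1.
Let Y : R := - b - t / 2 + 2^-1.
Let u1 : R := s / 2 + (- a + (q - 1) * X) - 1.
Let v1 : R := t / 2 + (- b + (q - 1) * Y).
Local Notation L e := (mass e (q * X + s) (q * Y + t)).
Local Notation kn e n := (testf e X Y (fun x => sin (ph n x))).

Lemma divk_kn e n : 0 < e <= 8^-1 -> divk e (kn e n) =
  fun x => window e (- a + (q - 1) * X - 1) (- b + (q - 1) * Y) x * sin (ph n x).
Proof.
move=> ee; apply/funext => x; rewrite /divk /testf mulrAC windowMc// addr0 -/q.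
by [].
Qed.

Lemma pcoef_divk e m n : 0 < e <= 8^-1 ->
  pcoef m (divk e (kn e n)) = Ipi (fun x => vn m x * (window e u1 v1 x * sin (ph n x))).
Proof.
move=> ee; rewrite divk_kn//; apply: eq_Ipi => x _; rewrite -hw2 /vn.
have -> : window e u1 v1 x = window e (- a + (q - 1) * X - 1) (- b + (q - 1) * Y) x * hw x.
  by rewrite windowM//; congr window; rewrite /u1 /v1; ring.
ring.
Qed.

(** This identity dictates the factor sin / (1 - cos) in K: the sine is produced by the phase shift
    between indices n and n + 1, the denominator by [divk], and K must contain both for the product
    to be K^q * omega. *)
Lemma window_sin_mass e : 0 < e <= 8^-1 -> Ipi (fun x => window e u1 v1 x * sin x) = L e.
Proof.
move=> ee; apply: eq_Ipi => x _; rewrite window_sin//.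
have aux1 (s' a' q' : R) : s' / 2 + (- a' + (q' - 1) * (- a' - s' / 2 - 2^-1)) - 1 + 2^-1 = q' * (- a' - s' / 2 - 2^-1) + s' by field.
have aux2 (s' a' q' : R) : s' / 2 + (- a' + (q' - 1) * (- a' - s' / 2 + 2^-1)) + 2^-1 = q' * (- a' - s' / 2 + 2^-1) + s' by field.
by rewrite /u1 /v1 /X /Y aux1 aux2.
Qed.

(** All asymptotic statements are collected at one index, after e, eta and kap have been fixed. *)
Lemma good_index e eta (kap : R) : 0 < e <= 8^-1 -> 0 < eta -> 4 * eta <= 1 -> 0 < kap ->
  exists n, [/\ L e / 8 <= - pcoef n.+1 (divk e (kn e n)), `|pcoef n (divk e (kn e n))| <= kap,
    Ipi (fun x => (vn n x - gn n x) ^+ 2) <= eta / 32 / 32, 4^-1 <= rho n &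
    forall h, contf h -> Ipi (fun x => tri eta x * (h x - gn n x) ^+ 2) <= Ipi (tri eta) / 128 ->
      Ipi (tri eta) / 4 <= Ipi (fun x => tri eta x * ramp (16 * `|h x|))].
Proof.
move=> ee eta0 eta1 kap0; have cW := cont_window e u1 v1 ee.
have L0 : 0 < L e by exact: mass_gt0.
have := pairing_sin_succ _ cW; rewrite window_sin_mass// => /cvgN; rewrite opprK => lB.
have [|N1 H1] := near_ge _ _ (L e / 8) lB.
  by have := sqrt_2pi; move: (Num.sqrt _) (L e) L0 => z l l0 z0; nra.
have lA := pairing_sin _ cW.
have /cvgrPdist_le /(_ _ kap0) [N2 _ H2] := lA.
have [|N3 H3] := vn_gn_small (eta / 32 / 32); first by rewrite !divr_gt0.
have [N4 _ H4] := rho_bounds.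
have p2 := @pi_ge2 R.
have I0 : 0 < Ipi (tri eta) by apply: lt_le_trans (Ipi_tri eta eta0 _); [rewrite divr_gt0|lra].
have [N5 H5] := ramp_mass_ex (tri eta) (cont_tri eta) (tri_ge0 eta) I0.
have [n [n1 n2 n3 [n4 n5]]] := common_index4 N1 N2 N3 N4 N5.
exists n; split.
- by rewrite pcoef_divk//; exact: (H1 n n1).
- by rewrite pcoef_divk//; have := H2 n n2; rewrite sub0r normrN.
- exact: H3.
- by case/andP: (H4 n n4).
- by move=> h ch; exact: H5.
Qed.

Lemma weak_type_lower_at e eta (Z : R) : 0 < e <= 8^-1 -> 0 < eta <= 1 -> 128 * eta ^+ 2 <= e ^+ 2 ->
  Z = 1 + Ipi (fun y => (window e (- a + (q - 1) * X - 1) (- b + (q - 1) * Y) y * hw y) ^+ 2) ->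
  (64 * (16 * (128 * eta ^+ 2 / e ^+ 2 * Z) / L e)) ^+ 2 <= eta ->
  ((eta ^+ 2) `^ (a - s / 2) * jacmin (a - s / 2) (b - t / 2) * (L e / 32 / 16)) `^ p *
    ((eta ^+ 2) `^ s * jacmin s t * (eta / 8)) <= C * L e.
Proof.
move=> ee eta01 etae EZ Hr; case/andP: (eta01) => eta0 eta1; case/andP: (ee) => e0 e8.
have L0 : 0 < L e by exact: mass_gt0.
have Z1 : 1 <= Z by rewrite EZ lerDl; apply: Ipi_ge0 => x _; exact: sqr_ge0.
have Z0 : 0 < Z := lt_le_trans ltr01 Z1.
have e20 : 0 < e ^+ 2 by rewrite exprn_gt0.
have eta20 : 0 < eta ^+ 2 by rewrite exprn_gt0.
have etale : 2 * eta <= e.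
  rewrite -(ler_pXn2r (n := 2)) ?nnegrE ?mulr_ge0 ?(ltW eta0) ?(ltW e0)//.
  by rewrite exprMn; apply: le_trans etae; rewrite -natrX; apply: ler_wpM2r; [exact: ltW|rewrite ler_nat].
have eta4 : 4 * eta <= 1 by lra.
pose kap := 128 * eta ^+ 2 / e ^+ 2 * Z.
have kap0 : 0 < kap by rewrite mulr_gt0// divr_gt0// mulr_gt0.
have [n [hB hA ho hr hmass]] := good_index e eta kap ee eta0 eta4 kap0.
set k := kn e n in hB hA.
have csin := cont_sinph n.
have sin1 x : `|sin (ph n x)| <= 1 := sin_max _.
have ck : contf k by exact: cont_testf.
have sk x : k x != 0 -> e <= x <= 1 by exact: (testf_supp e X Y _ ee x).
pose k0 := window e (- a + (q - 1) * X - 1) (- b + (q - 1) * Y).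
have ck0 : contf k0 by exact: cont_window.
have kk0 y : `|divk e k y| <= k0 y.
  rewrite /k divk_kn// normrM (ger0_norm (window_ge0 _ _ _ _)) -[leRHS]mulr1.
  by apply: ler_wpM2l; [exact: window_ge0|].
set B := pcoef n.+1 (divk e k) in hB.
have B0 : B < 0 by rewrite -oppr_gt0; apply: lt_le_trans hB; rewrite divr_gt0.
have Bn : B != 0 by rewrite lt_eqF.
have r0 : 0 < rho n := rho_gt0 n.
(* r * (L / 8) = 2 kap covers the two error terms of [psum_near] together. *)
pose r := 16 * kap / L e.
have rr0 : 0 <= r by rewrite divr_ge0 ?(ltW L0)// mulr_ge0// ltW.
have rB : `|pcoef n (divk e k)| + 128 * eta ^+ 2 / e ^+ 2 * (1 + Ipi (fun y => (k0 y * hw y) ^+ 2)) <= r * `|B|.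
  rewrite -EZ -/kap; apply: (@le_trans _ _ (kap + kap)); first by rewrite lerD2r.
  apply: (@le_trans _ _ (r * (L e / 8))); last by rewrite (ltr0_norm B0); apply: ler_wpM2l.
  rewrite le_eqVlt; apply/orP; left; apply/eqP; exact: half_scale.
have prof := near_profile e k k0 n eta r ee ck ck0 sk kk0 eta01 etae Bn rB Hr ho.
have amp0 : 0 < rho n * `|B| by rewrite mulr_gt0// normr_gt0.
have ch : contf (fun x => - (hw x * psum n k x) / (rho n * B)).
  by have cf := cont_psum n k ck;  cont.
have mm := hmass _ ch prof.
have sk2 x : k x != 0 -> 2 * eta <= x <= pi - 2 * eta.
  by move=> /sk hx; case: (supp_in (2 * eta) e x _ e8 hx) => //; rewrite etale mulr_gt0.
have hF x : 2 * eta <= x <= 4 * eta -> `|hw x * psum n k x| = rho n * `|B| * `|- (hw x * psum n k x) / (rho n * B)|.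
  move=> _; move: (hw x * psum n k x) => z; rewrite (normrM (- z)) normrN normfV (normrM (rho n)) (gtr0_norm r0).
  by rewrite mulrC divfK// gt_eqF.
have m0 : 0 < (eta ^+ 2) `^ (a - s / 2) * jacmin (a - s / 2) (b - t / 2) by rewrite mulr_gt0 ?powR_gt0 ?jacmin_gt0.
have w00 : 0 < (eta ^+ 2) `^ s * jacmin s t by rewrite mulr_gt0 ?powR_gt0 ?jacmin_gt0.
have := amplitude_test eta n k _ (rho n * `|B|) _ _ eta0 eta4 ck ch sk2 hF amp0 m0 w00
   (fun x => jac_lower _ _ _ x eta0 eta4) (fun x => jac_lower _ _ _ x eta0 eta4) mm.
have T : Ipi (fun x => (jacc (2 * eta) a b x * `|k x|) `^ p * jac s t x) <= L e.
  by apply: Ipi_testf => //; rewrite etale mulr_gt0.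
move=> H; apply: le_trans (le_trans H (ler_wpM2l C0 T)).
apply: ler_wpM2r; first exact: mulr_ge0 (ltW w00) (divr_ge0 (ltW eta0) (ler0n _ _)).
have amp : L e / 32 <= rho n * `|B|.
  rewrite (ltr0_norm B0); have -> : L e / 32 = 4^-1 * (L e / 8) by field.
  by apply: ler_pM => //; rewrite ?invr_ge0 ?divr_ge0 ?(ltW L0).
set m := (_ `^ _ * _) in m0 *.
have -> : m * (L e / 32 / 16) = m * (L e / 32) / 16 by field.
apply: (ge0_ler_powR (ltW p0)).
- by rewrite nnegrE; exact: divr_ge0 (mulr_ge0 (ltW m0) (divr_ge0 (ltW L0) (ler0n _ _))) (ler0n _ _).
- by rewrite nnegrE; exact: divr_ge0 (mulr_ge0 (ltW m0) (ltW amp0)) (ler0n _ _).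
by apply: ler_wpM2r; [rewrite invr_ge0|apply: ler_wpM2l; [exact: ltW|]].
Qed.

(** At angles of size eta, 1 - cos is of size eta^2: (a - s / 2) p comes from u^p * omega^(-p/2), s
    from omega, and 1/2 from the length of the interval. Only the threshold eta0 depends on e, not
    A. *)
Lemma weak_type_lower : exists2 A, 0 < A & forall e, 0 < e <= 8^-1 -> exists2 eta0, 0 < eta0 <= 1 &
  forall eta, 0 < eta <= eta0 -> A * (eta ^+ 2) `^ ((a - s / 2) * p + s + 2^-1) * L e `^ p <= C * L e.
Proof.
have j1 := jacmin_gt0 (a - s / 2) (b - t / 2); have j2 := jacmin_gt0 s t.
exists ((jacmin (a - s / 2) (b - t / 2) / 32 / 16) `^ p * (jacmin s t / 8)).
  by rewrite mulr_gt0 ?powR_gt0 ?divr_gt0 ?ltr0n.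
move=> e ee; case/andP: (ee) => e0 e8; have L0 : 0 < L e by exact: mass_gt0.
pose Z := 1 + Ipi (fun y => (window e (- a + (q - 1) * X - 1) (- b + (q - 1) * Y) y * hw y) ^+ 2).
pose G := 64 * (16 * (128 * Z / e ^+ 2) / L e).
have G1 : 0 < G ^+ 2 + 1 by rewrite ltr_wpDl ?sqr_ge0.
(* eta <= e / 12 gives 128 eta^2 <= e^2, and eta (G^2 + 1) <= 1 gives (eta^2 G)^2 <= eta. *)
exists (Num.min (e / 12) ((G ^+ 2 + 1))^-1).
  rewrite lt_min divr_gt0//= invr_gt0 G1/= ge_min; apply/orP; left; lra.
move=> eta /andP[eta0]; rewrite le_min => /andP[h1 h2].
have eta01 : 0 < eta <= 1 by rewrite eta0/=; lra.
have etae : 128 * eta ^+ 2 <= e ^+ 2.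
  have -> : e ^+ 2 = 144 * (e / 12) ^+ 2 by field.
  apply: ler_pM; rewrite ?sqr_ge0 ?ler_nat// ler_pXn2r ?nnegrE ?divr_ge0 ?(ltW eta0) ?(ltW e0)//.
have Hr : (64 * (16 * (128 * eta ^+ 2 / e ^+ 2 * Z) / L e)) ^+ 2 <= eta.
  have -> : 64 * (16 * (128 * eta ^+ 2 / e ^+ 2 * Z) / L e) = eta ^+ 2 * G.
    exact: scale_out.
  have h3 : eta * (G ^+ 2 + 1) <= 1 by rewrite -ler_pdivlMr// div1r.
  have h4 : eta ^+ 3 <= eta by rewrite exprS -[leRHS]mulr1; apply: ler_wpM2l; [exact: ltW|rewrite expr_le1 ?(ltW eta0)//; case/andP: eta01].
  have h5 : 0 <= G ^+ 2 by exact: sqr_ge0.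
  have -> : (eta ^+ 2 * G) ^+ 2 = eta ^+ 3 * (eta * G ^+ 2) by ring.
  rewrite -[leRHS]mulr1; apply: ler_pM => //.
  - by rewrite exprn_ge0// ltW.
  - by rewrite mulr_ge0 ?(ltW eta0).
  - by apply: le_trans h3; apply: ler_wpM2l; [exact: ltW|rewrite lerDl].
have := weak_type_lower_at e eta Z ee eta01 etae erefl Hr; apply: le_trans.
have eta20 : 0 < eta ^+ 2 by rewrite exprn_gt0.
have en : eta ^+ 2 != 0 by rewrite gt_eqF.
rewrite (powRD (r := (a - s / 2) * p + s)) ?en ?implybT// (powRD (r := (a - s / 2) * p)) ?en ?implybT// powR12_sqrt ?(ltW eta20)// sqrtr_sqr (gtr0_norm eta0).
rewrite (powRrM _ (a - s / 2)); set x := (eta ^+ 2) `^ (a - s / 2); set y := _ `^ s.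
set J1 := jacmin _ _ in j1 *; set J2 := jacmin _ _ in j2 *; move: (L e) L0 => l l0.
have x0 : 0 <= x := powR_ge0 _ _.
have -> : x * J1 * (l / 32 / 16) = x * (J1 / 32 / 16) * l by field.
have j0 : 0 <= J1 / 32 / 16 := divr_ge0 (divr_ge0 (ltW j1) (ler0n _ _)) (ler0n _ _).
rewrite (powRM _ (mulr_ge0 x0 j0) (ltW l0)) (powRM _ x0 j0).
by rewrite le_eqVlt; apply/orP; left; apply/eqP; field.
Qed.

(** Failure of the upper bound means q (- a - s / 2) + s <= -1/2, and failure of the lower bound
    means D <= 0. The value -1/2 is the power of 1 - cos x, of size x^2, whose integral near 0 is
    logarithmic. *)
Theorem weak_type_range : `|a + (s + 2^-1) * (p^-1 - 2^-1)| < 4^-1.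
Proof.
have pi0 : p != 0 by rewrite gt_eqF.
have pm : 0 < p - 1 by rewrite subr_gt0.
have qE : q * (1 - p^-1) = 1 by rewrite /q; field; rewrite pi0 gt_eqF.
have q0 : 0 < q by rewrite divr_gt0.
have qz (z : R) : s + 2^-1 - (s + 2^-1) / p <= z -> q * (- z) + s <= - 2^-1.
  move=> hz; have := ler_wpM2l (ltW q0) hz.
  have -> : q * (s + 2^-1 - (s + 2^-1) / p) = s + 2^-1 by rewrite -[RHS]mulr1 -qE; ring.
  by rewrite mulrN; lra.
rewrite ltr_norml; apply/andP; split; rewrite ltNge; apply/negP => H; last first.
  have [A A0 HA] := weak_type_upper.
  apply: (mass_contra A (2 * C) p _ _ A0 p1 _ HA).
  have -> : - a - s / 2 = - (a + s / 2) by ring.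
  by apply: qz; move: H; move: (p^-1) => v; lra.
have [A A0 HA] := weak_type_lower.
pose D := a - s / 2 + (s + 2^-1) / p.
have D0 : D <= 0 by rewrite /D; move: H; move: (p^-1) => v; lra.
have ED : (a - s / 2) * p + s + 2^-1 = D * p by rewrite /D; field.
rewrite ED in HA.
have : D != 0.
  (* At D = 0 the power of eta disappears and X produces exactly the exponent -1/2, so [mass] is
     unbounded as e tends to 0. *)
  apply/eqP => D00; apply: (mass_contra A C p (q * X + s) (q * Y + t) A0 p1) => [|e ee].
    have -> : X = - (a + s / 2 + 2^-1) by rewrite /X; ring.
    by apply: qz; move: D00; rewrite /D; move: (p^-1) => v; lra.
  have [eta0 /andP[h1 h2] H'] := HA e ee.
  have := H' eta0; rewrite h1 lexx D00 mul0r powRr0 mulr1; exact.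
move=> Dn; have Dp : D * p < 0 by rewrite pmulr_llt0// lt_neqAle Dn.
(* For D < 0 one fixed e suffices: the power of eta is unbounded as eta tends to 0. *)
have ee : 0 < (8^-1 : R) <= 8^-1 by rewrite invr_gt0 ltr0n lexx.
have [eta0 /andP[h1 h2] H'] := HA _ ee.
have L0 : 0 < L 8^-1 by exact: mass_gt0.
move: (L 8^-1) L0 H' => l l0 H'.
have lp : 0 < l `^ p by exact: powR_gt0.
(* With this N, A * N * l^p exceeds C * l by A * l^p. *)
pose N := C * l / (A * l `^ p) + 1.
have N0 : 0 < N by rewrite ltr_wpDl// divr_ge0 ?mulr_ge0 ?(ltW l0) ?(ltW A0) ?(ltW lp).
pose z := N `^ (D * p)^-1; have z0 : 0 < z by exact: powR_gt0.
pose eta := Num.min eta0 (Num.sqrt z).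
have et0 : 0 < eta by rewrite lt_min h1 sqrtr_gt0.
have := H' eta; rewrite et0 ge_min lexx => /(_ isT).
have etz : eta ^+ 2 <= z.
  rewrite -[leRHS]sqr_sqrtr ?(ltW z0)// ler_pXn2r ?nnegrE ?sqrtr_ge0 ?(ltW et0)//.
  by rewrite ge_min lexx orbT.
have big : N <= (eta ^+ 2) `^ (D * p).
  have -> : D * p = - (- (D * p)) by rewrite opprK.
  rewrite powRN -[leLHS]invrK lef_pV2 ?posrE ?invr_gt0 ?powR_gt0 ?exprn_gt0//.
  have -> : N^-1 = z `^ (- (D * p)).
    by rewrite powRN /z -powRrM mulVf ?lt_eqF// powRr1// ltW.
  by apply: ge0_ler_powR; rewrite ?oppr_ge0 ?(ltW Dp) ?nnegrE ?(ltW z0) ?sqr_ge0.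
move=> H3; have : A * N * l `^ p <= C * l.
  by apply: le_trans H3; rewrite ler_pM2r// ler_pM2l.
have -> : A * N * l `^ p = C * l + A * l `^ p.
  by rewrite /N; field; rewrite !gt_eqF.
by rewrite gerDl leNgt mulr_gt0.
Qed.
End JacobiPolynomials.

(** * From the measure to the angular variable *)

Section ChangeOfVariables.
Context {R : realType}.
Implicit Types (x sg : R) (H g : R -> R).
Local Notation mu := (@lebesgue_measure R).

(* The function [g] on (-1, 1) such that [g (sg * cos th) * sin th = H th]. *)
Definition pull sg H x : R :=
  if (-1 < x) && (x < 1) then H (acos (sg * x)) / sin (acos (sg * x)) else 0.

Definition is_sign sg : Prop := sg = 1 \/ sg = -1.

Lemma sign_mul sg : is_sign sg -> sg * sg = 1.
Proof. by case=> ->; rewrite ?mulN1r ?opprK ?mulr1. Qed.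

Lemma sign_interior sg x : is_sign sg -> (-1 < sg * x < 1) = (-1 < x < 1).
Proof. by case=> ->; rewrite ?mul1r// mulN1r ltrNl opprK ltrNl andbC. Qed.

Lemma cos_interior th : 0 < th < pi -> -1 < (cos th : R) < 1.
Proof. by move=> /cos_lt1[h1 h2]; apply/andP; split; lra. Qed.

Lemma acos_interior x : -1 < x < 1 -> 0 < acos x < pi.
Proof.
move=> /andP[h1 h2]; apply/andP; split; first by apply: acos_gt0; rewrite h2 ltW.
by apply: acos_ltpi; rewrite h1 ltW.
Qed.

Lemma pull_cos sg H th : is_sign sg -> 0 < th < pi -> pull sg H (sg * cos th) = H th / sin th.
Proof.
move=> hs h; rewrite /pull sign_interior// (cos_interior th h) mulrA sign_mul// mul1r.
by rewrite cosK// in_itv/=; case/andP: h => h1 h2; rewrite !ltW.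
Qed.

Lemma pull_continuous sg H x : is_sign sg -> contf H -> -1 < x < 1 -> {for x, continuous (pull sg H)}.
Proof.
move=> hs cH hx.
have hsx : -1 < sg * x < 1 by rewrite sign_interior.
have sa : 0 < sin (acos (sg * x)) by apply: sin_gt0_pi; exact: acos_interior.
have ca : {for x, continuous (fun x => acos (sg * x))}.
  apply: continuous_comp; [exact: cont_mull|exact: continuous_acos].
have cl : {for x, continuous (fun x => H (acos (sg * x)) / sin (acos (sg * x)))}.
  apply: continuousM.
    by apply: (continuous_comp ca); exact: cH.
  apply: continuousV; first by rewrite gt_eqF.
  by apply: (continuous_comp ca); exact: continuous_sin.
rewrite /continuous_at /prop_for/= {2}/pull hx; apply: cvg_trans cl; apply: near_eq_cvg.
have : x \in `]-1, 1[ by rewrite in_itv/=.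
move/near_in_itvoo; apply: filterS => y; rewrite in_itv/= => hy.
by rewrite /pull hy.
Qed.

Lemma pull_measurable sg H : is_sign sg -> contf H -> measurable_fun setT (pull sg H).
Proof.
move=> hs cH.
have -> : pull sg H = (pull sg H) \_ `]-1, 1[.
  apply/funext => x; rewrite patchE; case: ifPn => //.
  by rewrite notin_setE/= in_itv/= /pull => h; case: ifP.
apply/(measurable_restrictT (pull sg H)) => //.
apply: open_continuous_measurable_fun; first exact: interval_open.
by move=> x; rewrite inE/= in_itv/= => hx; exact: pull_continuous.
Qed.

Lemma substitution_decreasing (F f G : R -> R) (a b : R) : a <= b ->
  {in `[a, b] &, {homo F : x y /~ x < y}} -> (forall x, is_derive x 1 F (f x)) -> contf f ->
  {within `[F b, F a], continuous G} ->
  (\int[mu]_(x in `[F b, F a]) (G x)%:E = \int[mu]_(x in `[a, b]) (G (F x) * - f x)%:E)%E.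
Proof.
move=> ab dF dFf cf cG.
have E : F^`()%classic = f by apply/funext => x; rewrite derive1E derive_val.
have cF : continuous F.
  by move=> x; apply: differentiable_continuous; apply/derivable1_diffP; case: (dFf x).
rewrite (integration_by_substitution_decreasing ab dF)//; rewrite ?E.
- by [].
- by move=> x _; exact: cf.
- by apply/cvg_ex; exists (f a); apply: cvg_at_right_filter; exact: cf.
- by apply/cvg_ex; exists (f b); apply: cvg_at_left_filter; exact: cf.
split.
- by move=> x _; case: (dFf x).
- by apply: cvg_at_right_filter; exact: cF.
- by apply: cvg_at_left_filter; exact: cF.
Qed.

Lemma Ipi_refl H : contf H -> Ipi (fun x => H (pi - x)) = Ipi H.
Proof.
move=> cH; rewrite /Ipi /Rintegral; congr fine.
have /esym : (\int[mu]_(x in `[(pi - pi)%R, (pi - 0)%R]) (H x)%:E = \int[mu]_(x in `[0%R, pi]) (H (pi - x) * - (-1))%:E)%E.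
  apply: (substitution_decreasing (fun x => pi - x) (fun=> -1)).
  - exact: pi_ge0.
  - by move=> x y _ _ xy; rewrite ltrD2l ltrN2.
  - by move=> x; rewrite -[X in is_derive _ _ _ X](sub0r 1); apply: is_deriveB.
  - exact: cont_cst.
  - by apply: continuous_subspaceT; exact: cH.
rewrite subrr subr0; apply: etrans.
by apply: eq_integral => x _; rewrite opprK mulr1.
Qed.

(** Because of the division by sin, [pull 1 H] need not be bounded near the endpoints. The
    substitution is made on these compact intervals, which exhaust (-1, 1), and monotone convergence
    does the rest. *)
Definition cos_itv (n : nat) : set R := `[cos (pi - n.+1%:R^-1), cos (n.+1%:R^-1)].
Definition ang_itv (n : nat) : set R := `[n.+1%:R^-1, pi - n.+1%:R^-1].

Lemma inv_small n : 0 < (n.+1%:R^-1 : R) <= 1.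
Proof. by rewrite invr_gt0 ltr0n/= invf_le1 ?ltr0n// ler1n. Qed.

Lemma integral_pull_compact H n : contf H ->
  (\int[mu]_(x in cos_itv n) (pull 1 H x)%:E = \int[mu]_(x in ang_itv n) (H x)%:E)%E.
Proof.
move=> cH; have /andP[e0 e1] := inv_small n; rewrite /cos_itv /ang_itv; move: (n.+1%:R^-1) e0 e1 => e e0 e1.
have p2 := @pi_ge2 R.
have s1 : is_sign 1 by left.
rewrite (substitution_decreasing cos (fun x => - sin x)).
- apply: eq_integral => x; rewrite inE/= in_itv/= => /andP[h1 h2]; congr (_%:E).
  have xp : 0 < x < pi by apply/andP; split; lra.
  have sx : 0 < sin x by apply: sin_gt0_pi.
  by rewrite -[cos x]mul1r pull_cos// opprK mulfVK// gt_eqF.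
- lra.
- by move=> x y; rewrite !in_itv/= => /andP[h1 h2] /andP[h3 h4] xy; rewrite ltr_cos// in_itv/=; apply/andP; split; lra.
- by apply: contN; exact: cont_sin1.
apply: continuous_in_subspaceT => x; rewrite inE/= in_itv/= => /andP[h1 h2].
apply: pull_continuous => //; apply/andP; split.
  apply: lt_le_trans h1; have [] := cos_lt1 (pi - e); last by lra.
  by apply/andP; split; lra.
apply: le_lt_trans h2 _; have [] := cos_lt1 e; last by lra.
by apply/andP; split; lra.
Qed.

Lemma ang_itv_mono : nondecreasing_seq ang_itv.
Proof.
move=> m n mn; rewrite subsetEset => x; rewrite /ang_itv /= !in_itv/= => /andP[h1 h2].
have : n.+1%:R^-1 <= (m.+1%:R^-1 : R) by rewrite lef_pV2 ?posrE ?ltr0n// ler_nat.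
by move: (n.+1%:R^-1) (m.+1%:R^-1) h1 h2 => u v h1 h2 h; apply/andP; split; lra.
Qed.

Lemma bigcup_ang_itv : \bigcup_n ang_itv n = `]0, pi[%classic.
Proof.
apply/seteqP; split=> x.
  move=> [n _]; rewrite /ang_itv /= in_itv /= in_itv /= => /andP[h1 h2]; have /andP[e0 _] := inv_small n.
  move: (n.+1%:R^-1) e0 h1 h2 => e e0 h1 h2; by apply/andP; split; lra.
rewrite /= in_itv/= => /andP[x0 xpi].
have d0 : 0 < Num.min x (pi - x) by rewrite lt_min x0 subr_gt0.
have [n _ hn] := near_infty_natSinv_lt (PosNum d0).
exists n => //=; have := hn n (leqnn n); rewrite /= lt_min => /andP[h1 h2].
by rewrite /ang_itv /= in_itv/=; move: (n.+1%:R^-1) h1 h2 => u h1 h2; apply/andP; split; lra.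
Qed.

Lemma ang_cos n x : -1 < x < 1 -> cos_itv n x <-> ang_itv n (acos x).
Proof.
move=> hx; have /andP[a0 a1] := acos_interior x hx; have /andP[e0 e1] := inv_small n.
have p2 := @pi_ge2 R.
rewrite /cos_itv /ang_itv /= !in_itv/=; move: (n.+1%:R^-1) e0 e1 => e e0 e1.
rewrite -{1 2}(acosK (x := x)); last by rewrite in_itv/=; case/andP: hx => ? ?; rewrite !ltW.
have I y : 0 <= y <= pi -> y \in `[0, pi] by rewrite in_itv.
rewrite !(leNgt (cos _)) !ltr_cos ?I//; try by apply/andP; split; lra.
by rewrite -!leNgt andbC.
Qed.

Lemma bigcup_cos_itv : \bigcup_n cos_itv n = `]-1, 1[%classic.
Proof.
apply/seteqP; split=> x.
  move=> [n _]; have /andP[e0 e1] := inv_small n; have p2 := @pi_ge2 R.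
  rewrite /cos_itv /= in_itv /= in_itv /= => /andP[]; move: (n.+1%:R^-1) e0 e1 => e e0 e1 h1 h2; apply/andP; split.
    apply: lt_le_trans h1; have [] := cos_lt1 (pi - e); last by lra.
    by apply/andP; split; lra.
  apply: le_lt_trans h2 _; have [] := cos_lt1 e; last by lra.
  by apply/andP; split; lra.
rewrite /= in_itv/= => hx; have := acos_interior x hx.
have : `]0, pi[%classic (acos x) -> (\bigcup_n ang_itv n) (acos x) by rewrite bigcup_ang_itv.
rewrite /= in_itv/= => h /h[n _ hn]; exists n => //; exact/ang_cos.
Qed.

Lemma cos_itv_mono : nondecreasing_seq cos_itv.
Proof.
move=> m n mn; rewrite subsetEset => x hx.
have xi : -1 < x < 1.
  have : (\bigcup_n cos_itv n) x by exists m.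
  by rewrite bigcup_cos_itv /= in_itv.
apply/ang_cos => //; have /ang_cos := hx => /(_ xi).
by have := ang_itv_mono m n mn; rewrite subsetEset; apply.
Qed.

Lemma integral_pull_ge0 H : contf H -> (forall x, 0 <= H x) ->
  (\int[mu]_(x in `[(-1)%R, 1%R]) (pull 1 H x)%:E = (Ipi H)%:E)%E.
Proof.
move=> cH H0; have s1 : is_sign 1 by left.
have mp := pull_measurable 1 H s1 cH.
have mp' (A : set R) : measurable A -> measurable_fun A (fun x => (pull 1 H x)%:E).
  by move=> mA; apply/measurable_EFinP; exact: measurable_funS mp.
have mH (A : set R) : measurable A -> measurable_fun A (fun x => (H x)%:E).
  by move=> mA; exact: contf_measurable.
have p0 x : 0 <= pull 1 H x.
  rewrite /pull; case: ifP => // hx; rewrite divr_ge0//.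
  by rewrite mul1r sin_acos ?sqrtr_ge0//; case/andP: hx => ? ?; rewrite !ltW.
have l1 := @ge0_nondecreasing_set_cvg_integral _ (measurableTypeR R) R cos_itv (fun x => (pull 1 H x)%:E) mu cos_itv_mono.
have l2 := @ge0_nondecreasing_set_cvg_integral _ (measurableTypeR R) R ang_itv (fun x => (H x)%:E) mu ang_itv_mono.
rewrite bigcup_cos_itv in l1; rewrite bigcup_ang_itv in l2.
rewrite Ipi_oo//; transitivity (\int[mu]_(x in `](-1)%R, 1%R[) (pull 1 H x)%:E)%E.
  by apply: integral_itv_bndoo; exact: mp'.
have {}l1 := l1 (fun i => measurable_itv _) (fun i => mp' _ (measurable_itv _)) (fun i x _ => p0 x).
have {}l2 := l2 (fun i => measurable_itv _) (fun i => mH _ (measurable_itv _)) (fun i x _ => H0 x).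
apply: cvg_unique l1 _; first exact: ereal_hausdorff.
apply: cvg_trans l2; apply: near_eq_cvg; apply: nearW => i.
by symmetry; exact: integral_pull_compact.
Qed.

(** The sign -1 is reduced to 1 by the reflection x -> pi - x; positive and negative parts then
    reduce to the nonnegative case. *)
Lemma integral_pull sg H : is_sign sg -> contf H ->
  (\int[mu]_(x in `[(-1)%R, 1%R]) (pull sg H x)%:E = (Ipi H)%:E)%E.
Proof.
move=> hs; wlog -> : sg H hs / sg = 1.
  move=> W; case: (hs) => E cH; first by apply: W.
  have cH' : contf (fun x => H (pi - x)) by exact: (cont_comp (fun x => pi - x) H cH (contB _ _ (cont_cst pi) cont_id)).
  rewrite -Ipi_refl// -(W 1)//; last by left.
  apply: eq_integral => x _; congr (_%:E); rewrite /pull E mul1r mulN1r; case: ifP => // /andP[h1 h2].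
  by rewrite acosN ?ltW// sinB sinpi cospi mul0r sub0r mulN1r opprK.
move=> cH; rewrite integralE.
have cP : contf (fun x => Num.max (H x) 0) by cont.
have cN : contf (fun x => Num.max (- H x) 0) by cont.
have pos x : -1 < x < 1 -> 0 < sin (acos (1 * x)).
  by move=> hx; apply: sin_gt0_pi; rewrite mul1r; exact: acos_interior.
have EP : (fun x => (pull 1 H x)%:E)^\+%E = fun x => (pull 1 (fun x => Num.max (H x) 0) x)%:E.
  apply/funext => x; rewrite funeposE -EFin_max /pull; case: ifP => [/pos sx|]; last by rewrite maxxx.
  by rewrite maxr_pMl ?invr_ge0 ?(ltW sx)// mul0r.
have EN : (fun x => (pull 1 H x)%:E)^\-%E = fun x => (pull 1 (fun x => Num.max (- H x) 0) x)%:E.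
  apply/funext => x; rewrite funenegE -EFinN -EFin_max /pull; case: ifP => [/pos sx|]; last by rewrite oppr0 maxxx.
  by rewrite maxr_pMl ?invr_ge0 ?(ltW sx)// mul0r mulNr.
rewrite EP EN !integral_pull_ge0//; try by move=> x; rewrite le_max lexx orbT.
rewrite -EFinB -IpiB//; congr (_%:E); apply: eq_Ipi => x _.
have [h|h] := leP 0 (H x); first by rewrite (max_idPr _) ?subr0// oppr_le0.
by rewrite sub0r (max_idPl _) ?opprK// oppr_ge0 ltW.
Qed.

(** The finite set E allows a function to be altered at the mass points, which form a Lebesgue null
    set. *)
Lemma integral_pull_ae sg H g (E : seq R) : is_sign sg -> contf H -> measurable_fun setT g ->
  (forall th, 0 < th < pi -> sg * cos th \notin E -> g (sg * cos th) * sin th = H th) ->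
  (\int[mu]_(x in `[(-1)%R, 1%R]) (g x)%:E = (Ipi H)%:E)%E.
Proof.
move=> hs cH mg gH; rewrite -(integral_pull sg)//.
apply: ae_eq_integral => //.
- by apply/measurable_EFinP; exact: measurable_funS mg.
- by apply/measurable_EFinP; apply: measurable_funS (pull_measurable sg H hs cH).
have cE : countable ([set` [:: -1, 1 & E]] : set (measurableTypeR R)).
  by apply: finite_set_countable; exact: finite_seq.
exists [set` [:: -1, 1 & E]]; split.
- by apply: (@countable_measurable _ (measurableTypeR R)) => // x; exact: measurable_set1.
- exact: (@countable_lebesgue_measure0 R _ cE).
move=> x /=; apply: contra_notP => /negP h; rewrite /= in_itv/= => /andP[h1 h2].
have [n1 n2 nE] : [/\ x != -1, x != 1 & x \notin E].
  by move: h; rewrite !inE !negb_or => /and3P.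
have hx : -1 < x < 1 by rewrite !lt_neqAle h1 h2 eq_sym n1 n2.
have hsx : -1 < sg * x < 1 by rewrite sign_interior.
have tp := acos_interior _ hsx.
have Ex : sg * cos (acos (sg * x)) = x.
  rewrite acosK ?mulrA ?sign_mul ?mul1r// in_itv/=; case/andP: hsx => ? ?; by rewrite !ltW.
congr (_%:E); rewrite -{2}Ex pull_cos// -gH ?Ex//.
by rewrite mulfK// gt_eqF// sin_gt0_pi.
Qed.
End ChangeOfVariables.

(** * From the weak-type hypothesis for nu to its angular form *)

Section Reduction.
Context {R : realType}.
Local Notation mu := (@lebesgue_measure R).
Variables (alpha beta : R) (K : nat) (pts M : 'I_K -> R) (P : nat -> {poly R}) (a b u1 um1 p : R).
Hypotheses (M0 : forall i, 0 < M i) (orth : orthonormal_polys alpha beta pts M P).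
Hypotheses (p1 : 1 < p).
Variables (sg s t A B : R).
Hypotheses (hs : is_sign sg) (s0 : 0 <= s) (t0 : 0 <= t).
Hypothesis Hw : forall x, 0 < x < pi -> jacobi_w alpha beta (sg * cos x) * sin x = jac s t x.
Hypothesis Hu : forall x, 0 < x < pi -> jacobi_w a b (sg * cos x) = jac A B x.
Local Notation w := (jacobi_w alpha beta).
Local Notation wu := (weight_u a b u1 um1).
Let p0 : 0 < p := lt_trans ltr01 p1.
Let cj : contf (jac s t) := cont_jac s t s0 t0.
Implicit Types (x y d S : R) (H h k chi : R -> R).

Lemma measurable_powR_comp (r : R) (g : R -> R) : measurable_fun setT g -> measurable_fun setT (fun x => g x `^ r).
Proof. by move=> mg; exact: (measurableT_comp (measurable_powR r) mg). Qed.

Lemma measurable_cont (g : R -> R) : contf g -> measurable_fun setT g.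
Proof. by move=> cg; exact: continuous_measurable_fun. Qed.

Lemma measurable_jacobi (e f : R) : measurable_fun setT (jacobi_w e f).
Proof.
by apply: measurable_funM; apply: measurable_powR_comp; apply: measurable_cont;
  [apply: contB|apply: contD]; first [exact: cont_cst|exact: cont_id].
Qed.

Lemma jacobi_ge0 (e f x : R) : 0 <= jacobi_w e f x.
Proof. by rewrite mulr_ge0// powR_ge0. Qed.

Lemma nu_int_pull h H (E : seq R) : measurable_fun setT h -> contf H ->
  (forall x, 0 < x < pi -> sg * cos x \notin E -> h (sg * cos x) * jac s t x = H x) ->
  nu_int alpha beta pts M h = (Ipi H + \sum_i M i * h (pts i))%:E.
Proof.
move=> mh cH hH; rewrite /nu_int EFinD -sumEFin; congr (_ + _)%E.
apply: (integral_pull_ae sg H _ E) => //.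
  by apply: measurable_funM => //; exact: measurable_jacobi.
by move=> x xp xE; rewrite -mulrA Hw// hH.
Qed.

(** For sg = -1, the orthonormal polynomials of the reflected measure; the factor sg^n keeps the
    leading coefficients positive. *)
Definition mirror n : {poly R} := sg ^+ n *: (P n \Po (sg *: 'X)).
Local Notation P' := mirror.
Local Notation c := (fun i => sg * pts i).

Lemma sg_neq0 : sg != 0.
Proof. by case: hs => ->; rewrite ?oner_eq0// oppr_eq0 oner_eq0. Qed.
Lemma sg_sqr n : sg ^+ n * sg ^+ n = 1.
Proof. by rewrite -exprMn sign_mul// expr1n. Qed.

Lemma mirrorE n x : (P' n).[x] = sg ^+ n * (P n).[sg * x].
Proof. by rewrite hornerZ horner_comp hornerZ hornerX. Qed.

Lemma size_sgX : size (sg *: 'X : {poly R}) = 2%N.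
Proof. by rewrite size_scale ?sg_neq0// size_polyX. Qed.

Lemma size_mirror n : size (P' n) = n.+1.
Proof.
by rewrite size_scale ?expf_neq0 ?sg_neq0// size_comp_poly2 ?size_sgX//; case: orth => ->.
Qed.

Lemma lead_mirror n : 0 < lead_coef (P' n).
Proof.
rewrite lead_coefZ lead_coef_comp ?size_sgX//; case: orth => sP [lP _].
by rewrite sP lead_coefZ lead_coefX mulr1/= mulrCA sg_sqr mulr1.
Qed.

Lemma inner_mirror i j : inner s t K c M (P' i) (P' j) = (i == j)%:R.
Proof.
case: orth => _ [_ /(_ i j)].
pose H x := (P i).[sg * cos x] * (P j).[sg * cos x] * jac s t x.
have cp n : contf (fun x => (P n).[sg * cos x]).
  by apply: cont_horner; apply: contM; [exact: cont_cst|exact: cont_cos1].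
have cH : contf H by apply: contM => //; apply: contM.
have mP n : measurable_fun setT (fun x => (P n).[x]) by apply: measurable_cont; apply: cont_horner; exact: cont_id.
rewrite (nu_int_pull _ H [::])//; last first.
  by apply: measurable_funM.
move=> [E]; have -> : inner s t K c M (P' i) (P' j) =
    sg ^+ i * sg ^+ j * (Ipi H + \sum_i0 M i0 * ((P i).[pts i0] * (P j).[pts i0])).
  rewrite /inner mulrDr -IpiZ// mulr_sumr; congr (_ + _).
    by apply: eq_Ipi => x _; rewrite !mirrorE /H; ring.
  by apply: eq_bigr => i0 _; rewrite !mirrorE !mulrA sign_mul// !mul1r; ring.
rewrite E; have [->|] := eqVneq i j; first by rewrite sg_sqr mulr1.
by rewrite mulr0.
Qed.

Lemma kernel_mirror n x y : kernelL P' n x y = kernelL P n (sg * x) (sg * y).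
Proof.
apply: eq_bigr => j _; rewrite !mirrorE.
by rewrite mulrACA sg_sqr mul1r.
Qed.

Section Test.
Variables (d : R) (n : nat) (k : R -> R).
Hypotheses (d0 : 0 < d) (d1 : d < pi / 2) (ck : contf k) (sk : forall x, k x != 0 -> d <= x <= pi - d).
Local Notation E := (codom pts).

(** This is u^-1 f for the test function f: k transported to (-1, 1), multiplied by sin to
    compensate the division in [pull], and set to 0 at the mass points so that the discrete part of
    nu contributes nothing to the norm of f or to the partial sums. *)
Definition test_dual x : R := if x \in E then 0 else pull sg (fun y => k y * sin y) x.
Definition test_fun x : R := jacobi_w a b x * test_dual x.

Lemma cont_ksin : contf (fun y => k y * sin y).
Proof. by apply: contM => //; exact: cont_sin1. Qed.

Lemma test_dual_cos x : 0 < x < pi -> sg * cos x \notin E -> test_dual (sg * cos x) = k x.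
Proof.
by move=> xp /negbTE xE; rewrite /test_dual xE pull_cos// mulfK// gt_eqF// sin_gt0_pi.
Qed.

Lemma test_dual_pts i : test_dual (pts i) = 0.
Proof. by rewrite /test_dual codom_f. Qed.

Lemma measurable_test_dual : measurable_fun setT test_dual.
Proof.
apply: measurable_fun_ifT; last 2 first.
- exact: measurable_cst.
- by apply: pull_measurable => //; exact: cont_ksin.
apply: (measurable_fun_bool true); rewrite setTI.
have cE : countable ([set` E] : set (measurableTypeR R)).
  by apply: finite_set_countable; exact: finite_seq.
rewrite [X in measurable X](_ : _ = [set` E]); last by apply/seteqP; split => x.
by apply: (@countable_measurable _ (measurableTypeR R)) => // x; exact: measurable_set1.
Qed.

Lemma measurable_test_fun : measurable_fun setT test_fun.
Proof. by apply: measurable_funM; [exact: measurable_jacobi|exact: measurable_test_dual]. Qed.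

Lemma test_dualE x : (wu x)^-1 * test_fun x = test_dual x.
Proof.
have [|h] := boolP ((-1 < x) && (x < 1)); last first.
  suff -> : test_fun x = 0 by rewrite /test_dual /pull (negbTE h) mulr0; case: ifP.
  by rewrite /test_fun /test_dual /pull (negbTE h); case: ifP; rewrite mulr0.
move=> /andP[h1 h2]; rewrite /test_fun /weight_u (lt_eqF h2) (gt_eqF h1) /jacobi_w mulKf//.
by rewrite mulf_neq0// gt_eqF// powR_gt0; lra.
Qed.

Definition energy x : R := (jacc d A B x * `|k x|) `^ p * jac s t x.

Lemma cont_energy : contf energy.
Proof.
have cjd := cont_jacc d A B d0 d1.
apply: contM => //; apply: cont_powR_ge0; rewrite ?(ltW p0)//; last by apply: contM => //; exact: cont_norm.
by move=> x; rewrite mulr_ge0 ?jac_ge0.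
Qed.

Lemma nu_int_test : nu_int alpha beta pts M (fun x => `|test_fun x| `^ p) = (Ipi energy)%:E.
Proof.
rewrite (nu_int_pull _ energy E).
- rewrite big1 ?addr0// => i _; rewrite /test_fun test_dual_pts mulr0 normr0 powR0 ?mulr0// gt_eqF//.
- apply: measurable_powR_comp; apply: measurableT_comp => //; exact: measurable_test_fun.
- exact: cont_energy.
move=> x xp xE; rewrite /test_fun test_dual_cos// Hu// /energy normrM.
rewrite (ger0_norm (jac_ge0 _ _ _)); have [->|kx] := eqVneq (k x) 0; first by rewrite normr0 !mulr0.
by rewrite jaccE//; exact: sk.
Qed.

Lemma test_in_Lp : in_Lp alpha beta pts M p test_fun.
Proof. by split; [exact: measurable_test_fun|rewrite nu_int_test ltry]. Qed.

Definition dual_sum x : R := Ipi (fun y => kernelL P n x (sg * cos y) * k y * jac s t y).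

Lemma cont_kernel_snd x : contf (fun y => kernelL P n x (sg * cos y)).
Proof.
rewrite /kernelL; apply: cont_sum => j _; apply: contM; first exact: cont_cst.
by apply: cont_horner; apply: contM; [exact: cont_cst|exact: cont_cos1].
Qed.

Lemma partial_sum_test x :
  partial_sum alpha beta pts M P n (fun y => (wu y)^-1 * test_fun y) x = dual_sum x.
Proof.
rewrite /partial_sum (_ : (fun y => _) = (fun y => kernelL P n x y * test_dual y)); last first.
  by apply/funext => y; rewrite test_dualE.
have ck1 := cont_kernel_snd x.
rewrite (nu_int_pull _ (fun y => kernelL P n x (sg * cos y) * k y * jac s t y) E)/=.
- by rewrite big1 ?addr0// => i _; rewrite test_dual_pts !mulr0.
- apply: measurable_funM; last exact: measurable_test_dual.
  apply: measurable_cont; rewrite /kernelL; apply: cont_sum => j _.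
  by apply: contM; [exact: cont_cst|apply: cont_horner; exact: cont_id].
- by apply: contM => //; apply: contM.
by move=> y yp yE; rewrite test_dual_cos.
Qed.

Lemma dual_sum_cos x : dual_sum (sg * cos x) = psum s t P' n k x.
Proof. by apply: eq_Ipi => y _; rewrite kernel_mirror. Qed.

Lemma measurable_dual_sum : measurable_fun setT dual_sum.
Proof.
apply: measurable_cont.
rewrite (_ : dual_sum = fun x => \sum_(j < n.+1) (P j).[x] * Ipi (fun y => (P j).[sg * cos y] * k y * jac s t y)).
  by apply: cont_sum => j _; apply: contM; [apply: cont_horner; exact: cont_id|exact: cont_cst].
have cq j : contf (fun y => (P j).[sg * cos y] * k y * jac s t y).
  apply: contM => //; apply: contM => //; apply: cont_horner; apply: contM; [exact: cont_cst|exact: cont_cos1].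
apply/funext => x; transitivity (Ipi (fun y => \sum_(j < n.+1) (P j).[x] * ((P j).[sg * cos y] * k y * jac s t y))).
  by apply: eq_Ipi => y _; rewrite /kernelL !mulr_suml; apply: eq_bigr => j _; ring.
rewrite Ipi_sum; last by move=> j _; apply: contM => //; exact: cont_cst.
by apply: eq_bigr => j _; rewrite IpiZ.
Qed.

Lemma measurable_weight_u : measurable_fun setT wu.
Proof.
have meq (c0 : R) : measurable_fun setT (fun x : R => x == c0).
  apply: measurable_fun_eqr; [exact: measurable_id|exact: measurable_cst].
apply: measurable_fun_ifT => //; apply: measurable_fun_ifT => //.
exact: measurable_jacobi.
Qed.

Variables (chi : R -> R) (S : R).
Hypotheses (cchi : contf chi) (schi : forall x, chi x != 0 -> d <= x <= pi - d)
  (chi01 : forall x, 0 <= chi x <= 1) (S0 : 0 < S).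
Definition level x : R := chi x * ramp (`|jacc d A B x * psum s t P' n k x| / S) * jac s t x.

Lemma level_ge0 x : 0 <= level x.
Proof. by rewrite !mulr_ge0 ?ramp_ge0 ?jac_ge0//; case/andP: (chi01 x). Qed.

Lemma cont_level : contf level.
Proof.
have cf := cont_psum s t P' s0 t0 n k ck; have cjd := cont_jacc d A B d0 d1.
apply: contM => //; apply: contM => //; apply: cont_ramp; apply: contM; last exact: cont_cst.
by apply: cont_norm; apply: contM.
Qed.

Local Notation G := (fun x => wu x * partial_sum alpha beta pts M P n (fun y => (wu y)^-1 * test_fun y) x).

(** chi times the ramp is at most 1 and vanishes unless |G| > S, hence minorises the indicator of
    the level set. All S' <= S are covered because the rearrangement is an infimum over levels. *)
Lemma nu_set_level S' : S' <= S -> ((Ipi level)%:E <= nu_set alpha beta pts M [set x | (S' < `|G x|)%R])%E.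
Proof.
move=> SS; set Q := [set x | _].
have mQ : measurable (Q : set (measurableTypeR R)).
  have mG : measurable_fun setT (fun x => `|G x|).
    apply: measurableT_comp => //; apply: measurable_funM; first exact: measurable_weight_u.
    by rewrite (_ : partial_sum _ _ _ _ _ _ _ = dual_sum); [exact: measurable_dual_sum|apply/funext; exact: partial_sum_test].
  have := mG measurableT `]S', +oo[%classic (measurable_itv _); rewrite setTI; congr measurable.
  by apply/seteqP; split=> x /=; rewrite /Q /= in_itv/= andbT.
have cl := cont_level.
rewrite /nu_set -[X in (X <= _)%E]adde0; apply: leeD; last first.
  by apply: sume_ge0 => i _; rewrite lee_fin mulr_ge0 ?(ltW (M0 i)).
rewrite -(integral_pull sg)// integral_mkcondr.
have mI : measurable (`[(-1)%R, 1%R]%classic : set (measurableTypeR R)) by exact: measurable_itv.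
have mw : measurable_fun setT (fun x : measurableTypeR R => (w x)%:E) by apply/measurable_EFinP; exact: measurable_jacobi.
apply: ge0_le_integral => //.
- move=> x _; rewrite lee_fin /pull; case: ifP => // hx; rewrite divr_ge0 ?level_ge0//.
  by rewrite ltW// sin_gt0_pi// acos_interior// sign_interior.
- by apply/measurable_EFinP; apply: measurable_funS (pull_measurable sg _ hs cl).
- apply: (measurable_funS measurableT) => //.
  by apply/(measurable_restrictT _ mQ); exact: measurable_funS mw.
move=> x _; rewrite patchE.
have [hx|hx] := boolP ((-1 < x) && (x < 1)); last first.
  rewrite /pull (negbTE hx); case: ifP => _ //; by rewrite lee_fin jacobi_ge0.
have hsx : -1 < sg * x < 1 by rewrite sign_interior.
set th := acos (sg * x); have thp : 0 < th < pi by exact: acos_interior.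
have Ex : x = sg * cos th.
  rewrite /th acosK ?mulrA ?sign_mul ?mul1r// in_itv/=; case/andP: hsx => ? ?; by rewrite !ltW.
have sth : 0 < sin th by exact: sin_gt0_pi.
rewrite Ex pull_cos// -Ex.
have [l0|ln] := eqVneq (level th) 0.
  rewrite l0 mul0r; case: ifP => _ //; by rewrite lee_fin jacobi_ge0.
have [cn rn] : chi th != 0 /\ ramp (`|jacc d A B th * psum s t P' n k th| / S) != 0.
  by move: ln; rewrite /level !mulf_eq0 !negb_or => /andP[/andP[]].
have xQ : Q x.
  rewrite /Q /= partial_sum_test Ex dual_sum_cos.
  have -> : wu (sg * cos th) = jacc d A B th.
    rewrite jaccE ?schi// -Hu// /weight_u; have /andP[h1 h2] : -1 < sg * cos th < 1 by rewrite -Ex.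
    by rewrite (lt_eqF h2) (gt_eqF h1).
  by apply: le_lt_trans SS _; move/ramp_gt1: rn; rewrite ltr_pdivlMr// mul1r.
rewrite mem_set// lee_fin Ex -(mulfK (lt0r_neq0 sth) (w _)) Hw//.
apply: ler_wpM2r; first by rewrite invr_ge0 ltW.
rewrite /level -[leRHS]mul1r; apply: ler_wpM2r; first exact: jac_ge0.
case/andP: (chi01 th) => ? ?.
by rewrite -[leRHS]mulr1; apply: ler_pM; rewrite ?ramp_ge0 ?ramp_le1.
Qed.

(** At t equal to half of the integral of [level], no S' < S is admissible in the rearrangement,
    since its distribution function is at least the whole integral. Halving makes the comparison
    strict. *)
Lemma weak_norm_level : 0 < Ipi level ->
  (((Ipi level / 2) `^ p^-1 * S)%:E <= weak_Lp_norm alpha beta pts M p G)%E.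
Proof.
move=> l0; have l20 : 0 < Ipi level / 2 by rewrite divr_gt0.
apply: (@le_trans _ _ (((Ipi level / 2) `^ p^-1)%:E * rearrangement alpha beta pts M G (Ipi level / 2))%E).
  rewrite EFinM; apply: lee_wpmul2l; first by rewrite lee_fin powR_ge0.
  apply: le_ereal_inf_tmp => _ [S' [S'0 hS'] <-]; rewrite lee_fin leNgt; apply/negP => SS.
  have := le_trans (nu_set_level S' (ltW SS)) hS'; rewrite lee_fin; lra.
by apply: ereal_sup_ubound; exists (Ipi level / 2).
Qed.
End Test.

(** The bound is raised to the power p; the factor 2 undoes the halving in [weak_norm_level]. *)
Lemma weak_type_mirror (C : R) : 0 < C ->
  (forall (n : nat) (f : R -> R), in_Lp alpha beta pts M p f ->
       (forall x, nu_integrable alpha beta pts M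
          (fun y => kernelL P n x y * ((wu y)^-1 * f y))) /\
       (weak_Lp_norm alpha beta pts M p
          (fun x => (wu x * partial_sum alpha beta pts M P n (fun y => (wu y)^-1 * f y) x)%R)
        <= (C * Lp_norm alpha beta pts M p f)%R%:E)%E) ->
  weak_type s t P' A B p (2 * C `^ p).
Proof.
move=> C0 HC d n k chi S d0 d1 ck cchi sk schi chi01 S0.
have Cp : 0 <= 2 * C `^ p by rewrite mulr_ge0// powR_ge0.
have e0 : 0 <= Ipi (energy d k) by apply: Ipi_ge0 => x _; rewrite mulr_ge0 ?powR_ge0 ?jac_ge0.
have lv := weak_norm_level d n k d0 d1 ck chi S cchi schi chi01 S0.
change (S `^ p * Ipi (level d n k chi S) <= 2 * C `^ p * Ipi (energy d k)).
have [l0|l0] := leP (Ipi (level d n k chi S)) 0.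
  apply: (@le_trans _ _ 0); last exact: mulr_ge0.
  by rewrite mulr_ge0_le0 ?powR_ge0.
have [_ H] := HC n _ (test_in_Lp d k d0 d1 ck sk).
have := le_trans (lv l0) H; rewrite /Lp_norm (nu_int_test d k d0 d1 ck sk)/= lee_fin => H2.
set m := Ipi (level _ _ _ _ _) in l0 H2 *; set N := Ipi (energy d k) in e0 H2 *.
have pV : p^-1 * p = 1 by rewrite mulVf// gt_eqF.
have [v v0 Em] : exists2 v, 0 <= v & m = 2 * v.
  by exists (m / 2); [rewrite divr_ge0// ltW|rewrite mulrC divfK].
have E2 : m / 2 = v by rewrite Em mulrC mulKf.
rewrite E2 in H2; rewrite Em.
have /= := ge0_ler_powR (ltW p0) _ _ H2; rewrite !nnegrE !mulr_ge0 ?powR_ge0 ?(ltW S0) ?(ltW C0)// => /(_ isT isT).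
rewrite !powRM ?powR_ge0 ?(ltW S0) ?(ltW C0)// -!powRrM pV !powRr1//; lra.
Qed.
End Reduction.

Lemma jacobi_cos (R : realType) (e f x : R) :
  jacobi_w e f (1 * cos x) = jac e f x /\ jacobi_w e f (-1 * cos x) = jac f e x.
Proof. by split; rewrite ?mul1r// mulN1r /jacobi_w /jac opprK mulrC. Qed.

Lemma jac_sin (R : realType) (e f x : R) : 0 < x < pi ->
  jac e f x * sin x = jac (e + 2^-1) (f + 2^-1) x.
Proof. by move=> xp; rewrite jacD// jac_half. Qed.

Theorem theorem15 (R : realType) (alpha beta : R) (k : nat)
  (pts M : 'I_k -> R) (P : nat -> {poly R}) (a b u1 um1 p : R) :
  - (2^-1) <= alpha -> - (2^-1) <= beta ->
  (forall i, -1 <= pts i <= 1) -> injective pts ->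
  (forall i, 0 < M i) ->
  orthonormal_polys alpha beta pts M P ->
  0 < u1 -> 0 < um1 ->
  1 < p ->
  (exists C : R, 0 < C /\
     forall (n : nat) (f : R -> R), in_Lp alpha beta pts M p f ->
       (forall x, nu_integrable alpha beta pts M
          (fun y => kernelL P n x y * ((weight_u a b u1 um1 y)^-1 * f y))) /\
       (weak_Lp_norm alpha beta pts M p
          (fun x => (weight_u a b u1 um1 x *
             partial_sum alpha beta pts M P n
               (fun y => (weight_u a b u1 um1 y)^-1 * f y) x)%R)
        <= (C * Lp_norm alpha beta pts M p f)%R%:E)%E) ->
  `|a + (alpha + 1) * (p^-1 - 2^-1)| < 4^-1 /\
  `|b + (beta + 1) * (p^-1 - 2^-1)| < 4^-1.
Proof.
move=> ha hb hpts _ M0 orth _ _ p1 [C [C0 HC]].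
have sa : 0 <= alpha + 2^-1 by lra.
have sb : 0 <= beta + 2^-1 by lra.
have half (z : R) : z + 1 = z + 2^-1 + 2^-1 by field.
have Cp : 0 <= 2 * C `^ p by rewrite mulr_ge0// powR_ge0.
(* One statement serves both endpoints; (A, B) and (s, t) are the exponents of the weights read from
   the endpoint sg. *)
have range (sg s t A B : R) : is_sign sg -> 0 <= s -> 0 <= t ->
    (forall x, 0 < x < pi -> jacobi_w alpha beta (sg * cos x) * sin x = jac s t x) ->
    (forall x, 0 < x < pi -> jacobi_w a b (sg * cos x) = jac A B x) ->
    `|A + (s + 2^-1) * (p^-1 - 2^-1)| < 4^-1.
  move=> hs s0 t0 Hw Hu.
  have cpts i : -1 <= sg * pts i <= 1.
    by have := hpts i; case: hs => ->; rewrite ?mul1r ?mulN1r// => /andP[h1 h2]; apply/andP; split; lra.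
  apply: (weak_type_range s t k (fun i => sg * pts i) M (mirror P sg) s0 t0 cpts M0 _ _ _ A B p _ p1 Cp).
  - exact: (size_mirror alpha beta k pts M P orth sg hs).
  - exact: (lead_mirror alpha beta k pts M P orth sg hs).
  - exact: (inner_mirror alpha beta k pts M P orth sg s t hs s0 t0 Hw).
  - exact: (weak_type_mirror alpha beta k pts M P a b u1 um1 p M0 p1 sg s t A B hs s0 t0 Hw Hu C C0 HC).
split; rewrite half.
- apply: (range 1 (alpha + 2^-1) (beta + 2^-1) a b) => //; first by left.
    by move=> x xp; have [-> _] := jacobi_cos R alpha beta x; exact: jac_sin.
  by move=> x xp; have [] := jacobi_cos R a b x.
apply: (range (-1) (beta + 2^-1) (alpha + 2^-1) b a) => //; first by right.
  by move=> x xp; have [_ ->] := jacobi_cos R alpha beta x; exact: jac_sin.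
by move=> x xp; have [] := jacobi_cos R a b x.
Qed.
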